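(* Let $K$ be an algebraically closed field of characteristic $2$, let $q=2^e\ge 4$ be a power of $2$, and let $\lambda\in K\setminus\{0,1\}$. Let $C\subset\mathbb P^2$ be the smooth plane curve over $K$, of degree $q+1$ and genus $g_C=q(q-1)/2$, given by $$Z\prod_{\alpha\in\mathbb F_q}(X+\alpha Y+\alpha^2 Z)+\lambda Y^{q+1}=0.$$ Then $\mathrm{Aut}(C)\cong \mathrm{PGL}(2,\mathbb F_q)$. In particular, $|\mathrm{Aut}(C)|=q^3-q$, and $|\mathrm{Aut}(C)|>84(g_C-1)$ if $q\ge 64$.
   Context: $(X:Y:Z)$ are homogeneous coordinates on $\mathbb P^2$ over $K$, and $\mathbb F_q\subset K$ is the subfield with $q$ elements. $\mathrm{Aut}(C)$ denotes the group of all automorphisms of $C$ as an algebraic curve over $K$. *)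

(* Defs.v *)
(* Mathematical Components, with the classical axioms of mathcomp.classical. *)
From HB Require Import structures.
From mathcomp Require Import all_boot all_order all_algebra all_fingroup.
From mathcomp Require Import center finmap.
From mathcomp Require Import boolp classical_sets functions cardinality.
From mathcomp Require Import mpoly.

Set Implicit Arguments.
Unset Strict Implicit.
Unset Printing Implicit Defensive.

Import GRing.Theory.
Local Open Scope ring_scope.

Section PlaneCurve.
Variable K : closedFieldType.

(* Points of the projective plane: the lines through 0 in K^3. *)
Definition proj_plane := {P : {vspace 'rV[K]_3} | \dim P == 1%N}.

(* Homogeneous coordinates of P are only defined up to a nonzero factor; here
   one representative is chosen. Vanishing of a form at it does not depend on
   the choice. *)
Definition hcoord (P : proj_plane) : 'I_3 -> K := vpick (val P) 0.

Definition tuple_eval (G : 3.-tuple {mpoly K[3]}) (v : 'I_3 -> K) : 'rV[K]_3 :=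
  \row_i (tnth G i).@[v].

Section Curve.
Variable F : {mpoly K[3]}.

Definition smooth_curve : Prop :=
  forall P : proj_plane, F.@[hcoord P] = 0 ->
    exists i : 'I_3, (F^`M(i)).@[hcoord P] != 0.

(* [coord_ring_dim n h]: the degree-n part of the homogeneous coordinate ring
   K[X,Y,Z]/(F) has dimension h, i.e. some h forms of degree n are a basis of
   the forms of degree n modulo the multiples of F. *)
Definition coord_ring_dim (n h : nat) : Prop :=
  exists2 B : 'I_h -> {mpoly K[3]}, forall i, B i \is n.-homog &
    forall G : {mpoly K[3]}, G \is n.-homog ->
      exists! c : 'rV[K]_h,
        exists H : {mpoly K[3]}, G = \sum_i c 0 i *: B i + H * F.

(* The (arithmetic) genus 1 - P(0), where P(n) = a n + (1 - g) is the Hilbert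
   polynomial of the curve. For a smooth curve this is the genus. *)
Definition has_genus (g : nat) : Prop :=
  exists a n0 : nat, forall n, (n0 <= n)%N ->
    exists2 h, coord_ring_dim n h & (h + g = a * n + 1)%N.

(* Closed points; K being algebraically closed, these are the K-points. *)
Definition curve := {P : proj_plane | F.@[hcoord P] == 0}.

Definition ccoord (P : curve) : 'I_3 -> K := hcoord (val P).

(* Morphisms of varieties C -> C: in a Zariski neighbourhood {h != 0} of every
   point, f is given by forms G_0, G_1, G_2 of the same degree without common
   zero in that neighbourhood. *)
Definition regular_map (f : curve -> curve) : Prop :=
  forall P : curve,
    exists (d e : nat) (h : {mpoly K[3]}) (G : 3.-tuple {mpoly K[3]}),
    [/\ h \is e.-homog, forall i, tnth G i \is d.-homog,
        h.@[ccoord P] != 0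
      & forall Q : curve, h.@[ccoord Q] != 0 ->
          tuple_eval G (ccoord Q) != 0 /\
          val (val (f Q)) = <[tuple_eval G (ccoord Q)]>%VS].

Definition is_automorphism (f : curve -> curve) : Prop :=
  regular_map f /\
  exists g : curve -> curve, [/\ cancel f g, cancel g f & regular_map g].

Record curveAut := CurveAut { aut_fun :> curve -> curve;
                      _ : `[< is_automorphism aut_fun >] }.

HB.instance Definition _ := [isSub for aut_fun].
HB.instance Definition _ := [Choice of curveAut by <:].

Lemma autP (f : curveAut) : is_automorphism f.
Proof. exact/asboolP/(valP f). Qed.

Lemma aut_eqP (f g : curveAut) : aut_fun f = aut_fun g -> f = g.
Proof. by move=> fg; apply: val_inj. Qed.

End Curve.

Lemma mevalZ_homog (p : {mpoly K[3]}) d (c : K) (v : 'I_3 -> K) :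
  p \is d.-homog -> p.@[fun i => c * v i] = c ^+ d * p.@[v].
Proof.
move=> /dhomogP hp; rewrite !mevalE mulr_sumr; apply: eq_big_seq => m /hp hm.
rewrite mulrCA; congr (_ * _).
under eq_bigr do rewrite exprMn.
by rewrite big_split /= prodrXr -hm /= mdegE.
Qed.

Lemma comp_mpoly_homog (p : {mpoly K[3]}) d e (G : 3.-tuple {mpoly K[3]}) :
  p \is d.-homog -> (forall i, tnth G i \is e.-homog) ->
  p \mPo G \is (e * d)%N.-homog.
Proof.
move=> /dhomogP hp hG; rewrite comp_mpolyE big_seq; apply: rpred_sum => m /hp hm.
apply: rpredZ; rewrite -hm /= mdegE big_distrr /=.
elim/big_ind2: _ => [|p1 d1 p2 d2 h1 h2|i _]; first exact: dhomog1.
- exact: dhomogM.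
- exact: dhomogMn.
Qed.

Lemma hcoord_line (P : proj_plane) (w : 'rV[K]_3) :
  val P = <[w]>%VS -> exists2 c : K, c != 0 & hcoord P = fun i => c * w 0 i.
Proof.
move=> hP.
have P0 : vpick (val P) != 0.
  by rewrite vpick0 -dimv_eq0 (eqP (valP P)).
have : vpick (val P) \in <[w]>%VS by rewrite -hP memv_pick.
case/vlineP=> c hc; exists c.
  by apply: contraNneq P0 => c0; rewrite hc c0 scale0r.
by apply/funext => i; rewrite /hcoord hc mxE.
Qed.

Lemma hcoord_span (P : proj_plane) : val P = <[vpick (val P)]>%VS.
Proof.
apply/eqP; rewrite eq_sym eqEdim -memvE memv_pick /= dim_vline vpick0.
by rewrite -dimv_eq0 (eqP (valP P)).
Qed.

Section AutGroup.
Variable F : {mpoly K[3]}.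
Implicit Types f g : curve F -> curve F.

Lemma regular_map_id : regular_map (@id (curve F)).
Proof.
move=> P; exists 1%N, 0%N, 1, [tuple 'X_i | i < 3].
have GE (Q : curve F) : tuple_eval [tuple 'X_i | i < 3] (ccoord Q)
    = vpick (val (val Q)).
  by apply/rowP => i; rewrite mxE tnth_mktuple mevalXU.
split=> [|i||Q _]; first exact: dhomog1.
- by rewrite tnth_mktuple dhomogX; apply/eqP/mdeg1.
- by rewrite meval1 oner_eq0.
- by rewrite GE vpick0 -dimv_eq0 (eqP (valP (val Q))) -hcoord_span.
Qed.

Lemma regular_map_comp f g :
  regular_map f -> regular_map g -> regular_map (f \o g).
Proof.
move=> rf rg P; have [d [e [h [G [hh hG hP GP]]]]] := rg P.
have [d' [e' [h' [G' [hh' hG' hP' GP']]]]] := rf (g P).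
have cE (Q : curve F) : h.@[ccoord Q] != 0 -> exists2 c : K, c != 0 &
    ccoord (g Q) = fun i => c * (tnth G i).@[ccoord Q].
  move=> /GP [_ /hcoord_line [c c0 hc]]; exists c => //.
  by rewrite /ccoord hc; apply/funext => i; rewrite mxE.
exists (d * d')%N, (e + d * e')%N, (h * (h' \mPo G)),
  [tuple tnth G' i \mPo G | i < 3]; split.
- by apply: dhomogM => //; apply: comp_mpoly_homog.
- by move=> i; rewrite tnth_mktuple; apply: comp_mpoly_homog.
- have [c c0 hc] := cE P hP; rewrite mevalM mulf_neq0 // comp_mpoly_meval.
  by move: hP'; rewrite hc (mevalZ_homog _ _ hh') mulf_eq0 => /norP[].
move=> Q; rewrite mevalM mulf_eq0 comp_mpoly_meval => /norP[hQ h'Q].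
have [c c0 hc] := cE Q hQ.
have h'gQ : h'.@[ccoord (g Q)] != 0.
  by rewrite hc (mevalZ_homog _ _ hh') mulf_neq0 // expf_neq0.
have GE : tuple_eval G' (ccoord (g Q)) =
    c ^+ d' *: tuple_eval [tuple tnth G' i \mPo G | i < 3] (ccoord Q).
  apply/rowP => i; rewrite !mxE tnth_mktuple comp_mpoly_meval hc.
  exact: mevalZ_homog.
have [] := GP' _ h'gQ; rewrite GE => + ->.
rewrite scaler_eq0 negb_or => /andP[cd0 G0]; split=> //.
apply: subv_anti; apply/andP; split; rewrite -memvE.
  by rewrite memvZ ?memv_line.
by rewrite -[X in X \in _](scalerK cd0) memvZ ?memv_line.
Qed.

Lemma is_automorphism_id : is_automorphism (@id (curve F)).
Proof. by split; [|exists id; split=> //]; exact: regular_map_id. Qed.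

Lemma is_automorphism_comp f g :
  is_automorphism f -> is_automorphism g -> is_automorphism (f \o g).
Proof.
move=> [rf [f' [ff' f'f rf']]] [rg [g' [gg' g'g rg']]].
split; first exact: regular_map_comp.
exists (g' \o f'); split; [exact: can_comp|exact: can_comp|].
exact: regular_map_comp.
Qed.

Lemma is_automorphism_inv f : is_automorphism f ->
  exists g, [/\ is_automorphism g, cancel f g & cancel g f].
Proof. by move=> [rf [g [fg gf rg]]]; exists g; do !split=> //; exists f. Qed.

Definition aut_id : curveAut F := CurveAut (asboolT is_automorphism_id).
Definition aut_mul (f g : curveAut F) : curveAut F :=
  CurveAut (asboolT (is_automorphism_comp (autP f) (autP g))).
Definition aut_inv (f : curveAut F) : curveAut F :=
  let: exist g gP := cid (is_automorphism_inv (autP f)) in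
  let: And3 ag _ _ := gP in CurveAut (asboolT ag).

Lemma aut_invK (f : curveAut F) : cancel f (aut_inv f).
Proof. by rewrite /aut_inv; case: cid => g []. Qed.
Lemma aut_Kinv (f : curveAut F) : cancel (aut_inv f) f.
Proof. by rewrite /aut_inv; case: cid => g []. Qed.

Lemma aut_mulA : associative aut_mul.
Proof. by move=> f g h; apply: aut_eqP. Qed.
Lemma aut_mul1f : left_id aut_id aut_mul.
Proof. by move=> f; apply: aut_eqP. Qed.
Lemma aut_mulf1 : right_id aut_id aut_mul.
Proof. by move=> f; apply: aut_eqP. Qed.
Lemma aut_mulVf : left_inverse aut_id aut_inv aut_mul.
Proof. by move=> f; apply: aut_eqP; apply/funext => P; exact: aut_invK. Qed.
Lemma aut_mulfV : right_inverse aut_id aut_inv aut_mul.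
Proof. by move=> f; apply: aut_eqP; apply/funext => P; exact: aut_Kinv. Qed.

HB.instance Definition _ := isGroup.Build (curveAut F)
  aut_mulA aut_mul1f aut_mulf1 aut_mulVf aut_mulfV.

End AutGroup.
End PlaneCurve.

(* The centre of GL_2 consists of the scalar matrices. *)
Definition PGL2 (k : finFieldType) : groupType := coset_of 'Z('GL_2[k]).

Definition group_isomorphic (G H : groupType) : Prop :=
  exists f : G -> H, bijective f /\ {morph f : x y / (x * y)%g}.

(* This is 0 when T is infinite. *)
Definition cardinal (T : choiceType) : nat := #|` fset_set [set: T]|.

(* X, Y, Z are the variables number 0, 1, 2; iota identifies k with a subfield
   of K. *)
Definition curve_form (K : closedFieldType) (k : finFieldType)
    (iota : {rmorphism k -> K}) (lambda : K) : {mpoly K[3]} :=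
  'X_2 * \prod_(a : k) ('X_0 + iota a *: 'X_1 + iota a ^+ 2 *: 'X_2)
  + lambda *: 'X_1 ^+ #|k|.+1.

(* Main.v *)
(* Put tau(w, y) = \sum_(i < e) w^(2^i) y^(q - 2^(i+1)), so that
   tau(u^2 + u y, y) = u^q + u y^(q-1). Factoring X + T Y + T^2 Z in T shows that
     F = Z X^q + X Z^q + Y tau(X Z, Y) + lambda Y^(q+1),
   from which smoothness, the genus and the invariance of F under the natural
   action of GL_2(F_q) on binary quadratic forms x s^2 + y s t + z t^2 follow; only
   scalar matrices act trivially.

   Conversely let phi be an automorphism. The line Y = 0 meets C in q + 1 points;
   for a line L through exactly one of them, the pullback of L / Y has at most q
   poles. A product of m lines can serve as its denominator as soon as it vanishes
   at all poles, and one of these lines, l, can be cancelled if the number of poles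
   on l lost in this way is at most q - m + 1. If the poles were not collinear, one
   could take the line through two of them and one general line through each pole
   outside it, and cancel all of them, making L / Y constant. Hence phi^-1(Y = 0)
   is contained in a line, which is a common denominator of the pullbacks of X / Y
   and Z / Y: phi is given by a matrix M, and F o M = c F. The Hessian matrix of F
   vanishes exactly where Y = 0, so M preserves this line. After rescaling,
   comparing gradients shows that the entries of M lie in F_q, and then F o M = c F
   forces c = 1 and M to come from GL_2(F_q). *)
Require Import Defs.
From HB Require Import structures.
From mathcomp Require Import all_boot all_order all_algebra all_fingroup.
From mathcomp Require Import ring zify separable finfield center finmap.
From mathcomp Require Import boolp classical_sets functions cardinality.
From mathcomp Require Import mpoly.

Set Implicit Arguments.
Unset Strict Implicit.
Unset Printing Implicit Defensive.

Import GRing.Theory.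
Local Open Scope ring_scope.

(** * The group PGL_2 *)

(** A function on [C] is handled as a pair of forms compared outside a finite set, and divisors are
    replaced by divisibility of one-variable polynomials. Restrict to a line on which a point off
    [C] has been put at infinity: if the restriction of [F] divides that of a numerator [A], then
    [A] is a multiple of the line modulo [F], and the line cancels. This divisibility can be checked
    one root at a time. [C] meets [Y = 0] transversally, so every pole is simple and spoils at most
    one linear factor of the divisibility. If the numerator and the spoiled factors together have
    degree at most [q], the restriction of [F], of degree [q + 1], can divide their product only if
    the numerator vanishes on the line. This count allows [q] poles, not [q + 1]; hence the choice
    of [L] through a point of [Y = 0]. The result is the collinearity of [q] of the [q + 1]
    preimages. Omitting two different points gives two lines with at least two common points, hence
    a single line. The value [c = 1] comes from the term [w^2] of the trace, present because
    [q >= 4]; smoothness comes from the trace taking only the values 0 and 1 on [F_q]. *)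

Lemma sum_ord2 (V : nmodType) (f : 'I_2 -> V) : \sum_i f i = f 0 + f 1.
Proof. by rewrite !big_ord_recl big_ord0 addr0; congr (_ + f _); apply: val_inj. Qed.

Lemma mx2_eq (R : pzRingType) (A B : 'M[R]_2) : A 0 0 = B 0 0 -> A 0 1 = B 0 1 ->
  A 1 0 = B 1 0 -> A 1 1 = B 1 1 -> A = B.
Proof.
have ord2 (i : 'I_2) : i = 0 \/ i = 1.
  by case: i => [[|[|]]] // ?; [left|right]; apply: val_inj.
by move=> *; apply/matrixP => i j; case: (ord2 i) => ->; case: (ord2 j) => ->.
Qed.

Lemma det_mx2 (R : comPzRingType) (M : 'M[R]_2) : \det M = M 0 0 * M 1 1 - M 0 1 * M 1 0.
Proof.
rewrite (expand_det_row _ 0) sum_ord2 /cofactor !det_mx11 !mxE /=.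
have -> : lift 0 0 = 1 :> 'I_2 by apply: val_inj.
have -> : lift 1 0 = 0 :> 'I_2 by apply: val_inj.
by rewrite expr0 mul1r expr1 mulN1r mulrN.
Qed.

Lemma cardinal_bij (T : choiceType) (U : finType) (f : T -> U) :
  bijective f -> cardinal T = #|U|.
Proof.
case=> g fK gK; have fin : finite_set [set: T].
  apply: (@sub_finite_set _ _ (g @` [set: U])); last exact: finite_image.
  by move=> x _; exists (f x).
rewrite cardE -(size_map g); apply: perm_size; apply: uniq_perm.
- exact: fset_uniq.
- by rewrite map_inj_uniq ?enum_uniq //; exact: can_inj gK.
move=> x; rewrite in_fset_set // in_setT.
by apply/esym/mapP; exists (f x); rewrite ?mem_enum ?fK.
Qed.

(** The first isomorphism theorem for a target that is not known in advance to be finite; the map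
    out of [G] picks a preimage under [a]. Since every element normalizes [H], [coset H] is
    multiplicative on all of [gT]. *)
Lemma quotient_isomorphic (gT : finGroupType) (H : {group gT}) (G : groupType)
    (a : gT -> G) :
  (forall x, x \in 'N(H))%g -> {morph a : x y / (x * y)%g} ->
  (forall y, exists x, a x = y) -> (forall x, a x = 1%g <-> x \in H) ->
  group_isomorphic G (coset_of H).
Proof.
move=> nH aM a_surj ker_a.
pose r y := sval (cid (a_surj y)); have rK y : a (r y) = y by rewrite /r; case: cid.
have a1 : a 1%g = 1%g by apply/ker_a.
have aV x : a x^-1%g = (a x)^-1%g.
  by apply: (mulgI (a x)); rewrite -aM !mulgV.
have cM x y : coset H (x * y)%g = (coset H x * coset H y)%g by exact: morphM.
have cV x : coset H x^-1%g = (coset H x)^-1%g by exact: morphV.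
have a_eq x y : a x = a y <-> coset H x = coset H y.
  have -> : (coset H x = coset H y) <-> (x^-1 * y)%g \in H.
    have -> : (x^-1 * y)%g \in H <-> coset H (x^-1 * y)%g = 1%g.
      by split; [exact: coset_id | apply: coset_idr].
    rewrite cM cV; split=> [->|/(congr1 (fun z => coset H x * z)%g)].
      exact: mulVg.
    by rewrite mulKVg mulg1.
  rewrite -ker_a aM aV; split=> [->|/(congr1 (fun z => a x * z)%g)]; first exact: mulVg.
  by rewrite mulKVg mulg1.
exists (fun y => coset H (r y)); split.
  exists (fun C : coset_of H => a (repr C)) => [y|C].
    by rewrite -[RHS]rK; apply/a_eq; rewrite coset_reprK.
  by rewrite -[RHS]coset_reprK; apply/a_eq.
by move=> x y; rewrite -cM; apply/a_eq; rewrite aM !rK.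
Qed.

Section CenterGL2.
Variable k : finFieldType.

(** Commuting with the transvection [1 + delta_mx i j] amounts to commuting with [delta_mx i j],
    which kills the off-diagonal entries and equates the diagonal ones. *)
Lemma center_GL2P (u : {'GL_2[k]}) :
  reflect (exists a, GLval u = a%:M) (u \in 'Z('GL_2[k])%g).
Proof.
apply: (iffP (centerP _ _)) => [[_ cu]|[a ua]]; last first.
  split=> [|v _]; first by rewrite inE.
  apply: val_inj; rewrite -[LHS]/(GLval u *m GLval v) -[RHS]/(GLval v *m GLval u).
  by rewrite ua scalar_mxC.
have elem i j : i != j -> (1%:M + delta_mx i j : 'M[k]_2) \in unitmx.
  move=> ij; apply: (proj1 (@mulmx1_unit _ _ _ (1%:M - delta_mx i j) _)).
  rewrite mulmxDl !mulmxBr !mulmx1 mul1mx mul_delta_mx_0 1?eq_sym // subr0.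
  exact: subrK.
have h i j (ij : i != j) : GLval u *m delta_mx i j = delta_mx i j *m GLval u.
  pose v : {'GL_2[k]} := Sub (1%:M + delta_mx i j) (elem i j ij).
  have : GLval (u * v)%g = GLval (v * u)%g by rewrite (cu v) ?finset.in_setT.
  rewrite -[X in X = _]/(GLval u *m GLval v) -[X in _ = X]/(GLval v *m GLval u) /=.
  by rewrite mulmxDl mulmxDr mulmx1 mul1mx => /addrI.
have h01 := h 0 1 isT; have h10 := h 1 0 isT.
exists (GLval u 0 0).
have c (A B : 'M[k]_2) i j : A = B -> A i j = B i j by move=> ->.
have mE i j (A : 'M[k]_2) l m : (A *m delta_mx i j) l m = A l i * (m == j)%:R.
  rewrite mxE (bigD1 i) //= mxE eqxx big1 ?addr0 // => n ni.
  by rewrite mxE (negPf ni) mulr0.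
have Em i j (A : 'M[k]_2) l m : (delta_mx i j *m A) l m = (l == i)%:R * A j m.
  rewrite mxE (bigD1 j) //= mxE eqxx andbT big1 ?addr0 // => n ni.
  by rewrite mxE (negPf ni) andbF mul0r.
apply: mx2_eq; rewrite !mxE ?mulr1n ?mulr0n //.
- by have := c _ _ 1 1 h10; rewrite mE Em mulr0 mul1r.
- by have := c _ _ 1 1 h01; rewrite mE Em mulr1 mul0r.
by have := c _ _ 0 1 h01; rewrite mE Em mulr1 mul1r.
Qed.

Lemma card_center_GL2 : #|'Z('GL_2[k])%g| = #|k|.-1.
Proof.
rewrite -(cardsC1 (0 : k)) -(@card_in_imset _ _ (fun u : {'GL_2[k]} => GLval u 0 0)).
  congr #|pred_of_set _|; apply/finset.setP => a; rewrite !inE; apply/imsetP/idP.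
    case=> u /center_GL2P[b ub] ->; rewrite ub !mxE mulr1n.
    by apply: contraNneq (GL_det u) => b0; rewrite ub b0 det_scalar expr0n.
  move=> a0; have ua : (a%:M : 'M[k]_2) \in unitmx by rewrite unitmxE det_scalar unitfE expf_neq0.
  exists (Sub a%:M ua); last by rewrite !mxE.
  by apply/center_GL2P; exists a.
move=> u v /center_GL2P[a ua] /center_GL2P[b ub]; rewrite ua ub !mxE !mulr1n => ab.
by apply: val_inj; rewrite -[LHS]/(GLval u) ua ab -ub.
Qed.

Lemma card_PGL2 : #|{: coset_of 'Z('GL_2[k])%g}| = (#|k| ^ 3 - #|k|)%N.
Proof.
rewrite -cardsT -(quotientT 'Z('GL_2[k])) card_quotient; last first.
  exact: (normal_norm (center_normal _)).
rewrite -divgS ?center_sub // card_center_GL2 card_GL_2.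
have := card_finRing_gt1 k; case: #|k| => [|[|n]] // _ /=.
have -> : (n.+2 ^ 3 = n.+2 * n.+1 * n.+3 + n.+2)%N by ring.
have -> : (n.+2 * n.+1 ^ 2 * n.+3 = n.+2 * n.+1 * n.+3 * n.+1)%N by ring.
by rewrite addnK mulnK.
Qed.

End CenterGL2.

(** * Ternary forms *)

Notation ev A v := (A.@[fun_of_matrix v (@ord0 0)]).

Lemma ord3P (i : 'I_3) : [\/ i = 0, i = 1 | i = 2].
Proof.
case: i => [[|[|[|]]]] //= h; [apply: Or31|apply: Or32|apply: Or33];
  exact: val_inj.
Qed.

Lemma sum_ord3 (V : nmodType) (E : 'I_3 -> V) : \sum_i E i = E 0 + E 1 + E 2.
Proof.
rewrite !big_ord_recl big_ord0 addr0 -addrA.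
by congr (_ + (E _ + E _)); apply: val_inj.
Qed.

Lemma prod_ord3 (R : pzSemiRingType) (E : 'I_3 -> R) :
  \prod_i E i = E 0 * E 1 * E 2.
Proof.
rewrite !big_ord_recl big_ord0 mulr1 -mulrA.
by congr (_ * (E _ * E _)); apply: val_inj.
Qed.

Section Forms.
Variable K : closedFieldType.
Implicit Types (A B : {mpoly K[3]}) (u v w : 'rV[K]_3).

Definition vec3 (x y z : K) : 'rV[K]_3 :=
  \row_i (if i == 0 then x else if i == 1 then y else z).

Lemma vec3E x y z :
  ((vec3 x y z 0 0 = x) * (vec3 x y z 0 1 = y) * (vec3 x y z 0 2 = z))%type.
Proof. by rewrite !mxE. Qed.

Lemma vec3_eta v : v = vec3 (v 0 0) (v 0 1) (v 0 2).
Proof. by apply/rowP => i; case: (ord3P i) => ->; rewrite vec3E. Qed.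

Lemma vec3_eq0 x y z : (vec3 x y z == 0) = [&& x == 0, y == 0 & z == 0].
Proof.
apply/eqP/and3P => [/rowP h|[/eqP-> /eqP-> /eqP->]].
  by move: (h 0) (h 1) (h 2); rewrite !vec3E !mxE => -> -> ->.
by apply/rowP => i; case: (ord3P i) => ->; rewrite vec3E mxE.
Qed.

Lemma vec3Z c x y z : c *: vec3 x y z = vec3 (c * x) (c * y) (c * z).
Proof. by apply/rowP => i; case: (ord3P i) => ->; rewrite mxE !vec3E. Qed.

Lemma vec3D x y z x' y' z' :
  vec3 x y z + vec3 x' y' z' = vec3 (x + x') (y + y') (z + z').
Proof. by apply/rowP => i; case: (ord3P i) => ->; rewrite mxE !vec3E. Qed.

Lemma vec3_mulmx x y z (M : 'M[K]_3) :
  vec3 x y z *m M = x *: row 0 M + y *: row 1 M + z *: row 2 M.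
Proof. by apply/rowP => j; rewrite !mxE sum_ord3 !vec3E. Qed.

Lemma mx3_eq (M N : 'M[K]_3) : (forall x y z, vec3 x y z *m M = vec3 x y z *m N) -> M = N.
Proof.
move=> h; apply/row_matrixP => i; rewrite !rowE (vec3_eta (delta_mx 0 i)); exact: h.
Qed.

Lemma mulmx_vec3 (M : 'M[K]_3) x y z (v := vec3 x y z *m M) : M 0 1 = 0 -> M 1 1 = 1 -> M 2 1 = 0 ->
  v = vec3 (M 0 0 * x + M 1 0 * y + M 2 0 * z) y (M 0 2 * x + M 1 2 * y + M 2 2 * z).
Proof.
move=> m0 m1 m2; rewrite /v (vec3_eta (_ *m _)) !mxE !sum_ord3 !vec3E m0 m1 m2.
congr (vec3 _ _ _); ring.
Qed.

Lemma mnm3E (m : 'X_{1..3}) : mdeg m = (m 0%R + (m 1%R + m 2%R))%N.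
Proof. exact: etrans (mdegE m) (etrans (sum_ord3 _) (esym (addnA _ _ _))). Qed.

Lemma mnm3_eq (m m' : 'X_{1..3}) : mdeg m = mdeg m' ->
  m 0%R = m' 0%R -> m 1%R = m' 1%R -> m = m'.
Proof.
rewrite !mnm3E => /eqP + e0 e1; rewrite e0 e1 !eqn_add2l => /eqP e2.
by apply/mnmP => i; case: (ord3P i) => ->.
Qed.

Lemma evX v i : ev 'X_i v = v 0 i.
Proof. exact: mevalXU. Qed.

Lemma ev_homogZ A n c v : A \is n.-homog -> ev A (c *: v) = c ^+ n * ev A v.
Proof.
by move=> hA; rewrite -(mevalZ_homog c _ hA); apply: meval_eq => i; rewrite mxE.
Qed.

Lemma ev_homog0 A n : A \is n.+1.-homog -> ev A (0 : 'rV[K]_3) = 0.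
Proof. by move=> hA; rewrite -(scale0r 0) (ev_homogZ _ _ hA) expr0n mul0r. Qed.

Lemma homogX (i : 'I_3) : ('X_i : {mpoly K[3]}) \is 1.-homog.
Proof. by rewrite dhomogX; apply/eqP/mdeg1. Qed.

Lemma dhomogM_eq A B m n k : A \is m.-homog -> B \is n.-homog ->
  (m + n)%N = k -> A * B \is k.-homog.
Proof. by move=> hA hB <-; exact: dhomogM. Qed.

Lemma dhomogMn_eq A m n k : A \is m.-homog -> (m * n)%N = k -> A ^+ n \is k.-homog.
Proof. by move=> hA <-; exact: dhomogMn. Qed.

Lemma homogXn (i : 'I_3) n : ('X_i ^+ n : {mpoly K[3]}) \is n.-homog.
Proof. by apply: dhomogMn_eq (homogX i) _; rewrite mul1n. Qed.

Lemma poly_root_all (p : {poly K}) : (forall x, p.[x] = 0) -> p = 0.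
Proof.
move=> h; apply/eqP; case: eqP => // /eqP /closed_nonrootP[x].
by rewrite /root h eqxx.
Qed.

Lemma poly_root_cofin (p : {poly K}) (s : seq K) :
  (forall x, x \notin s -> p.[x] = 0) -> p = 0.
Proof.
move=> h; have : p * \prod_(x <- s) ('X - x%:P) = 0.
  apply: poly_root_all => x; rewrite hornerM; have [xs|/h->] := boolP (x \in s).
    by have := xs; rewrite -root_prod_XsubC => /rootP ->; rewrite mulr0.
  by rewrite mul0r.
move/eqP; rewrite mulf_eq0 => /orP[/eqP //|].
by rewrite (negPf (monic_neq0 (monic_prod_XsubC _ _ _))).
Qed.

Lemma exists_notin (s : seq K) : exists x, x \notin s.
Proof.
have /closed_nonrootP[x] : \prod_(x <- s) ('X - x%:P) != 0 :> {poly K}.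
  exact: monic_neq0 (monic_prod_XsubC _ _ _).
by rewrite root_prod_XsubC; exists x.
Qed.

(** The chart [Z = 1], with [Y] as outer variable over [K[X]], so that degrees and resultants with
    respect to [Y] are those of univariate polynomials. *)
Definition dehom : {mpoly K[3]} -> {poly {poly K}} :=
  mmap (polyC \o polyC) (fun i : 'I_3 => if i == 0 then 'X%:P else
                                   if i == 1 then 'X else 1).

HB.instance Definition _ := GRing.RMorphism.copy dehom dehom.

Lemma dehomX (m : 'X_{1..3}) : dehom 'X_[m] = ('X^(m 0%R))%:P * 'X^(m 1%R).
Proof. by rewrite /dehom mmapX /mmap1 prod_ord3 /= expr1n mulr1 rmorphXn. Qed.

Lemma dehomE A : dehom A = \sum_(m <- msupp A) (A@_m)%:P%:P * ('X^(m 0%R))%:P * 'X^(m 1%R).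
Proof.
rewrite /dehom /mmap; apply: eq_bigr => m _ /=; rewrite -mulrA; congr (_ * _).
by rewrite /mmap1 prod_ord3 /= expr1n mulr1 rmorphXn.
Qed.

Lemma dehom_ev A x y : (dehom A).[y%:P].[x] = ev A (vec3 x y 1).
Proof.
rewrite dehomE mevalE !horner_sum; apply: eq_bigr => m _.
by rewrite prod_ord3 !vec3E expr1n mulr1 !(hornerM, hornerC, hornerXn, horner_exp) mulrA.
Qed.

Lemma coef_dehom A n (m : 'X_{1..3}) : A \is n.-homog -> mdeg m = n ->
  (dehom A)`_(m 1%R)`_(m 0%R) = A@_m.
Proof.
move=> hA hm; rewrite dehomE !coef_sum.
under eq_bigr => m' _ do rewrite -rmorphM /= coefCM coefXn mulr_natr.
under eq_bigr => m' _ do rewrite coefMn coefCM coefXn mulr_natr.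
have [mA|mA] := boolP (m \in msupp A); last first.
  rewrite (memN_msupp_eq0 mA) big_seq big1 // => m' m'A.
  have [e1|] := eqVneq (m 1%R) (m' 1%R); last by rewrite mulr0n.
  have [e0|] := eqVneq (m 0%R) (m' 0%R); last by rewrite mulr0n mul0rn.
  suff e : m = m' by rewrite e m'A in mA.
  by apply: mnm3_eq => //; rewrite hm (dhomog_mf hA m'A).
rewrite (bigD1_seq m) ?msupp_uniq //= !eqxx !mulr1n big_seq_cond big1 ?addr0 //.
move=> m' /andP[m'A nm].
have [e1|] := eqVneq (m 1%R) (m' 1%R); last by rewrite mulr0n.
have [e0|] := eqVneq (m 0%R) (m' 0%R); last by rewrite mulr0n mul0rn.
case/eqP: nm; apply: mnm3_eq => //; rewrite hm; exact: dhomog_mf hA _ m'A.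
Qed.

(** In a fixed degree the exponents of [X] and [Y] determine that of [Z], so dehomogenization loses
    nothing. Identities between forms can thus be checked at points with [Z = 1]. *)
Lemma homog_eq0 A n : A \is n.-homog ->
  (forall x y, ev A (vec3 x y 1) = 0) -> A = 0.
Proof.
move=> hA h; have d0 : dehom A = 0.
  apply/polyP => i; rewrite coef0; apply/polyP => j; rewrite coef0.
  suff e x : map_poly (horner_eval x) (dehom A) = 0.
    have : (dehom A)`_i = 0.
      apply: poly_root_all => x; have := congr1 (fun p : {poly K} => p`_i) (e x).
      by rewrite coef_map coef0.
    by move->; rewrite coef0.
  apply: poly_root_all => y; rewrite -(h x y) -dehom_ev.
  by rewrite -[y in LHS](hornerC y x) -[_.[x] in LHS]/(horner_eval x _) horner_map.
apply/mpolyP => m; rewrite mcoeff0.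
have [mn|mn] := eqVneq (mdeg m) n; last exact: dhomog_nemf_coeff hA mn.
by rewrite -(coef_dehom hA mn) d0 !coef0.
Qed.

Lemma homog_eq A B n : A \is n.-homog -> B \is n.-homog ->
  (forall x y, ev A (vec3 x y 1) = ev B (vec3 x y 1)) -> A = B.
Proof.
move=> hA hB h; apply/eqP; rewrite -subr_eq0; apply/eqP.
by apply: (@homog_eq0 _ n) => [|x y]; rewrite ?rpredB // mevalB h subrr.
Qed.

End Forms.

Arguments homogX {K}.
Arguments homogXn {K}.

(** * Restriction to a line *)

Section Lines.
Variable K : closedFieldType.
Implicit Types (A B : {mpoly K[3]}) (u v w c : 'rV[K]_3).

Definition restr u w : {mpoly K[3]} -> {poly K} :=
  mmap polyC (fun i => (u 0 i)%:P + (w 0 i)%:P * 'X).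

HB.instance Definition _ u w := GRing.RMorphism.copy (restr u w) (restr u w).

Lemma restrX u w i : restr u w 'X_i = (u 0 i)%:P + (w 0 i)%:P * 'X.
Proof. by rewrite /restr mmapX mmap1U. Qed.

Lemma restrZ u w a A : restr u w (a *: A) = a *: restr u w A.
Proof. by rewrite /restr mmapZ mul_polyC. Qed.

Lemma restr_ev u w A t : (restr u w A).[t] = ev A (u + t *: w).
Proof.
rewrite /restr /mmap mevalE horner_sum; apply: eq_bigr => m _.
rewrite hornerM hornerC horner_prod; congr (_ * _); apply: eq_bigr => i _.
by rewrite horner_exp hornerD hornerM !hornerC hornerX !mxE mulrC.
Qed.

Lemma coefM_top (p q : {poly K}) a b : (size p <= a.+1)%N -> (size q <= b.+1)%N ->
  (p * q)`_(a + b) = p`_a * q`_b.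
Proof.
move=> hp hq; rewrite coefM (bigD1 (inord a)) //=.
have ea : nat_of_ord (inord a : 'I_(a + b).+1) = a by rewrite inordK // ltnS leq_addr.
rewrite ea addKn big1 ?addr0 // => -[i /= hi] ne.
have : i != a by apply: contraNneq ne => e; apply/eqP/val_inj; rewrite /= ea.
rewrite neq_ltn => /orP[lt|lt].
  by rewrite [q`__]nth_default ?mulr0 // (leq_trans hq) // ltn_subRL; lia.
by rewrite [p`__]nth_default ?mul0r // (leq_trans hp).
Qed.

Lemma sizeM_top (p q : {poly K}) a b : (size p <= a.+1)%N -> (size q <= b.+1)%N ->
  (size (p * q)%R <= (a + b).+1)%N.
Proof.
move=> hp hq; apply: leq_trans (size_polyMleq p q) _.
by move: (size p) (size q) hp hq => i j; lia.
Qed.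

(** In the parametrization [u + t w] the point [w] is at infinity, so [A] keeps its full degree on
    the line exactly when it does not vanish at [w]. *)
Lemma restr_top u w A n : A \is n.-homog ->
  (size (restr u w A) <= n.+1)%N /\ (restr u w A)`_n = ev A w.
Proof.
pose top k (p : {poly K}) x := (size p <= k.+1)%N /\ p`_k = x.
have topM a b p q x y : top a p x -> top b q y -> top (a + b)%N (p * q) (x * y).
  by move=> [h1 <-] [h2 <-]; split; [exact: sizeM_top|exact: coefM_top].
have topX a p x : top 1%N p x -> top a (p ^+ a) (x ^+ a).
  move=> h; elim: a => [|a IH]; last by rewrite !exprS -add1n; exact: (topM).
  by rewrite /top !expr0 size_poly1 coef1.
move=> /dhomogP hA; rewrite /restr /mmap mevalE big_seq [X in _ = X]big_seq.
rewrite -/(top _ _ _); elim/big_ind2: _ => [|p x p' x' [h1 <-] [h2 <-]|m mA].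
- by split; rewrite ?size_poly0 ?coef0.
- split; last exact: coefD.
  by rewrite (leq_trans (size_polyD _ _)) // geq_max h1.
rewrite -[n]add0n; apply: (topM).
  by split; rewrite ?coefC ?size_polyC //; case: eqP.
rewrite -(hA m mA) /= mdegE /mmap1.
apply: (big_ind3 (fun p x k => top k p x)) => [|p x k p' x' k' |i _].
- by rewrite /top size_poly1 coef1.
- exact: (topM).
apply: topX; split; last by rewrite coefD coefCM coefC coefX /= add0r mulr1.
rewrite (leq_trans (size_polyD _ _)) // geq_max size_polyC.
by rewrite (leq_trans (leq_b1 _)) // mul_polyC (leq_trans (size_scale_leq _ _)) ?size_polyX.
Qed.

(** Divide both by their gcd: a root left in [f] would, by Gauss's lemma, be a root of the local
    multiplier [g]. This takes the place of valuations at the points of a line section,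
    multiplicities included. *)
Lemma dvdp_local (f p : {poly K}) : f != 0 ->
  (forall t, root f t -> exists2 g, ~~ root g t & f %| g * p) -> f %| p.
Proof.
move=> f0 h; set d := gcdp f p.
have d0 : d != 0 by rewrite gcdp_eq0 negb_and f0.
have co : coprimep (f %/ d) (p %/ d) by rewrite coprimep_div_gcd ?f0.
have ef : f = f %/ d * d by rewrite divpK ?dvdp_gcdl.
have ep : p = p %/ d * d by rewrite divpK ?dvdp_gcdr.
have [s1|s1] := eqVneq (size (f %/ d)) 1%N.
  have /size_poly1P[c c0 e] : size (f %/ d) == 1%N by rewrite s1.
  by rewrite ef e mul_polyC (eqp_dvdl _ (eqp_scale _ c0)) dvdp_gcdr.
have [t rt] := closed_rootP _ s1.
have [|g gt fg] := h t; first by rewrite ef rootM rt.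
case/negP: gt; move: fg; rewrite {1}ef {1}ep mulrA dvdp_mul2r // Gauss_dvdpl //.
by case/dvdpP=> g1 ->; rewrite rootM rt orbT.
Qed.

Definition lin c : {mpoly K[3]} := \sum_i c 0 i *: 'X_i.

Lemma ev_lin c v : ev (lin c) v = \sum_i c 0 i * v 0 i.
Proof. by rewrite /lin raddf_sum; apply: eq_bigr => i _; rewrite /= mevalZ evX. Qed.

Lemma lin_homog c : lin c \is 1.-homog.
Proof. by apply: rpred_sum => i _; rewrite rpredZ ?homogX. Qed.

Lemma restr_lin u w c :
  restr u w (lin c) = (ev (lin c) u)%:P + (ev (lin c) w)%:P * 'X.
Proof.
rewrite !ev_lin !rmorph_sum mulr_suml -big_split /=; apply: eq_bigr => i _.
by rewrite restrZ restrX scalerDr -!mul_polyC !rmorphM mulrA.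
Qed.

(** A congruence modulo an ideal passes from the variables to all polynomials. With [P]
    parametrizing a line or a point, it puts a form vanishing there into the corresponding ideal. *)
Lemma subst_ideal (P : 3.-tuple {mpoly K[3]}) (L1 L2 : {mpoly K[3]}) :
  (forall i, exists a b, 'X_i - tnth P i = a * L1 + b * L2) ->
  forall A, exists a b, A - (A \mPo P) = a * L1 + b * L2.
Proof.
move=> h A.
pose I (B B' : {mpoly K[3]}) := exists a b, B - B' = a * L1 + b * L2.
have ID B B' C C' : I B B' -> I C C' -> I (B + C) (B' + C').
  move=> [a [b e]] [a' [b' e']]; exists (a + a'), (b + b').
  by rewrite opprD addrACA e e' !mulrDl addrACA.
have IM B B' C C' : I B B' -> I C C' -> I (B * C) (B' * C').
  move=> [a [b e]] [a' [b' e']]; exists (a * C + B' * a'), (b * C + B' * b').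
  have -> : B * C - B' * C' = (B - B') * C + B' * (C - C') by ring.
  by rewrite e e'; ring.
have I0 B : I B B by exists 0, 0; rewrite subrr !mul0r addr0.
suff : I A (A \mPo P) by [].
rewrite [X in I X _]mpolyE comp_mpolyE.
apply: (big_ind2 I) => [||m _]; [exact: I0|exact: ID|].
rewrite -!mul_mpolyC; apply: (IM) => //.
rewrite mpolyXE_id.
apply: (big_ind2 I) => [||i _]; [exact: I0|exact: IM|].
by elim: (m i) => [|k IH]; rewrite ?expr0 ?exprS; [exact: I0|apply: (IM)].
Qed.

Lemma pihomogM A (L : {mpoly K[3]}) n k : L \is k.-homog ->
  pihomog mdeg (n + k) (A * L) = pihomog mdeg n A * L.
Proof.
move=> hL; rewrite {1}(pihomog_partitionE (leqnn (mmeasure mdeg A))).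
set N := mmeasure _ _; rewrite mulr_suml raddf_sum /=.
have hd (i : nat) : pihomog mdeg (n + k) (pihomog mdeg i A * L) =
    if i == n then pihomog mdeg n A * L else 0.
  have h : pihomog mdeg i A * L \is (i + k).-homog by rewrite dhomogM // pihomogP.
  have [<-|ne] := eqVneq i n; first exact: pihomog_dE.
  by apply: pihomog_ne0 h; rewrite eqn_add2r.
under eq_bigr do rewrite hd.
have [lt|le] := ltnP n N.
  by rewrite -big_mkcond /= (big_pred1 (Ordinal lt)).
rewrite big1 => [|i _]; last by case: eqP => // e; move: (ltn_ord i); rewrite e ltnNge le.
rewrite [pihomog _ n A]pihomogE big_seq_cond big1 ?mul0r // => m /andP[mA /eqP e].
by have := mmeasure_mnm_lt mdeg mA; rewrite e ltnNge le.
Qed.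

(** The coefficients are replaced by their components of degree [n.-1]. For [n = 0] a constant in
    the ideal is zero, so the truncated predecessor does no harm. *)
Lemma homog_ideal A a b (L1 L2 : {mpoly K[3]}) n :
  A \is n.-homog -> L1 \is 1.-homog -> L2 \is 1.-homog ->
  A = a * L1 + b * L2 ->
  exists a' b', [/\ a' \is n.-1.-homog, b' \is n.-1.-homog
    & A = a' * L1 + b' * L2].
Proof.
case: n => [|n] hA h1 h2 e.
  exists 0, 0; split; rewrite ?rpred0 // !mul0r addr0.
  rewrite -(pihomog_dE hA) e raddfD /=.
  have z (c L : {mpoly K[3]}) : L \is 1.-homog -> pihomog mdeg 0 (c * L) = 0.
    move=> hL; rewrite (pihomog_partitionE (leqnn (mmeasure mdeg c))).
    rewrite mulr_suml raddf_sum /= big1 // => i _.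
    have h : pihomog mdeg i c * L \is (i + 1)%N.-homog.
      exact: dhomogM (pihomogP _ _ _) hL.
    by apply: pihomog_ne0 h; rewrite addn1.
  by rewrite !z ?addr0.
exists (pihomog mdeg n a), (pihomog mdeg n b); split; rewrite ?pihomogP //.
by rewrite -(pihomog_dE hA) e raddfD /= -[n.+1]addn1 !pihomogM.
Qed.

(** For invertible [M] these are the dual basis of the rows of [M]. *)
Definition coord_form (M : 'M[K]_3) j : {mpoly K[3]} := lin (col j (invmx M))^T.

Lemma coord_form_homog M j : coord_form M j \is 1.-homog.
Proof. exact: lin_homog. Qed.

Lemma restr_coord M u w j : restr u w (coord_form M j) =
  (ev (coord_form M j) u)%:P + (ev (coord_form M j) w)%:P * 'X.
Proof. exact: restr_lin. Qed.

Lemma ev_coord_form M j v : ev (coord_form M j) v = (v *m invmx M) 0 j.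
Proof. by rewrite ev_lin mxE; apply: eq_bigr => i _; rewrite !mxE mulrC. Qed.

Lemma ev_coord_row M i j : M \in unitmx ->
  ev (coord_form M j) (row i M) = (i == j)%:R.
Proof. by move=> uM; rewrite ev_coord_form -row_mul mulmxV // !mxE. Qed.

Lemma coord_form_sum (M : 'M[K]_3) i : M \in unitmx ->
  'X_i = \sum_j (M j i) *: coord_form M j.
Proof.
move=> uM; apply: (@homog_eq _ _ _ 1%N) => [||x y]; first exact: homogX.
  by apply: rpred_sum => j _; rewrite rpredZ ?coord_form_homog.
rewrite evX raddf_sum /=; under eq_bigr do rewrite mevalZ ev_coord_form mulrC.
by rewrite -{1}(mulmxKV uM (vec3 x y 1)) mxE.
Qed.

(** Modulo the form of the line, [A] equals its substitution by the parametrization in the other two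
    coordinates, and this substitution is zero because [A] vanishes on the line. *)
Lemma restr_ker (M : 'M[K]_3) A n : M \in unitmx -> A \is n.-homog ->
  restr (row 0 M) (row 1 M) A = 0 ->
  exists2 A1, A1 \is n.-1.-homog & A = coord_form M 2 * A1.
Proof.
move=> uM hA r0; set u := row 0 M in r0; set w := row 1 M in r0.
pose s := coord_form M 0; pose t := coord_form M 1; pose l := coord_form M 2.
pose P := [tuple u 0 i *: s + w 0 i *: t | i < 3].
have hP i : tnth P i \is 1.-homog.
  by rewrite tnth_mktuple rpredD ?rpredZ ?coord_form_homog.
have [i|a [b e]] := @subst_ideal P l 0 _ A.
  exists (M 2 i)%:MP, 0; rewrite (coord_form_sum i uM) sum_ord3 tnth_mktuple !mxE.
  by rewrite mulr0 addr0 mul_mpolyC -/s -/t -/l [LHS]addrC addKr.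
suff z : A \mPo P = 0.
  move: e; rewrite z subr0 => e.
  have [a' [b' [ha' _ e']]] :=
    homog_ideal hA (coord_form_homog M 2) (rpred0 _) e.
  by exists a' => //; rewrite e' mulr0 addr0 mulrC.
have hC : A \mPo P \is (1 * n)%N.-homog by exact: comp_mpoly_homog.
have nzs : s != 0.
  apply/eqP => s0; have /eqP := ev_coord_row 0 0 uM.
  by rewrite -/s s0 meval0 eqxx eq_sym oner_eq0.
(* The parametrization [u + t w] misses the points with [s = 0]; the factor [s] takes care of
   them. *)
apply: (mulfI nzs).
rewrite mulr0; apply: (@homog_eq0 _ _ (1 + 1 * n)).
  by rewrite dhomogM ?coord_form_homog.
move=> x y; set v := vec3 x y 1; rewrite mevalM comp_mpoly_meval.
have [->|s0] := eqVneq (ev s v) 0; first by rewrite mul0r.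
have -> : A.@[fun i => (tnth P i).@[v ord0]] =
    ev A (ev s v *: (u + (ev t v / ev s v) *: w)).
  apply: meval_eq => i; rewrite tnth_mktuple mevalD !mevalZ !mxE mulrDr.
  by rewrite [_ * (_ / _ * _)]mulrA [_ * (_ / _)]mulrC divfK // ![M _ _ * _]mulrC.
by rewrite (ev_homogZ _ _ hA) -restr_ev r0 horner0 !mulr0.
Qed.

(** Noether's theorem for a line and [F]: the quotient of the restrictions is homogenized in the
    coordinates of the line to a form [H], and [A - H F] then vanishes on the line. As the point at
    infinity is not a zero of [F], the restriction of [F] has its full degree [d], and the quotient
    has degree at most [n - d]. *)
Lemma restr_dvd (M : 'M[K]_3) A F n d : M \in unitmx ->
  A \is n.-homog -> F \is d.-homog -> ev F (row 1 M) != 0 ->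
  restr (row 0 M) (row 1 M) F %| restr (row 0 M) (row 1 M) A ->
  exists A1 H, A1 \is n.-1.-homog /\ A = coord_form M 2 * A1 + H * F.
Proof.
set u := row 0 M; set w := row 1 M => uM hA hF Fw /dvdpP[p hp].
have [szA _] := restr_top u w hA; have [szF cF] := restr_top u w hF.
have [p0|p0] := eqVneq p 0.
  have [] := restr_ker uM hA; first by rewrite hp p0 mul0r.
  by move=> A1 h1 ->; exists A1, 0; rewrite mul0r addr0.
have sF : size (restr u w F) = d.+1.
  apply/eqP; rewrite eqn_leq szF ltnNge; apply: contraNN Fw => h.
  by rewrite -cF nth_default.
have F0 : restr u w F != 0 by rewrite -size_poly_gt0 sF.
have szp : (size p + d <= n.+1)%N.
  by move: szA; rewrite hp size_mul // sF addnS.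
have dn : (d <= n)%N.
  by have := szp; rewrite -size_poly_gt0 in p0; move: (size p) p0 szp => ? ? ?; lia.
pose H := \sum_(i < size p) p`_i *: (coord_form M 0 ^+ (n - d - i) * coord_form M 1 ^+ i).
have hH : H \is (n - d).-homog.
  apply: rpred_sum => i _; rewrite rpredZ //.
  have e : (1 * (n - d - i) + 1 * i = n - d)%N by have := ltn_ord i; lia.
  have := dhomogM (dhomogMn (n - d - i) (coord_form_homog M 0))
                  (dhomogMn i (coord_form_homog M 1)).
  by rewrite e.
have rH : restr u w H = p.
  rewrite rmorph_sum /= -[RHS]coefK poly_def; apply: eq_bigr => i _.
  rewrite restrZ rmorphM !rmorphXn /= !restr_coord.
  by rewrite !ev_coord_row // mul0r addr0 expr1n mul1r add0r mul1r.
have [] := @restr_ker M (A - H * F) n uM.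
- by rewrite rpredB // -(subnK dn) dhomogM.
- by rewrite rmorphB rmorphM /= rH hp subrr.
by move=> A1 h1 e; exists A1, H; rewrite -e subrK.
Qed.

End Lines.

(** * Degree with respect to [Y] *)

Section YDegree.
Variable K : closedFieldType.
Implicit Types (p : {mpoly K[3]}).

Definition ydeg_le k p := all (fun m : 'X_{1..3} => m 1%R <= k)%N (msupp p).

Lemma ydeg_leW k k' p : ydeg_le k p -> (k <= k')%N -> ydeg_le k' p.
Proof. by move=> /allP h kk'; apply/allP => m /h /leq_trans; apply. Qed.

Lemma ydeg_leD k p p' : ydeg_le k p -> ydeg_le k p' -> ydeg_le k (p + p').
Proof.
move=> /allP h /allP h'; apply/allP => m /msuppD_le.
by rewrite mem_cat => /orP[/h|/h'].
Qed.

Lemma ydeg_leZ k c p : ydeg_le k p -> ydeg_le k (c *: p).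
Proof. by move=> /allP h; apply/allP => m /msuppZ_le /h. Qed.

Lemma ydeg_le0 k : ydeg_le k 0.
Proof. by rewrite /ydeg_le msupp0. Qed.

Lemma ydeg_le_sum k (I : Type) (s : seq I) (P : pred I) (f : I -> {mpoly K[3]}) :
  (forall i, P i -> ydeg_le k (f i)) -> ydeg_le k (\sum_(i <- s | P i) f i).
Proof.
by move=> h; elim/big_ind: _ => // [|p p']; [exact: ydeg_le0|exact: ydeg_leD].
Qed.

Lemma ydeg_leM k k' p p' : ydeg_le k p -> ydeg_le k' p' -> ydeg_le (k + k') (p * p').
Proof.
move=> /allP h /allP h'; apply/allP => m /msuppM_le.
by case/allpairsP=> -[m1 m2] /= [/h l1 /h' l2 ->]; rewrite mnmDE leq_add.
Qed.

Lemma ydeg_leX (m : 'X_{1..3}) : ydeg_le (m 1%R) 'X_[m].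
Proof. by rewrite /ydeg_le msuppX /= leqnn. Qed.

Lemma ydeg_le_exp k p n : ydeg_le k p -> ydeg_le (n * k) (p ^+ n).
Proof.
move=> h; elim: n => [|n IH].
  by rewrite expr0 /ydeg_le msupp1 /= mnm0E.
by rewrite exprS mulSn; exact: ydeg_leM.
Qed.

Lemma size_restr_ydeg k x z p : ydeg_le k p ->
  (size (restr (vec3 x 0 z) (vec3 0 1 0) p) <= k.+1)%N.
Proof.
move=> /allP h; rewrite /restr /mmap big_seq.
apply: (big_ind (fun f : {poly K} => size f <= k.+1)%N) => [|f g hf hg|m mp].
- by rewrite size_poly0.
- by rewrite (leq_trans (size_polyD _ _)) // geq_max hf.
rewrite /mmap1 prod_ord3 !vec3E !mul0r !addr0 add0r mul1r mulrAC mulrA.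
rewrite -!polyC_exp -!rmorphM mul_polyC (leq_trans (size_scale_leq _ _)) //.
by rewrite size_polyXn ltnS h.
Qed.

End YDegree.

(** * Coordinates of points *)

Section Points.
Variables (K : closedFieldType) (F : {mpoly K[3]}).

(** The chosen representative as a row vector: matrices can act on it, and [ev F (cvec P)] is still
    convertible with [F.@[hcoord (val P)]]. *)
Definition cvec (P : curve F) : 'rV[K]_3 := vpick (val (val P)).

Lemma cvec_neq0 P : cvec P != 0.
Proof. by rewrite vpick0 -dimv_eq0 (eqP (valP (val P))). Qed.

Lemma cvec_on P : ev F (cvec P) = 0.
Proof. exact/eqP/(valP P). Qed.

Lemma cvec_span P : val (val P) = <[cvec P]>%VS.
Proof. exact: hcoord_span. Qed.

Lemma span_eqP (v w : 'rV[K]_3) : v != 0 ->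
  reflect (exists2 c, c != 0 & w = c *: v) (<[w]> == <[v]>)%VS.
Proof.
move=> v0; apply: (iffP eqP) => [e|[c c0 ->]].
  have : w \in <[v]>%VS by rewrite -e memv_line.
  case/vlineP=> c ew; exists c => //; apply: contraNneq v0 => c0.
  have : v \in <[w]>%VS by rewrite e memv_line.
  by rewrite ew c0 scale0r => /vlineP[k ->]; rewrite scaler0.
apply: subv_anti; rewrite -!memvE memvZ ?memv_line //=.
by rewrite -[X in X \in _](scalerK c0) memvZ ?memv_line.
Qed.

Lemma cvec_line P v c : cvec P = c *: v -> val (val P) = <[v]>%VS.
Proof.
move=> e; have c0 : c != 0.
  by apply: contraNneq (cvec_neq0 P) => c0; rewrite e c0 scale0r.
have v0 : v != 0 by apply: contraNneq (cvec_neq0 P) => v0; rewrite e v0 scaler0.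
by rewrite cvec_span; apply/eqP/span_eqP => //; exists c.
Qed.

Lemma cvec_inj P Q c : cvec P = c *: cvec Q -> P = Q.
Proof. by move/cvec_line; rewrite -cvec_span => e; do 2!apply: val_inj. Qed.

Lemma span_cvec P v : val (val P) = <[v]>%VS ->
  exists2 c, c != 0 & cvec P = c *: v.
Proof.
move=> h; apply/span_eqP; last by rewrite -cvec_span h.
apply: contraNneq (cvec_neq0 P) => v0; have := cvec_span P.
by rewrite h v0 => e; have := memv_line (cvec P); rewrite -e => /vlineP[k ->]; rewrite scaler0.
Qed.

Lemma point_exists n v : F \is n.-homog -> v != 0 -> ev F v = 0 ->
  exists P : curve F, val (val P) = <[v]>%VS.
Proof.
move=> hF v0 Fv; have h1 : \dim <[v]>%VS == 1%N by rewrite dim_vline v0.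
pose p : proj_plane K := exist _ <[v]>%VS h1.
have hp : F.@[hcoord p] == 0.
  have : vpick <[v]>%VS \in <[v]>%VS by exact: memv_pick.
  case/vlineP=> c hc; rewrite /hcoord /= hc (ev_homogZ _ _ hF) Fv mulr0 //.
by exists (exist _ p hp).
Qed.

End Points.

(** * The curve C *)

Section Curve.
Variables (K : closedFieldType) (q e : nat) (Fq : finFieldType)
  (iota : {rmorphism Fq -> K}) (lambda : K).
Hypotheses (charK : 2%N \in [pchar K]) (qE : q = (2 ^ e)%N) (q_ge4 : (4 <= q)%N)
  (card_Fq : #|Fq| = q) (lambda0 : lambda != 0) (lambda1 : lambda != 1).

Local Notation F := (curve_form iota lambda).

Lemma two0 : 2%:R = 0 :> K.
Proof. exact: pcharf0 charK. Qed.

Lemma e_ge2 : (2 <= e)%N.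
Proof. by move: q_ge4; rewrite qE; case: e => [|[]]. Qed.

Lemma q_gt0 : (0 < q)%N.
Proof. exact: leq_trans q_ge4. Qed.

Lemma pow2_le i : (i <= e)%N -> (2 ^ i <= q)%N.
Proof. by move=> ie; rewrite qE leq_exp2l. Qed.

Lemma q_even : odd q = false.
Proof. by move: e_ge2; rewrite qE; case: e => // n _; rewrite oddX. Qed.

Lemma frob i (x y : K) : (x + y) ^+ (2 ^ i) = x ^+ (2 ^ i) + y ^+ (2 ^ i).
Proof. by apply: exprDn_pchar; rewrite pnatX pnatE // charK. Qed.

Lemma sqrD2 (x y : K) : (x + y) ^+ 2 = x ^+ 2 + y ^+ 2.
Proof. by have := frob 1 x y; rewrite expn1. Qed.

Lemma frobq (x y : K) : (x + y) ^+ q = x ^+ q + y ^+ q.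
Proof. by rewrite qE frob. Qed.

Lemma iotaq a : (iota a) ^+ q = iota a.
Proof. by rewrite -rmorphXn -card_Fq expf_card. Qed.

Lemma prod_Fq (T : K) : \prod_a (T - iota a) = T ^+ q - T.
Proof.
have /(congr1 (fun p => (map_poly iota p).[T])) := finField_genPoly Fq.
rewrite rmorphB rmorphXn rmorph_prod /= map_polyX !(hornerD, hornerN, hornerXn, hornerX) card_Fq.
rewrite horner_prod => ->; apply: eq_bigr => a _.
by rewrite rmorphB /= map_polyX map_polyC !hornerE.
Qed.

Lemma Fq_fixed (x : K) : x ^+ q = x -> exists a, x = iota a.
Proof.
move=> xq; have /eqP := prod_Fq x; rewrite xq subrr prodf_seq_eq0.
by case/hasP=> a _ /=; rewrite subr_eq0 => /eqP ->; exists a.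
Qed.

(** * The additive polynomial [tau] and the expansion of [F] *)

Definition tau (w y : K) := \sum_(i < e) w ^+ (2 ^ i) * y ^+ (q - 2 ^ i.+1).

Lemma tauD w w' y : tau (w + w') y = tau w y + tau w' y.
Proof. by rewrite -big_split; apply: eq_bigr => i _; rewrite frob mulrDl. Qed.

Lemma tau0 y : tau 0 y = 0.
Proof. by rewrite /tau big1 // => i _; rewrite expr0n expn_eq0 mul0r. Qed.

(** With [g i = u^(2^i) y^(q - 2^i)] the [i]-th term is [g i.+1 - g i], so the sum telescopes. At
    [y = 1] this says that the trace of [u^2 + u] is [u^q + u]. *)
Lemma tau_artin_schreier u y : tau (u ^+ 2 + u * y) y = u ^+ q + u * y ^+ q.-1.
Proof.
pose g i := u ^+ (2 ^ i) * y ^+ (q - 2 ^ i).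
transitivity (\sum_(0 <= i < e) (g i.+1 - g i)).
  rewrite big_mkord; apply: eq_bigr => i _.
  rewrite frob mulrDl /g (oppr_pchar2 charK) -exprM -expnS; congr (_ + _).
  rewrite exprMn -mulrA -exprD; congr (_ * y ^+ _).
  by have := pow2_le (ltn_ord i); rewrite expnS; lia.
rewrite telescope_sumr // /g -qE subnn mulr1 expn0 (oppr_pchar2 charK) expr1.
by rewrite subn1.
Qed.

(** For [z != 0] the polynomial [x + T y + T^2 z] has roots [r], [r'] with [y = z (r + r')] and
    [x = z r r'], so the product over [F_q] is [z^q (r^q + r) (r'^q + r')]. Moreover
    [x z = u^2 + u y] with [u = z r], and [tau] of this is known. *)
Lemma F_ev x y z :
  ev F (vec3 x y z) = z * x ^+ q + x * z ^+ q + y * tau (x * z) y + lambda * y ^+ q.+1.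
Proof.
have -> : ev F (vec3 x y z) =
    z * \prod_a (x + iota a * y + iota a ^+ 2 * z) + lambda * y ^+ q.+1.
  rewrite /curve_form mevalD mevalM mevalZ !rmorphXn !rmorph_prod /= !evX.
  rewrite !vec3E card_Fq; congr (_ * _ + _); apply: eq_bigr => a _.
  by rewrite !mevalD !mevalZ !evX !vec3E.
congr (_ + _); have [->|z0] := eqVneq z 0.
  by rewrite !mul0r !mulr0 tau0 expr0n eqn0Ngt q_gt0 !mulr0 !addr0.
have [r hr] : exists r, z * r ^+ 2 + y * r + x = 0.
  have [|r] := @closed_rootP _ (z *: 'X^2 + y *: 'X + x%:P) _.
    rewrite -addrA size_polyDl size_scale ?size_polyXn //.
    rewrite (leq_ltn_trans (size_polyD _ _)) // ltnS geq_max size_polyC.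
    by rewrite (leq_trans (size_scale_leq _ _)) ?size_polyX //=; case: eqP.
  by rewrite rootE !(hornerD, hornerZ, hornerXn, hornerX, hornerC) => /eqP <-; exists r.
pose r' := r + y / z.
have ey : y = z * (r + r').
  by rewrite /r' addrA (addrr_pchar2 charK) add0r mulrC divfK.
have ex : x = z * (r * r').
  move/eqP: hr; rewrite addr_eq0 (oppr_pchar2 charK) => /eqP <-.
  by rewrite /r'; field.
have -> : \prod_a (x + iota a * y + iota a ^+ 2 * z) =
    z ^+ q * ((r ^+ q + r) * (r' ^+ q + r')).
  have prodF s : s ^+ q + s = \prod_a (s - iota a).
    by rewrite prod_Fq (oppr_pchar2 charK).
  rewrite !prodF -big_split /= -card_Fq -prodr_const -big_split /=.
  apply: eq_bigr => a _; rewrite ex ey.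
  by rewrite !(oppr_pchar2 charK); ring: two0.
have -> : x * z = (z * r) ^+ 2 + (z * r) * y by rewrite ex ey; ring: two0.
have yq : y * y ^+ q.-1 = y ^+ q by rewrite -exprS prednK ?q_gt0.
rewrite tau_artin_schreier.
have -> a b : y * (a + b * y ^+ q.-1) = y * a + b * y ^+ q.
  by rewrite mulrDr mulrCA yq.
clearbody r'; rewrite ex ey !exprMn frobq.
by ring: two0.
Qed.

Lemma F_homog : F \is q.+1.-homog.
Proof.
rewrite rpredD ?rpredZ //=; last by rewrite card_Fq homogXn.
apply: (@dhomogM_eq _ _ _ 1 q); [exact: homogX| |exact: add1n].
rewrite -card_Fq -sum1_card.
apply: (big_ind2 (fun (p : {mpoly K[3]}) k => p \is k.-homog)) => [|p k p' k'|a _].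
- exact: dhomog1.
- exact: dhomogM.
by rewrite !rpredD ?rpredZ ?homogX.
Qed.

Local Notation Tau :=
  (\sum_(i < e) ('X_0 * 'X_2) ^+ (2 ^ i) * 'X_1 ^+ (q - 2 ^ i.+1) : {mpoly K[3]}).

Lemma F_expand : F =
  'X_2 * 'X_0 ^+ q + 'X_0 * 'X_2 ^+ q + 'X_1 * Tau + lambda *: 'X_1 ^+ q.+1.
Proof.
have hT : Tau \is q.-homog.
  apply: rpred_sum => i _.
  apply: (@dhomogM_eq _ _ _ (2 * 2 ^ i) (q - 2 ^ i.+1)); last 1 first.
  - by have := pow2_le (ltn_ord i); rewrite expnS; lia.
  - by apply: dhomogMn; apply: (@dhomogM_eq _ _ _ 1 1); rewrite ?homogX.
  exact: homogXn.
apply: (@homog_eq _ _ _ q.+1); first exact: F_homog.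
  rewrite !rpredD ?rpredZ ?homogXn //.
  - by apply: (dhomogM_eq (homogX _) (homogXn _ _)).
  - by apply: (dhomogM_eq (homogX _) (homogXn _ _)).
  by apply: (dhomogM_eq (homogX _) hT).
move=> x y; rewrite F_ev !mevalD mevalZ !mevalM !rmorphXn /= !evX !vec3E.
congr (_ + y * _ + _); rewrite raddf_sum /=; apply: eq_bigr => i _.
by rewrite mevalM !rmorphXn /= mevalM !evX !vec3E.
Qed.

(** * Derivatives and smoothness *)

Lemma mderiv_exp (p : {mpoly K[3]}) i n :
  (p ^+ n)^`M(i) = (p ^+ n.-1 * p^`M(i)) *+ n.
Proof.
elim: n => [|[|n] IH]; first by rewrite expr0 -mpolyC1 mderivC mulr0n.
  by rewrite expr1 expr0 mul1r.
rewrite exprS mderivM IH /= mulrnAr mulrA -exprS [RHS]mulrS.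
by rewrite [p^`M(i) * _]mulrC.
Qed.

Lemma mulrn_even (p : {mpoly K[3]}) n : odd n = false -> p *+ n = 0.
Proof.
move=> on; rewrite -[n]odd_double_half on add0n -mul2n mulrnA.
by rewrite -(scaler_nat 2 p) two0 scale0r mul0rn.
Qed.

Lemma mderivXi i j : ('X_i : {mpoly K[3]})^`M(j) = (i == j)%:R.
Proof.
rewrite mderivX mnm1E; case: eqP => [->|_]; last by rewrite scale0r.
rewrite scale1r (_ : (U_(j) - U_(j))%MM = 0%MM) ?mpolyX0 //.
by apply/mnmP => k; rewrite mnmBE subnn mnm0E.
Qed.

(** In characteristic 2 only odd exponents matter, and the only ones are those of [X Z] in the term
    [i = 0]. *)
Lemma deriv_Tau : [/\ Tau^`M(0) = 'X_2 * 'X_1 ^+ (q - 2), Tau^`M(1) = 0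
  & Tau^`M(2) = 'X_0 * 'X_1 ^+ (q - 2)].
Proof.
have ev1 i : odd (q - 2 ^ i.+1) = false.
  case: (leqP (2 ^ i.+1) q) => h; first by rewrite oddB // q_even oddX.
  by rewrite (eqP (ltnW h)).
case: e e_ge2 => // n _; rewrite big_ord_recl expn0 expr1.
have even_exp (i : 'I_n) : odd (2 ^ bump 0 i) = false by rewrite oddX.
rewrite !raddfD !raddf_sum /=.
split; rewrite big1 ?addr0 => [|i _]; rewrite !mderivM !mderiv_exp
  ?(mulrn_even _ (ev1 _)) ?(mulrn_even _ (even_exp _)) ?mulr0 ?addr0 ?mul0r //.
all: by rewrite !mderivXi /= ?(mul1r, mul0r, mulr0, mulr1, addr0, add0r) // [RHS]mul0r.
Qed.

Lemma deriv_F : [/\ F^`M(0) = 'X_2 ^+ q + 'X_2 * 'X_1 ^+ q.-1,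
  F^`M(1) = Tau + lambda *: 'X_1 ^+ q & F^`M(2) = 'X_0 ^+ q + 'X_0 * 'X_1 ^+ q.-1].
Proof.
have [T0 T1 T2] := deriv_Tau.
have eX : 'X_1 * 'X_1 ^+ (q - 2) = 'X_1 ^+ q.-1 :> {mpoly K[3]}.
  by rewrite -exprS; congr (_ ^+ _); have := q_ge4; lia.
rewrite F_expand !mderivD !mderivZ !mderivM T0 T1 T2 !mderiv_exp.
rewrite !(mulrn_even _ q_even) !mderivXi /= !(mul0r, mulr0, mul1r, addr0, add0r).
rewrite !(mul0rn, scaler0, addr0, mulr1, mulrCA 'X_1) eX; split => //.
by rewrite [_ *+ q.+1]mulrS (mulrn_even _ q_even) addr0.
Qed.

Lemma tau_trace (w : K) : tau w 1 = \sum_(i < e) w ^+ (2 ^ i).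
Proof. by apply: eq_bigr => i _; rewrite expr1n mulr1. Qed.

(** At [y = 1], [tau] is on [F_q] the absolute trace, which is fixed by squaring. *)
Lemma tau_Fq a : tau (iota a) 1 = 0 \/ tau (iota a) 1 = 1.
Proof.
pose t := tau (iota a) 1.
have tt : t ^+ 2 = t.
  rewrite /t !tau_trace -[2%N]expn1.
  rewrite (big_morph (fun x => x ^+ (2 ^ 1)) (frob 1) (expr0n _ _)).
  under eq_bigr do rewrite -exprM -expnSr.
  rewrite -(big_mkord xpredT (fun i => iota a ^+ (2 ^ i.+1))).
  rewrite -(big_mkord xpredT (fun i => iota a ^+ (2 ^ i))).
  rewrite -(big_add1 _ _ 0 e.+1 xpredT (fun i => iota a ^+ (2 ^ i))).
  have := e_ge2; case: e qE => // n qn _; rewrite big_nat_recr //= -qn iotaq.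
  by rewrite [RHS]big_nat_recl //= expn0 expr1 addrC big_add1.
have /eqP : t * (t - 1) = 0 by rewrite mulrBr mulr1 -expr2 tt subrr.
by rewrite mulf_eq0 subr_eq0 => /orP[] /eqP; [left|right].
Qed.

Lemma F_ev_deriv x y z :
  [/\ ev F^`M(0) (vec3 x y z) = z ^+ q + z * y ^+ q.-1,
      ev F^`M(1) (vec3 x y z) = tau (x * z) y + lambda * y ^+ q
    & ev F^`M(2) (vec3 x y z) = x ^+ q + x * y ^+ q.-1].
Proof.
have [-> -> ->] := deriv_F.
rewrite !mevalD mevalZ !mevalM !rmorphXn /= !evX !vec3E; split => //.
congr (_ + _); rewrite raddf_sum /=; apply: eq_bigr => i _.
by rewrite mevalM !rmorphXn /= mevalM !evX !vec3E.
Qed.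

(** For [y = 0] the outer partials are [z^q] and [x^q]. Otherwise they force [x / y] and [z / y]
    into [F_q], and the middle partial becomes [y^q] times the trace of [x z / y^2] plus [lambda];
    it is nonzero because the trace is 0 or 1. *)
Lemma F_smooth_pt x y z : ev F^`M(0) (vec3 x y z) = 0 ->
  ev F^`M(1) (vec3 x y z) = 0 -> ev F^`M(2) (vec3 x y z) = 0 ->
  vec3 x y z = 0.
Proof.
have [-> -> ->] := F_ev_deriv x y z => h0 h1 h2.
have [y0|y0] := eqVneq y 0.
  have q1 : (q.-1 == 0)%N = false by have := q_ge4; lia.
  move: h0 h2; rewrite y0 expr0n q1 !mulr0 !addr0 => /eqP h0 /eqP h2.
  apply/eqP; rewrite vec3_eq0 eqxx.
  by move: h0 h2; rewrite !expf_eq0 q_gt0 /= => -> ->.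
have main w : w ^+ q + w * y ^+ q.-1 = 0 -> exists a, w = iota a * y.
  move=> h; have [|a ha] := @Fq_fixed (w / y).
    rewrite exprMn exprVn; move/eqP: h.
    rewrite addr_eq0 (oppr_pchar2 charK) => /eqP ->.
    have -> : y ^+ q = y ^+ q.-1 * y by rewrite -exprSr prednK ?q_gt0.
    by field; rewrite y0 expf_neq0.
  by exists a; rewrite -ha divfK.
have [a ea] := main _ h2; have [b eb] := main _ h0.
have tauZ w : tau (w * y ^+ 2) y = y ^+ q * tau w 1.
  rewrite tau_trace mulr_sumr; apply: eq_bigr => i _.
  rewrite exprMn -exprM -mulrA -exprD mulrC; congr (y ^+ _ * _).
  by have := pow2_le (ltn_ord i); rewrite expnS; lia.
move: h1; rewrite ea eb.
have -> : iota a * y * (iota b * y) = iota (a * b) * y ^+ 2.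
  by rewrite rmorphM; ring.
rewrite tauZ [lambda * _]mulrC -mulrDr => /eqP; rewrite mulf_eq0 expf_eq0.
rewrite q_gt0 (negPf y0) /= addr_eq0 (oppr_pchar2 charK).
case: (tau_Fq (a * b)) => ->; rewrite eq_sym.
  by rewrite (negPf lambda0).
by rewrite (negPf lambda1).
Qed.

Lemma F_smooth : smooth_curve F.
Proof.
move=> P _; case: (boolP [exists i, (F^`M(i)).@[hcoord P] != 0]).
  by move/existsP.
rewrite negb_exists => /forallP h.
have : vpick (val P) = 0.
  rewrite (vec3_eta (vpick (val P))); apply: F_smooth_pt;
    by apply/eqP; rewrite -vec3_eta; apply: negbNE; apply: h.
by move/eqP; rewrite vpick0 -dimv_eq0 (eqP (valP P)).
Qed.

(** * Reduction modulo [F], forms vanishing on the curve, and the genus *)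

Lemma F_minus_ydeg : ydeg_le q (F - lambda *: 'X_1 ^+ q.+1).
Proof.
rewrite F_expand // addrK.
have y0 : ydeg_le 0 ('X_0 : {mpoly K[3]}) .
  by rewrite /ydeg_le msuppX /= mnm1E.
have y1 : ydeg_le 1 ('X_1 : {mpoly K[3]}) .
  by rewrite /ydeg_le msuppX /= mnm1E.
have y2 : ydeg_le 0 ('X_2 : {mpoly K[3]}) .
  by rewrite /ydeg_le msuppX /= mnm1E.
apply: ydeg_leD; first apply: ydeg_leD.
- by have /ydeg_leW := ydeg_leM y2 (ydeg_le_exp q y0); apply; rewrite muln0.
- by have /ydeg_leW := ydeg_leM y0 (ydeg_le_exp q y2); apply; rewrite muln0.
rewrite mulr_sumr; apply: ydeg_le_sum => i _.
have := ydeg_leM y1 (ydeg_leM (ydeg_le_exp (2 ^ i) (ydeg_leM y0 y2))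
  (ydeg_le_exp (q - 2 ^ i.+1) y1)).
move/ydeg_leW; apply; rewrite muln0 add0n muln1 expnS.
have := pow2_le (ltn_ord i); rewrite expnS.
have : (0 < 2 ^ i)%N by rewrite expn_gt0.
lia.
Qed.

(** [F] has degree [q + 1] in [Y] with constant leading coefficient [lambda], so Euclidean division
    in [Y] is possible over [K[X, Z]] and respects homogeneity. *)
Lemma F_divmod n (A : {mpoly K[3]}) : A \is n.-homog ->
  exists H R, [/\ A = H * F + R, R \is n.-homog & ydeg_le q R].
Proof.
pose J (p : {mpoly K[3]}) := exists H R, [/\ p = H * F + R, R \is n.-homog & ydeg_le q R].
have JD p p' : J p -> J p' -> J (p + p').
  move=> [H [R [-> h1 h2]]] [H' [R' [-> h1' h2']]].
  exists (H + H'), (R + R'); split; [by ring|exact: rpredD|exact: ydeg_leD].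
have JZ c p : J p -> J (c *: p).
  move=> [H [R [-> h1 h2]]]; exists (c *: H), (c *: R).
  by split; [rewrite scalerDr scalerAl|exact: rpredZ|exact: ydeg_leZ].
have J0 p : p \is n.-homog -> ydeg_le q p -> J p.
  by move=> h h'; exists 0, p; rewrite mul0r add0r.
pose W := F - lambda *: 'X_1 ^+ q.+1.
have hW : W \is q.+1.-homog by apply: rpredB; [exact: F_homog|apply/rpredZ/homogXn].
have yW : ydeg_le q W := F_minus_ydeg.
suff main k p : p \is n.-homog -> ydeg_le k p -> J p.
  move=> hA; apply: (main (\max_(m <- msupp A) (m : 'X_{1..3}) 1%R)%N) => //; apply/allP => m mA.
  by rewrite (bigD1_seq m) ?msupp_uniq //= leq_maxl.
elim/ltn_ind: k p => k IH p hp yp; have [kq|qk] := leqP k q.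
  by apply: J0 => //; exact: (ydeg_leW yp).
rewrite (mpolyE p) big_seq; elim/big_ind: _ => [||m mp].
- by exists 0, 0; rewrite mul0r addr0; split; [|exact: rpred0|exact: ydeg_le0].
- exact: (JD).
apply: (JZ); have mn := dhomog_mf hp mp; have mk := allP yp m mp.
have [mq|qm] := leqP (m 1%R) q.
  by apply: J0; [rewrite dhomogX; apply/eqP|rewrite /ydeg_le msuppX /= mq].
pose m' := (m - U_(1) *+ q.+1)%MM.
have Em : m = (m' + U_(1) *+ q.+1)%MM.
  apply/mnmP => i; rewrite /m' mnmDE mnmBE subnK // mulmnE mnm1E.
  by case: eqP => [<-|]; rewrite ?mul1n ?mul0n.
have hm' : ('X_[m'] : {mpoly K[3]}) \is (n - q.+1).-homog.
  rewrite dhomogX; apply/eqP; move: mn; rewrite /= Em mdegD mdegMn mdeg1.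
  by move=> <-; rewrite mul1n addnK.
have nq : (q.+1 <= n)%N.
  by rewrite -mn /= Em mdegD mdegMn mdeg1 mul1n leq_addl.
have eX : 'X_[m] = (lambda^-1 *: 'X_[m']) * F - lambda^-1 *: ('X_[m'] * W).
  rewrite Em mpolyXD -mpolyXn /W mulrBr -scalerAl -scalerBr opprB addrC subrK.
  by rewrite -scalerAr scalerA mulVf ?lambda0 // scale1r.
rewrite eX; apply: (JD).
  exists (lambda^-1 *: 'X_[m']), 0; rewrite addr0.
  by split; [|exact: rpred0|exact: ydeg_le0].
rewrite -scaleNr; apply: (JZ); apply: (IH (m' 1%R + q)%N).
- by rewrite /m' mnmBE mulmnE mnm1E eqxx mul1n; lia.
- by apply: dhomogM_eq hm' hW _; rewrite subnK.
- exact: ydeg_leM (ydeg_leX _ _) yW.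
Qed.

Definition special_x : seq K := [seq iota a | a <- enum Fq].

(** On this line the equation is [f = (x^q + x) + t g] with [g] a polynomial in [t^2]. Hence
    [f' = g], and [f - t f'] is the constant [x^q + x], nonzero outside [F_q]; so all roots are
    simple. *)
Lemma vert_line x : x \notin special_x ->
  exists2 rs : seq K, uniq rs & size rs = q.+1 /\
    forall t, (t \in rs) = (ev F (vec3 x t 1) == 0).
Proof.
move=> xs; pose f := restr (vec3 x 0 1) (vec3 0 1 0) F.
have fE t : f.[t] = ev F (vec3 x t 1).
  by rewrite restr_ev vec3Z vec3D !mulr0 !addr0 mulr1 add0r.
have [szf cf] := restr_top (vec3 x 0 1) (vec3 0 1 0) F_homog.
have cf1 : f`_q.+1 = lambda.
  rewrite cf F_ev // !(mulr0, mul0r, expr1n, mulr1) tau0 //.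
  by rewrite mulr0 !add0r.
have sf : size f = q.+2.
  apply/eqP; rewrite eqn_leq szf ltnNge; apply: contraNN lambda0 => h.
  by rewrite -cf1 nth_default.
pose g : {poly K} := \sum_(i < e) x ^+ (2 ^ i) *: 'X^(q - 2 ^ i.+1) + lambda *: 'X^q.
have dg : g^`() = 0.
  have ev0 k : odd k = false -> ('X^k : {poly K})^`() = 0.
    move=> ok; rewrite derivXn -[k]odd_double_half ok add0n -muln2 mulrnA.
    by rewrite -scaler_nat two0 // scale0r.
  rewrite derivD derivZ ev0 ?q_even // scaler0 addr0 raddf_sum /= big1 // => i _.
  rewrite derivZ ev0 ?scaler0 //.
  case: (leqP (2 ^ i.+1) q) => h; last by rewrite (eqP (ltnW h)).
  by rewrite oddB // q_even // oddX.
have ef : f = (x ^+ q + x)%:P + 'X * g.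
  apply/eqP; rewrite -subr_eq0; apply/eqP; apply: poly_root_all => t.
  rewrite hornerD hornerN fE F_ev // !mul1r mulr1 expr1n mulr1.
  rewrite !(hornerD, hornerM, hornerX, hornerC, hornerZ, hornerXn, horner_sum).
  have -> : \sum_(i < e) (x ^+ (2 ^ i) *: 'X^(q - 2 ^ i.+1)).[t] = tau x t.
    by apply: eq_bigr => i _; rewrite hornerZ hornerXn.
  by rewrite exprS; ring.
have df : f^`() = g by rewrite ef derivD derivC derivM derivX dg mulr0 addr0 add0r mul1r.
have sep : separable_poly f.
  rewrite unlock df ef; apply/Bezout_eq1_coprimepP.
  have c0 : x ^+ q + x != 0.
    apply: contraNneq xs => /eqP; rewrite addr_eq0 (oppr_pchar2 charK) => /eqP h.
    have [a ->] := Fq_fixed h.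
    by apply: map_f; rewrite mem_enum.
  exists ((x ^+ q + x)^-1%:P, - ((x ^+ q + x)^-1%:P * 'X)) => /=.
  by rewrite mulrDr -polyCM mulVf // -addrA mulrA mulNr subrr addr0.
have [rs ers] := closed_field_poly_normal f.
have lf : lead_coef f != 0 by rewrite lead_coef_eq0 -size_poly_eq0 sf.
exists rs; first by move: sep; rewrite ers (eqp_separable (eqp_scale _ lf)) separable_prod_XsubC.
split=> [|t]; last by rewrite -fE -[_ == 0]/(root f t) ers rootZ // root_prod_XsubC.
by move: sf; rewrite ers size_scale // size_prod_XsubC => -[].
Qed.

(** On all but finitely many vertical lines, [R] would have the [q + 1] distinct zeros of [F], too
    many for its degree in [Y]. The exceptional points [s] only exclude finitely many further
    lines. *)
Lemma homog_vanish_eq0 n R (s : seq (curve F)) : R \is n.-homog -> ydeg_le q R ->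
  (forall P : curve F, P \notin s -> ev R (cvec P) = 0) -> R = 0.
Proof.
move=> hR yR vR.
pose bad := special_x ++ [seq cvec P 0 0 / cvec P 0 2 | P <- s].
have Rv x t : x \notin bad -> ev F (vec3 x t 1) = 0 -> ev R (vec3 x t 1) = 0.
  rewrite mem_cat negb_or => /andP[_ xs] Fv.
  have v0 : vec3 x t 1 != 0 by rewrite vec3_eq0 oner_eq0 !andbF.
  have [P hP] := point_exists F_homog v0 Fv; have [c c0 hc] := span_cvec hP.
  have Ps : P \notin s.
    apply: contra xs => Ps; apply/mapP; exists P => //.
    by rewrite hc vec3Z !vec3E mulr1 mulrC mulrA mulVf // mul1r.
  move/eqP: (vR P Ps); rewrite hc (ev_homogZ _ _ hR) mulf_eq0.
  by rewrite expf_eq0 (negPf c0) andbF /= => /eqP.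
have Rx x : x \notin bad -> forall t, ev R (vec3 x t 1) = 0.
  move=> xb; have := xb; rewrite mem_cat negb_or => /andP[xs _].
  have [rs urs [srs mrs]] := vert_line xs.
  pose r := restr (vec3 x 0 1) (vec3 0 1 0) R.
  have rE t : r.[t] = ev R (vec3 x t 1).
    by rewrite restr_ev vec3Z vec3D !mulr0 !addr0 mulr1 add0r.
  have [r0|r0] := eqVneq r 0; first by move=> t; rewrite -rE r0 horner0.
  have : all (root r) rs.
    by apply/allP => t; rewrite mrs => /eqP /(Rv _ _ xb) h; rewrite /root rE h.
  move/(max_poly_roots r0)/(_ urs); rewrite srs ltnNge.
  by rewrite (size_restr_ydeg _ _ yR).
apply: homog_eq0 hR _ => x y.
suff r0 : restr (vec3 0 y 1) (vec3 1 0 0) R = 0.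
  have := horner0 x; rewrite -r0 restr_ev vec3Z vec3D.
  by rewrite !mulr0 !addr0 mulr1 add0r.
apply: (@poly_root_cofin _ _ bad) => x' /Rx h; rewrite restr_ev vec3Z vec3D.
by rewrite !mulr0 !addr0 mulr1 add0r.
Qed.

Lemma homog_vanish_dvd n A (s : seq (curve F)) : A \is n.-homog ->
  (forall P : curve F, P \notin s -> ev A (cvec P) = 0) -> exists H, A = H * F.
Proof.
move=> hA vA; have [H [R [e1 hR yR]]] := F_divmod hA.
exists H; rewrite e1 (homog_vanish_eq0 (s := s) hR yR) ?addr0 // => P /vA.
by rewrite e1 mevalD mevalM cvec_on mulr0 add0r.
Qed.

Lemma homog_vanish n A (s : seq (curve F)) : A \is n.-homog ->
  (forall P : curve F, P \notin s -> ev A (cvec P) = 0) -> forall P : curve F, ev A (cvec P) = 0.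
Proof.
move=> hA vA P; have [H ->] := homog_vanish_dvd hA vA.
by rewrite mevalM cvec_on mulr0.
Qed.

Lemma homog_vanish_small n A (s : seq (curve F)) : A \is n.-homog -> (n <= q)%N ->
  (forall P : curve F, P \notin s -> ev A (cvec P) = 0) -> A = 0.
Proof.
move=> hA nq; apply: (homog_vanish_eq0 hA); apply/allP => m mA.
apply: leq_trans nq; rewrite -(dhomog_mf hA mA) /= mnm3E; lia.
Qed.

Lemma sum_rows n k : (k <= n.+1)%N ->
  (\sum_(i < k) (n - i).+1 + 'C(k, 2) = k * n.+1)%N.
Proof.
elim: k => [|k IH] kn; first by rewrite big_ord0.
rewrite big_ord_recr /= binS bin1 mulSn.
have := IH (ltnW kn); set s := (\sum_(i < k) _)%N; move: (k * n.+1)%N => t; lia.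
Qed.

(** Division by [F] leaves as a basis the monomials of degree [n] with [Y]-exponent at most [q],
    indexed by [T]: the tag is the exponent of [Y], the tagged value that of [X]. For [n >= q] there
    are [(q + 1)(n + 1) - q (q + 1) / 2] of them, and adding [q (q - 1) / 2] gives
    [(q + 1) n + 1]. *)
Lemma F_genus : has_genus F (q * (q - 1) %/ 2)%N.
Proof.
exists q.+1, q => n qn; pose T := {i : 'I_q.+1 & 'I_(n - i).+1}.
pose mon (t : T) : 'X_{1..3} :=
  [multinom (if j == 0%R then nat_of_ord (tagged t) else
             if j == 1%R then nat_of_ord (tag t) else n - tag t - tagged t)%N | j < 3].
have mon0 t : mon t 0%R = tagged t :> nat by rewrite mnmE.
have mon1 t : mon t 1%R = tag t :> nat by rewrite mnmE.
have mon2 t : mon t 2%R = (n - tag t - tagged t)%N :> nat by rewrite mnmE.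
have tag_le (t : T) : (tag t + tagged t <= n)%N.
  have := ltn_ord (tagged t); have := ltn_ord (tag t); rewrite !ltnS => h1 h2.
  by have := leq_add (leqnn (tag t)) h2; rewrite subnKC ?(leq_trans h1).
have mond t : mdeg (mon t) = n.
  by rewrite mnm3E mon0 mon1 mon2; have := tag_le t; lia.
have mon_inj : injective mon.
  move=> [[b hb] [a ha]] [[b' hb'] [a' ha']] /mnmP h.
  have := h 1; have := h 0; rewrite !mon0 !mon1 /= => ea eb.
  move: ha ha' h; rewrite /= {}ea; case: _ / eb hb' => hb' ha ha' _.
  by rewrite (bool_irrelevance hb hb') (bool_irrelevance ha ha').
have mon_surj m : mdeg m = n -> (m 1%R <= q)%N -> exists t, m = mon t.
  move=> mn mq; have h1 : (m 1%R < q.+1)%N by [].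
  have h0 : (m 0%R < (n - Ordinal h1).+1)%N by rewrite ltnS -mn mnm3E /=; lia.
  exists (Tagged (fun i : 'I_q.+1 => 'I_(n - i).+1) (Ordinal h0)).
  by apply: mnm3_eq; rewrite ?mond ?mon0 ?mon1.
exists #|{: T}|; last first.
  rewrite card_tagged sumnE big_map big_enum /=.
  under eq_bigr do rewrite card_ord.
  have := @sum_rows n q.+1; rewrite ltnS => /(_ qn).
  rewrite binS bin1 bin2 -subn1 -divn2.
  set s := (\sum_(i < q.+1) _)%N; lia.
pose B (i : 'I_#|{: T}|) : {mpoly K[3]} := 'X_[mon (enum_val i)].
have reindex (c : T -> K) : \sum_t c t *: 'X_[mon t] =
    \sum_(i < #|{: T}|) c (enum_val i) *: B i.
  by rewrite (reindex (fun i : 'I_#|{: T}| => enum_val i)) //; apply: onW_bij; exact: enum_val_bij.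
have coefc (c : T -> K) t : (\sum_t c t *: 'X_[mon t])@_(mon t) = c t.
  rewrite raddf_sum /= (bigD1 t) //= mcoeffZ mcoeffX eqxx mulr1 big1 ?addr0 //.
  move=> t' nt; rewrite mcoeffZ mcoeffX (inj_eq mon_inj) (negPf nt) mulr0 //.
have ydegc (c : T -> K) : ydeg_le q (\sum_t c t *: 'X_[mon t]).
  apply: ydeg_le_sum => t _; apply: ydeg_leZ.
  by apply: (ydeg_leW (ydeg_leX _ _)); rewrite mon1 -ltnS.
have homc (c : T -> K) : \sum_t c t *: 'X_[mon t] \is n.-homog.
  by apply: rpred_sum => t _; rewrite rpredZ // dhomogX /= mond.
exists B => [i|G hG]; first by rewrite dhomogX /= mond.
have [H [R [eG hR yR]]] := F_divmod hG.
have eR : R = \sum_t R@_(mon t) *: 'X_[mon t].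
  apply/mpolyP => m; have [mR|mR] := boolP (m \in msupp R).
    have [t ->] := mon_surj m (dhomog_mf hR mR) (allP yR _ mR).
    by rewrite coefc.
  rewrite memN_msupp_eq0 // raddf_sum /= big1 // => t _.
  rewrite mcoeffZ mcoeffX; case: eqP => [->|_]; last by rewrite mulr0.
  by rewrite memN_msupp_eq0 ?mul0r.
exists (\row_i R@_(mon (enum_val i))); split.
  exists H; rewrite eG addrC {1}eR reindex; congr (_ + _).
  by apply: eq_bigr => i _; rewrite mxE.
move=> c [H' eG']; apply/rowP => i; rewrite mxE.
pose c' t := c 0 (enum_rank t).
have ec : \sum_i c 0 i *: B i = \sum_t c' t *: 'X_[mon t].
  by rewrite reindex; apply: eq_bigr => j _; rewrite /c' enum_valK.
have : R - \sum_t c' t *: 'X_[mon t] = 0.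
  apply: (@homog_vanish_eq0 n _ [::]).
  - by rewrite rpredB ?hR ?homc.
  - rewrite -scaleN1r; apply: ydeg_leD => //; exact: ydeg_leZ.
  move=> P _; have := congr1 (fun p => ev p (cvec P)) (etrans (esym eG) eG').
  rewrite /= !mevalD !mevalM !cvec_on !mulr0 add0r addr0 ec => ->.
  by rewrite mevalN subrr.
move/eqP; rewrite subr_eq0 => /eqP ->.
by rewrite coefc /c' enum_valK.
Qed.

(** * Automorphisms are linear *)

Section Cross.
Variable k : fieldType.
Implicit Types u v w a : 'rV[k]_3.

Definition dot u v := u 0 0 * v 0 0 + u 0 1 * v 0 1 + u 0 2 * v 0 2.

Definition cross u v : 'rV[k]_3 := \row_i
  (if i == 0 then u 0 1 * v 0 2 - u 0 2 * v 0 1 else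
   if i == 1 then u 0 2 * v 0 0 - u 0 0 * v 0 2 else
   u 0 0 * v 0 1 - u 0 1 * v 0 0).

Lemma crossE u v : ((cross u v 0 0 = u 0 1 * v 0 2 - u 0 2 * v 0 1) *
  (cross u v 0 1 = u 0 2 * v 0 0 - u 0 0 * v 0 2) *
  (cross u v 0 2 = u 0 0 * v 0 1 - u 0 1 * v 0 0))%type.
Proof. by rewrite !mxE. Qed.

Lemma dot_cross a v w : dot (cross a v) w = dot a (cross v w).
Proof. by rewrite /dot !crossE; ring. Qed.

Lemma dot_crossl v w : dot (cross v w) v = 0.
Proof. by rewrite /dot !crossE; ring. Qed.

Lemma dot_crossr v w : dot (cross v w) w = 0.
Proof. by rewrite /dot !crossE; ring. Qed.

Lemma dotZl c u v : dot (c *: u) v = c * dot u v.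
Proof. by rewrite /dot !mxE; ring. Qed.

Lemma cross_eq0 v w : v != 0 -> cross v w = 0 -> exists c, w = c *: v.
Proof.
move=> v0 /rowP h.
have {}h i j : v 0 i * w 0 j = v 0 j * w 0 i.
  move: (h 0) (h 1) (h 2); rewrite !crossE !mxE.
  do 3![move/eqP; rewrite subr_eq0 => /eqP ?].
  by case: (ord3P i) => ->; case: (ord3P j) => -> //; rewrite mulrC [RHS]mulrC.
have [i vi] : exists i, v 0 i != 0.
  apply/existsP; rewrite -[X in is_true X]negbK negb_exists; apply: contra v0.
  by move/forallP=> h0; apply/eqP/rowP => j; rewrite mxE; apply/eqP/negbNE/h0.
exists (w 0 i / v 0 i); apply/rowP => j; rewrite mxE.
by apply: (mulfI vi); rewrite h; field.
Qed.

Lemma cross_neq0 v w : v != 0 -> (forall c, w != c *: v) -> cross v w != 0.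
Proof.
by move=> v0 h; apply/eqP => /(cross_eq0 v0)[c ec]; move: (h c); rewrite ec eqxx.
Qed.

(** A vector orthogonal to [v] and [w] has zero cross product with [cross v w], hence is a multiple
    of it. *)
Lemma dot_two c c' v w : v != 0 -> (forall t, w != t *: v) ->
  dot c v = 0 -> dot c w = 0 -> dot c' v = 0 -> dot c' w = 0 -> c != 0 ->
  exists t, c' = t *: c.
Proof.
move=> v0 vw cv cw c'v c'w c0; have x0 := cross_neq0 v0 vw.
have par d : dot d v = 0 -> dot d w = 0 -> exists t, d = t *: cross v w.
  move=> dv dw; apply: cross_eq0 => //; apply/rowP => i; rewrite [RHS]mxE.
  case: (ord3P i) => ->; rewrite !crossE.
  - transitivity (w 0 0 * dot d v - v 0 0 * dot d w); first by rewrite /dot; ring.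
    by rewrite dv dw; ring.
  - transitivity (w 0 1 * dot d v - v 0 1 * dot d w); first by rewrite /dot; ring.
    by rewrite dv dw; ring.
  transitivity (w 0 2 * dot d v - v 0 2 * dot d w); first by rewrite /dot; ring.
  by rewrite dv dw; ring.
have [a ea] := par _ cv cw; have [a' ea'] := par _ c'v c'w.
have a0 : a != 0 by apply: contraNneq c0 => a0; rewrite ea a0 scale0r.
by exists (a' / a); rewrite ea' ea scalerA divfK.
Qed.

End Cross.

Lemma ev_lin_dot (k : closedFieldType) (c v : 'rV[k]_3) : ev (lin c) v = dot c v.
Proof. by rewrite ev_lin sum_ord3. Qed.

(** The normals tried are [cross a v] with [a = (1, t, t^2)]. Then [dot (cross a v) w] is a
    polynomial in [t] whose coefficients are the coordinates of [cross v w], nonzero when [w] is not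
    a multiple of [v]; a generic [t] serves all of [s]. *)
Lemma line_avoiding (k : closedFieldType) (v : 'rV[k]_3) (s : seq 'rV[k]_3) : v != 0 ->
  (forall w, w \in s -> forall a, w != a *: v) ->
  exists c, [/\ c != 0, dot c v = 0 & forall w, w \in s -> dot c w != 0].
Proof.
move=> v0 hs.
(* This extra vector makes the normal nonzero even when [s] is empty. *)
have [w0 hw0] : exists w0, forall a, w0 != a *: v.
  have [[a ea]|] := EM (exists a, vec3 1 0 0 = a *: v); last first.
    by move=> h; exists (vec3 1 0 0) => a; apply/eqP => e1; apply: h; exists a.
  exists (vec3 0 1 0) => b; apply/eqP => eb.
  have := congr1 (fun w : 'rV_3 => w 0 0) eb; rewrite !mxE /= => /esym/eqP.
  have := congr1 (fun w : 'rV_3 => w 0 0) ea; rewrite !mxE /= => ea0.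
  rewrite mulf_eq0 => /orP[/eqP b0|/eqP v00].
    have := congr1 (fun w : 'rV_3 => w 0 1) eb; rewrite !mxE /= b0 mul0r.
    by move/eqP; rewrite oner_eq0.
  by move/eqP: ea0; rewrite v00 mulr0 oner_eq0.
pose p (w : 'rV[k]_3) : {poly k} :=
  (cross v w 0 0)%:P + (cross v w 0 1)%:P * 'X + (cross v w 0 2)%:P * 'X^2.
have p0 w : (forall a, w != a *: v) -> p w != 0.
  move=> /(cross_neq0 v0); apply: contraNneq => e0.
  have c i : (p w)`_i = 0 by rewrite e0 coef0.
  apply/eqP/rowP => i; rewrite [RHS]mxE; have := c i.
  rewrite /p !coefD !coefCM coefC coefX coefXn.
  by case: (ord3P i) => -> /=; rewrite ?mulr0 ?mulr1 ?addr0 ?add0r.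
have /closed_nonrootP[t] : p w0 * \prod_(w <- s) p w != 0.
  rewrite mulf_neq0 ?p0 //.
  by rewrite prodf_seq_neq0; apply/allP => w /hs /p0.
rewrite rootM negb_or => /andP[r0 rs].
pose a : 'rV[k]_3 := vec3 1 t (t ^+ 2).
have da w : dot (cross a v) w = (p w).[t].
  rewrite dot_cross /dot /a !vec3E /p.
  by rewrite !(hornerD, hornerM, hornerC, hornerX, hornerXn) ?crossE; ring.
exists (cross a v); split.
- by apply: contraNneq r0 => e0; rewrite /root -da e0 /dot !mxE !mul0r !addr0.
- exact: dot_crossr.
move=> w ws; rewrite da; apply: contra rs => /eqP e0.
rewrite /root horner_prod prodf_seq_eq0; apply/hasP; exists w => //=.
by rewrite e0.
Qed.

(** The normalization [dot c v = 1] of the third row makes the dual form equal to [lin c], not just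
    proportional to it. *)
Lemma frame_of (k : closedFieldType) (c u w v : 'rV[k]_3) :
  dot c u = 0 -> dot c w = 0 -> dot c v = 1 -> w != 0 -> (forall a, u != a *: w) ->
  exists M : 'M[k]_3, [/\ M \in unitmx, row 0 M = u, row 1 M = w & coord_form M 2 = lin c].
Proof.
move=> cu cw cv w0 uw.
pose M : 'M[k]_3 := \matrix_i (if i == 0 then u else if i == 1 then w else v).
have r0 : row 0 M = u by rewrite rowK.
have r1 : row 1 M = w by rewrite rowK.
have r2 : row 2 M = v by rewrite rowK.
have Mc : M *m c^T = (delta_mx 0 2)^T.
  apply/colP => i; rewrite -[M *m _]trmxK mxE trmx_mul trmxK.
  have -> : (c *m M^T) 0 i = dot c (row i M).
    by rewrite mxE sum_ord3 /dot !mxE.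
  by rewrite !mxE; case: (ord3P i) => ->; rewrite ?r0 ?r1 ?r2.
have uM : M \in unitmx.
  rewrite -row_free_unit -kermx_eq0; apply/eqP/row_matrixP => i; rewrite row0.
  have : row i (kermx M) *m M = 0 by rewrite -row_mul mulmx_ker row0.
  move: (row i _) => x xM.
  have x2 : x 0 2 = 0.
    have := congr1 (fun A => (A *m c^T) 0 0) xM; rewrite -mulmxA Mc mul0mx mxE.
    by rewrite sum_ord3 !mxE /= !mulr0 !add0r mulr1 => ->.
  have : x 0 0 *: u + x 0 1 *: w = 0.
    rewrite -[RHS]xM; apply/rowP => j; rewrite !mxE sum_ord3 x2 mul0r addr0.
    by rewrite !mxE.
  have [x00 |x0] := eqVneq (x 0 0) 0.
    rewrite x00 scale0r add0r => /eqP; rewrite scaler_eq0 (negPf w0) orbF => /eqP x1.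
    by rewrite (vec3_eta x) x00 x1 x2; apply/eqP; rewrite vec3_eq0 eqxx.
  move/eqP; rewrite addr_eq0 => /eqP h.
  have := uw (- (x 0 1) / x 0 0); rewrite mulrC -scalerA scaleNr -h scalerA mulVf //.
  by rewrite scale1r eqxx.
exists M; split => //; rewrite /coord_form; congr lin.
rewrite -[RHS]trmxK; congr (_^T); rewrite -[RHS](mulKmx uM) Mc.
by apply/colP => i; rewrite !mxE sum_ord3 !mxE /= !mulr0 !add0r mulr1.
Qed.

(** A point of the line off [C] is needed as second row. If the line contains [(0:1:0)], that point
    works, since [F] is [lambda] there. Otherwise the point with [z = 0] or the one with [x = 0]
    works, unless the line is [Y = 0]; there [(x:0:1)] with [x] outside [F_q] is taken. *)
Lemma frame_exists (c : 'rV[K]_3) : c != 0 ->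
  exists M : 'M[K]_3, [/\ M \in unitmx, ev F (row 1 M) != 0 & coord_form M 2 = lin c].
Proof.
have q0 : 0 ^+ q = 0 :> K by rewrite expr0n eqn0Ngt q_gt0.
rewrite (vec3_eta c); move: (c 0 0) (c 0 1) (c 0 2) => a b d c0.
have fin u w v : dot (vec3 a b d) u = 0 -> dot (vec3 a b d) w = 0 ->
    dot (vec3 a b d) v = 1 -> ev F w != 0 -> (forall t, u != t *: w) ->
    exists M : 'M[K]_3, [/\ M \in unitmx, ev F (row 1 M) != 0 & coord_form M 2 = lin (vec3 a b d)].
  move=> cu cw cv Fw uw; have w0 : w != 0.
    by apply: contraNneq Fw => ->; rewrite (ev_homog0 F_homog).
  by have [M [uM _ r1 cM]] := frame_of cu cw cv w0 uw; exists M; rewrite r1.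
have [b0|b0] := eqVneq b 0.
  pose e1 := if a == 0 then vec3 0 0 d^-1 else vec3 a^-1 0 0.
  apply: (fin (vec3 d 0 (- a)) (vec3 0 1 0) e1).
  - by rewrite /dot !vec3E; ring.
  - by rewrite /dot !vec3E b0; ring.
  - rewrite /e1 /dot b0; have [a0|a0] := eqVneq a 0; rewrite !vec3E ?a0.
      rewrite !mul0r !add0r mulfV //.
      by move: c0; rewrite vec3_eq0 a0 b0 eqxx.
    by rewrite mulfV // !mulr0 !addr0.
  - by rewrite F_ev q0 !mul0r tau0 expr1n !mulr1 mulr0 !add0r lambda0.
  move=> t; rewrite vec3Z !mulr0; apply: contraNneq c0 => /rowP h.
  move: (h 0) (h 2); rewrite !vec3E => -> /eqP; rewrite oppr_eq0 => /eqP ->.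
  by rewrite vec3_eq0 b0 !eqxx.
have dot_e1 : dot (vec3 a b d) (vec3 0 b^-1 0) = 1.
  by rewrite /dot !vec3E mulfV // !mulr0 add0r addr0.
have Fpow x y : x != 0 -> lambda * (- (x / y)) ^+ q.+1 != 0 \/ y = 0.
  move=> x0; have [->|y0] := eqVneq y 0; [by right|left].
  by rewrite mulf_neq0 ?lambda0 // expf_neq0 // oppr_eq0 mulf_neq0 ?invr_eq0.
pose p1 := vec3 1 (- (a / b)) 0; pose p2 := vec3 0 (- (d / b)) 1.
have c1 : dot (vec3 a b d) p1 = 0 by rewrite /dot !vec3E; field.
have c2 : dot (vec3 a b d) p2 = 0 by rewrite /dot !vec3E; field.
have F1 : ev F p1 = lambda * (- (a / b)) ^+ q.+1.
  by rewrite F_ev q0 !mulr0 !mul0r tau0 mulr0 !add0r.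
have F2 : ev F p2 = lambda * (- (d / b)) ^+ q.+1.
  by rewrite F_ev q0 !mul0r !mulr0 tau0 mulr0 !add0r.
have [a0|a0] := eqVneq a 0; last first.
  apply: (fin p2 p1 _ c2 c1 dot_e1).
    by rewrite F1; case: (Fpow a b a0) => // /eqP; rewrite (negPf b0).
  move=> t; apply/eqP => /rowP/(_ 2); rewrite !mxE /= mulr0 => /eqP.
  by rewrite oner_eq0.
have [d0|d0] := eqVneq d 0; last first.
  apply: (fin p1 p2 _ c1 c2 dot_e1).
    by rewrite F2; case: (Fpow d b d0) => // /eqP; rewrite (negPf b0).
  move=> t; apply/eqP => /rowP/(_ 0); rewrite !mxE /= mulr0 => /eqP.
  by rewrite oner_eq0.
have [x xs] := exists_notin special_x.
apply: (fin (vec3 1 0 0) (vec3 x 0 1) _ _ _ dot_e1).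
- by rewrite /dot !vec3E a0; ring.
- by rewrite /dot !vec3E a0 d0; ring.
- rewrite F_ev expr1n mul1r mul0r mulr1 addr0 expr0n mulr0 addr0.
  apply: contraNneq xs => /eqP; rewrite addr_eq0 (oppr_pchar2 charK) => /eqP h.
  have [a' ->] := Fq_fixed h.
  by apply: map_f; rewrite mem_enum.
move=> t; apply/eqP => /rowP h; move: (h 0) (h 2); rewrite !mxE /=.
by rewrite mulr1 => + t0; rewrite -t0 mul0r => /eqP; rewrite oner_eq0.
Qed.

Lemma finite_points (sv : seq 'rV[K]_3) : exists s : seq (curve F),
  forall P, (exists2 v, v \in sv & exists c, cvec P = c *: v) -> P \in s.
Proof.
elim: sv => [|v sv [s hs]]; first by exists [::] => P [v].
have [[Q hQ]|h] := EM (exists Q : curve F, val (val Q) = <[v]>%VS).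
  exists (Q :: s) => P [w]; rewrite inE => /orP[/eqP->|ws] [c hc].
    rewrite inE (_ : P = Q) ?eqxx //; do 2!apply: val_inj.
    by rewrite hQ; exact: cvec_line hc.
  by rewrite inE hs ?orbT //; exists w => //; exists c.
exists s => P [w]; rewrite inE => /orP[/eqP->|ws] [c hc]; last first.
  by apply: hs; exists w => //; exists c.
by case: h; exists P; exact: cvec_line hc.
Qed.

(* The first coordinate does not vanish as the second basis vector is off the
   curve. *)
Lemma point_on_line (M : 'M[K]_3) (P : curve F) : M \in unitmx ->
  ev F (row 1 M) != 0 -> ev (coord_form M 2) (cvec P) = 0 ->
  exists c t, [/\ c != 0, cvec P = c *: (row 0 M + t *: row 1 M)
    & root (restr (row 0 M) (row 1 M) F) t].
Proof.
move=> uM Fw l0; set v := cvec P in l0 *.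
pose a := ev (coord_form M 0) v; pose b := ev (coord_form M 1) v.
have ev_ : v = a *: row 0 M + b *: row 1 M.
  rewrite -[LHS](mulmxKV uM); apply/rowP => i.
  rewrite mxE sum_ord3 -!ev_coord_form l0 mul0r addr0.
  by rewrite !mxE.
have a0 : a != 0.
  apply: contraNneq Fw => a0; have := cvec_on P.
  rewrite -/v ev_ a0 scale0r add0r (ev_homogZ _ _ F_homog) => /eqP.
  rewrite mulf_eq0 expf_eq0 => /orP[/andP[_ /eqP b0]|/eqP//].
  by have := cvec_neq0 P; rewrite -/v ev_ a0 b0 !scale0r addr0 eqxx.
have e1 : v = a *: (row 0 M + (b / a) *: row 1 M).
  by rewrite scalerDr scalerA [a * _]mulrC divfK.
exists a, (b / a); split=> //; rewrite /root restr_ev.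
have /eqP := cvec_on P; rewrite -/v e1 (ev_homogZ _ _ F_homog) mulf_eq0.
by rewrite expf_eq0 (negPf a0) andbF.
Qed.

Lemma restr_F_size (M : 'M[K]_3) : ev F (row 1 M) != 0 ->
  size (restr (row 0 M) (row 1 M) F) = q.+2.
Proof.
have [szF cF] := restr_top (row 0 M) (row 1 M) F_homog.
move=> Fw; apply/eqP; rewrite eqn_leq szF ltnNge; apply: contraNN Fw => h.
by rewrite -cF nth_default.
Qed.

Lemma line_finite (c : 'rV[K]_3) : c != 0 ->
  exists s : seq (curve F), forall P : curve F, ev (lin c) (cvec P) = 0 -> P \in s.
Proof.
move=> /frame_exists[M [uM Fw <-]]; pose f := restr (row 0 M) (row 1 M) F.
have [rs ers] := closed_field_poly_normal f.
have [s hs] := finite_points [seq row 0 M + t *: row 1 M | t <- rs].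
exists s => P /(point_on_line uM Fw)[a [t [a0 eP rt]]]; apply: hs.
exists (row 0 M + t *: row 1 M); last by exists a.
apply: map_f; move: rt; rewrite -/f ers rootZ ?root_prod_XsubC //.
by rewrite lead_coef_eq0 -size_poly_eq0 restr_F_size.
Qed.

(** * Local structure: [Y] as a uniformizer, and charts of a morphism *)

Lemma ideal_Y_point n (A : {mpoly K[3]}) (r : 'rV[K]_3) :
  A \is n.-homog -> r 0 1 = 0 -> r != 0 -> ev A r = 0 ->
  exists A1 A2, [/\ A1 \is n.-1.-homog, A2 \is n.-1.-homog &
    A = A1 * (r 0 2 *: 'X_0 - r 0 0 *: 'X_2) + A2 * 'X_1].
Proof.
move=> hA r1 r0 Ar; set L := _ - _.
have hL : L \is 1.-homog by rewrite rpredB ?rpredZ ?homogX.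
(* A linear form with value 1 at [r], so that replacing [X_i] by [r_i kap] projects onto the point
   [r]. *)
pose kap : {mpoly K[3]} := if r 0 2 == 0 then (r 0 0)^-1 *: 'X_0 else (r 0 2)^-1 *: 'X_2.
have hk : kap \is 1.-homog by rewrite /kap; case: ifP; rewrite rpredZ ?homogX.
pose P := [tuple r 0 i *: kap | i < 3].
have [i|a [b e1]] := @subst_ideal K P L 'X_1 _ A.
  rewrite tnth_mktuple /L /kap; have [z0|z0] := eqVneq (r 0 2) 0.
    have x0 : r 0 0 != 0.
      apply: contraNneq r0 => x0; rewrite (vec3_eta r) x0 r1 z0.
      by rewrite vec3_eq0 eqxx.
    case: (ord3P i) => ->.
    - by exists 0, 0; rewrite !mul0r addr0 scalerA mulfV // scale1r subrr.
    - by exists 0, 1; rewrite r1 scale0r subr0 mul0r mul1r add0r.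
    exists (- (r 0 0)^-1)%:MP, 0; rewrite z0 !scale0r subr0 sub0r mul0r addr0.
    by rewrite mul_mpolyC scalerN scaleNr opprK scalerA mulVf // scale1r.
  case: (ord3P i) => ->.
  - exists ((r 0 2)^-1)%:MP, 0; rewrite mul0r addr0 mul_mpolyC scalerBr !scalerA.
    by rewrite mulVf // scale1r [_ * r 0 0]mulrC.
  - by exists 0, 1; rewrite r1 scale0r subr0 mul0r mul1r add0r.
  by exists 0, 0; rewrite !mul0r addr0 scalerA mulfV // scale1r subrr.
suff z : A \mPo P = 0.
  have eA : A = a * L + b * 'X_1 by rewrite -e1 z subr0.
  by have [a' [b' [h1 h2 h3]]] := homog_ideal hA hL (homogX 1) eA; exists a', b'.
apply: (@homog_eq0 _ _ (1 * n)).
  by apply: comp_mpoly_homog => // i; rewrite tnth_mktuple rpredZ.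
move=> x y; rewrite comp_mpoly_meval.
have -> : A.@[fun i => (tnth P i).@[vec3 x y 1 ord0]] = ev A (ev kap (vec3 x y 1) *: r).
  by apply: meval_eq => i; rewrite tnth_mktuple mevalZ mxE mulrC.
by rewrite (ev_homogZ _ _ hA) Ar mulr0.
Qed.

(** Write [A = A1 L + A2 Y] and [F = h L + F2 Y] with [L] a second line through [R]; eliminating [L]
    gives [h A = Y (h A2 - F2 A1)] on [C]. That [h] is nonzero at [R] expresses the transversality
    of [C] and [Y = 0]: the partials of [F] in [X] and [Z] do not both vanish there. *)
Lemma Y_uniformizer n (A : {mpoly K[3]}) (R : curve F) :
  A \is n.+1.-homog -> cvec R 0 1 = 0 -> ev A (cvec R) = 0 ->
  exists h a, [/\ h \is q.-homog, a \is (q + n)%N.-homog, ev h (cvec R) != 0 &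
    forall S : curve F, ev h (cvec S) * ev A (cvec S) = cvec S 0 1 * ev a (cvec S)].
Proof.
move=> hA R1 AR; set r := cvec R in R1 AR *.
have r0 : r != 0 by exact: cvec_neq0.
have [A1 [A2 [hA1 hA2 eA]]] := ideal_Y_point hA R1 r0 AR.
have [h [F2 [hh hF2 eF]]] := ideal_Y_point F_homog R1 r0 (cvec_on R).
move: eA eF; set L := _ - _ => eA eF.
have Lr : ev L r = 0 by rewrite mevalB !mevalZ !evX mulrC subrr.
exists h, (h * A2 - F2 * A1); split=> //.
- by rewrite rpredB ?dhomogM.
- apply/eqP => h0.
  have [d0 _ d2] := F_ev_deriv (r 0 0) (r 0 1) (r 0 2).
  move: d0 d2; rewrite -vec3_eta eF !mderivD !mderivM.
  rewrite !mevalD !mevalM Lr evX R1 h0 !mul0r !mulr0 !addr0.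
  rewrite !mderivXi /= !meval0 !mulr0 !add0r expr0n.
  have -> : (q.-1 == 0)%N = false by have := q_ge4; lia.
  rewrite !mulr0 !addr0 => /esym/eqP + /esym/eqP; rewrite !expf_eq0 q_gt0 /= => z0 x0.
  by move: r0; rewrite (vec3_eta r) R1 vec3_eq0 x0 z0 eqxx.
clearbody L; move=> S; move: (cvec S) (cvec_on S) => v; rewrite eF mevalD !mevalM evX => eS.
rewrite eA !(mevalB, mevalD, mevalM) evX.
transitivity (ev A1 v * (ev h v * ev L v + ev F2 v * v 0 1) +
   v 0 1 * (ev h v * ev A2 v - ev F2 v * ev A1 v)).
  by ring.
by rewrite eS mulr0 add0r.
Qed.

Definition gev (G : 3.-tuple {mpoly K[3]}) (v : 'rV[K]_3) : 'rV[K]_3 :=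
  \row_i ev (tnth G i) v.

Lemma ev_comp A (G : 3.-tuple {mpoly K[3]}) v : ev (A \mPo G) v = ev A (gev G v).
Proof. by rewrite comp_mpoly_meval; apply: meval_eq => i; rewrite mxE. Qed.

(** The chart's [h] is multiplied by a coordinate nonzero at [P], which makes its degree positive; a
    product with [h] can then be fed to [Y_uniformizer]. *)
Lemma regular_at (f : curve F -> curve F) : regular_map f -> forall P : curve F,
  exists d k h G, [/\ h \is k.+1.-homog, forall i, tnth G i \is d.-homog,
    ev h (cvec P) != 0 & forall Q, ev h (cvec Q) != 0 ->
      exists2 c, c != 0 & cvec (f Q) = c *: gev G (cvec Q)].
Proof.
move=> rf P; have [d [k [h [G [hh hG hP H]]]]] := rf P.
have [j Pj] : exists j, cvec P 0 j != 0.
  apply/existsP; rewrite -[X in is_true X]negbK negb_exists.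
  apply: contra (cvec_neq0 P) => /forallP h0.
  by apply/eqP/rowP => j; rewrite mxE; apply/eqP/negbNE/h0.
exists d, k, (h * 'X_j), G; split=> //.
- by apply: (dhomogM_eq hh (homogX j)); rewrite addn1.
- by rewrite mevalM mulf_neq0 // evX.
move=> Q; rewrite mevalM mulf_eq0 negb_or => /andP[hQ _].
by have [_ /span_cvec] := H Q hQ.
Qed.

Lemma line_Y_finite : exists s : seq (curve F), forall P : curve F, cvec P 0 1 = 0 -> P \in s.
Proof.
have [|s hs] := @line_finite (vec3 0 1 0).
  by rewrite vec3_eq0 oner_eq0 andbF.
by exists s => P P1; apply: hs; rewrite ev_lin_dot /dot !vec3E P1; ring.
Qed.

(** * Elimination of [Y] *)

Lemma homogenize (p : {poly {poly K}}) : exists M0, forall M, (M0 <= M)%N ->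
  exists2 P : {mpoly K[3]}, P \is M.-homog &
    forall x y, ev P (vec3 x y 1) = p.[y%:P].[x].
Proof.
pose J (p : {poly {poly K}}) := exists M0, forall M, (M0 <= M)%N ->
  exists2 P : {mpoly K[3]}, P \is M.-homog &
    forall x y, ev P (vec3 x y 1) = p.[y%:P].[x].
have JD p1 p2 : J p1 -> J p2 -> J (p1 + p2).
  move=> [M1 h1] [M2 h2]; exists (maxn M1 M2) => M; rewrite geq_max => /andP[l1 l2].
  have [P1 hP1 e1] := h1 M l1; have [P2 hP2 e2] := h2 M l2.
  by exists (P1 + P2) => [|x y]; rewrite ?rpredD // mevalD e1 e2 !hornerD.
have JM p1 (i : 'I_3) (l : {poly {poly K}}) :
    (forall x y, vec3 x y 1 0 i = l.[y%:P].[x]) -> J p1 -> J (p1 * l).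
  move=> hl [M1 h1]; exists M1.+1 => -[//|M] lM; have [P hP e1] := h1 M lM.
  exists (P * 'X_i) => [|x y].
    by apply: (dhomogM_eq hP (homogX i)); rewrite addn1.
  by rewrite mevalM e1 evX !hornerM hl.
elim/poly_ind: p => [|p c IH].
  by exists 0%N => M _; exists 0 => [|x y]; rewrite ?rpred0 // meval0 !horner0.
apply: (JD); first by apply: (JM _ 1) => // x y; rewrite vec3E hornerX hornerC.
elim/poly_ind: c => [|c a IHc].
  by exists 0%N => M _; exists 0 => [|x y]; rewrite ?rpred0 // meval0 !horner0.
rewrite polyCD polyCM; apply: (JD).
  by apply: (JM _ 0) => // x y; rewrite vec3E hornerC hornerX.
exists 0%N => M _; exists (a *: 'X_2 ^+ M) => [|x y]; first by rewrite rpredZ ?homogXn.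
by rewrite mevalZ rmorphXn /= evX vec3E expr1n mulr1 !hornerC.
Qed.

Lemma size_dehom_ydeg k (p : {mpoly K[3]}) : ydeg_le k p -> (size (dehom p) <= k.+1)%N.
Proof.
move=> /allP h; rewrite dehomE big_seq.
apply: (big_ind (fun f : {poly {poly K}} => size f <= k.+1)%N) => [|f g hf hg|m mp].
- by rewrite size_poly0.
- by rewrite (leq_trans (size_polyD _ _)) // geq_max hf.
rewrite -rmorphM mul_polyC (leq_trans (size_scale_leq _ _)) //.
by rewrite size_polyXn ltnS h.
Qed.

Lemma dehom_F : size (dehom F) = q.+2 /\ lead_coef (dehom F) = lambda%:P.
Proof.
have eF : dehom F = lambda%:P *: 'X^(q.+1) + dehom (F - lambda *: 'X_1 ^+ q.+1).
  have d1 : dehom ('X_1 : {mpoly K[3]}) = 'X.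
    by rewrite dehomX !mnm1E /= expr0 expr1 mul1r.
  have dC : dehom (lambda%:MP : {mpoly K[3]}) = lambda%:P%:P by exact: mmapC.
  have dL : dehom (lambda *: 'X_1 ^+ q.+1 : {mpoly K[3]}) = lambda%:P *: 'X^(q.+1).
    by rewrite -mul_mpolyC rmorphM rmorphXn /= dC d1 mul_polyC.
  have split_ (p r : {mpoly K[3]}) : dehom p = dehom r + dehom (p - r).
    by rewrite -rmorphD addrC subrK.
  by rewrite (split_ F (lambda *: 'X_1 ^+ q.+1)) dL.
have szW := size_dehom_ydeg F_minus_ydeg.
have l0 : lambda%:P != 0 :> {poly K} by rewrite polyC_eq0 lambda0.
have szX : size (lambda%:P *: 'X^(q.+1) : {poly {poly K}}) = q.+2.
  by rewrite size_scale // size_polyXn.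
split; first by rewrite eF size_polyDl szX.
rewrite eF lead_coefDl ?szX // lead_coefZ ?lead_coefXn ?mulr1 //.
Qed.

(* The resultant with respect to [Y] of [F] and [B] at [Z = 1]; adding a multiple
   of [F] to [B] makes its leading coefficient constant, so that the
   resultant commutes with the specialization of [X]. *)
Lemma eliminate_Y (B : {mpoly K[3]}) x0 :
  (forall t, ev F (vec3 x0 t 1) = 0 -> ev B (vec3 x0 t 1) != 0) ->
  exists r v, r.[x0] != 0 /\ forall x y, ev F (vec3 x y 1) = 0 ->
    r.[x] = v.[y%:P].[x] * ev B (vec3 x y 1).
Proof.
move=> hB; have [sF lF] := dehom_F; set f := dehom F in sF lF.
pose b := dehom B; pose b' := b + f * 'X^(size b).
have szf : size (f * 'X^(size b)) = (size b + q.+2)%N.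
  rewrite size_Mmonic ?monicXn // -?size_poly_gt0 ?sF //.
  by rewrite size_polyXn addnC.
have sb' : size b' = (size b + q.+2)%N by rewrite /b' addrC size_polyDl szf // addnS ltnS leq_addr.
have lb' : lead_coef b' = lambda%:P.
  by rewrite /b' addrC lead_coefDl ?lead_coef_Mmonic ?monicXn // szf addnS ltnS leq_addr.
have [|| [u v] _ /= euv] := @resultant_in_ideal _ f b'; rewrite ?sF ?sb' ?addnS //.
exists (resultant f b'), v; split; last first.
  move=> x y F0; have := congr1 (fun p => p.[y%:P].[x]) euv.
  rewrite hornerC !(hornerD, hornerM) !dehom_ev F0 mul0r mulr0 add0r addr0.
  by rewrite mulrC.
have hlam : horner_eval x0 lambda%:P != 0 by rewrite /horner_eval hornerC lambda0.
rewrite -[_.[x0]]/(horner_eval x0 _) map_resultant ?lF ?lb' // resultant_eq0.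
rewrite -leqNgt; set f0 := map_poly _ f; set b0 := map_poly _ b'.
have ev0 (p : {poly {poly K}}) t : (map_poly (horner_eval x0) p).[t] = p.[t%:P].[x0].
  by rewrite -[t in LHS](hornerC t x0) -[_.[x0] in LHS]/(horner_eval x0 _) horner_map.
have [//|sz] := leqP (size (gcdp f0 b0)) 1.
have [|t] := @closed_rootP _ (gcdp f0 b0) _; first by rewrite neq_ltn sz orbT.
rewrite root_gcd => /andP[/rootP + /rootP]; rewrite !ev0 dehom_ev => Ft.
rewrite !(hornerD, hornerM) !dehom_ev Ft mul0r addr0 => Bt.
by move: (hB t Ft); rewrite Bt eqxx.
Qed.

Lemma lin_prod_homog (cs : seq 'rV[K]_3) : \prod_(c <- cs) lin c \is (size cs).-homog.
Proof.
rewrite -sum1_size.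
apply: (big_ind2 (fun (p : {mpoly K[3]}) k => p \is k.-homog)) => [|p k p' k'|c _].
- exact: dhomog1.
- exact: dhomogM.
exact: lin_homog.
Qed.

Lemma lin_prod_generic (cs : seq 'rV[K]_3) : all (fun c => c != 0) cs ->
  exists s : seq (curve F), forall Q, Q \notin s -> ev (\prod_(c <- cs) lin c) (cvec Q) != 0.
Proof.
elim: cs => [_|c cs IH /= /andP[/line_finite[s hs] /IH[s' hs']]].
  by exists [::] => Q _; rewrite big_nil meval1 oner_neq0.
exists (s ++ s') => Q; rewrite mem_cat negb_or => /andP[Qs /hs' h].
rewrite big_cons mevalM mulf_neq0 //; apply: contra Qs => /eqP; exact: hs.
Qed.

(** * The pullback of [L / Y] and the cancellation of lines in its denominator *)

Section Pullback.
Variables phi psi : curve F -> curve F.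
Hypotheses (rphi : regular_map phi) (rpsi : regular_map psi).
Hypotheses (phiK : cancel phi psi) (psiK : cancel psi phi).

Lemma phi_Y_finite : exists s : seq (curve F),
  forall P, cvec (phi P) 0 1 = 0 -> P \in s.
Proof.
have [s hs] := line_Y_finite; exists (map psi s) => P /hs Ps.
by rewrite -(phiK P) map_f.
Qed.

Variable L : {mpoly K[3]}.
Hypothesis hL : L \is 1.-homog.

(* [A / B] agrees with the pullback of [L / Y] outside a finite set. *)
Definition pullback_eq A B := exists s : seq (curve F), forall Q, Q \notin s ->
  ev A (cvec Q) * cvec (phi Q) 0 1 = ev B (cvec Q) * ev L (cvec (phi Q)).

Definition pole (P : curve F) := cvec (phi P) 0 1 = 0 /\ ev L (cvec (phi P)) != 0.

Lemma ev_linear c v : ev L (c *: v) = c * ev L v.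
Proof. by rewrite (ev_homogZ _ _ hL) expr1. Qed.

(** The case to treat is that [Y] and [L] both vanish at [phi P]: there [h1 L = Y a] on [C] with
    [h1] nonzero at [phi P], and [a / h1] replaces [L / Y]. *)
Lemma pullback_regular P : ~ pole P -> exists n A B,
  [/\ A \is n.-homog, B \is n.-homog, pullback_eq A B & ev B (cvec P) != 0].
Proof.
move=> nP; have [d [k [h [G [hh hG hP HG]]]]] := regular_at rphi P.
have hLG : L \mPo G \is d.-homog by rewrite -[d]muln1; exact: comp_mpoly_homog.
have [c c0 eP] := HG P hP.
have [Y0|Y0] := eqVneq (cvec (phi P) 0 1) 0; last first.
  exists (k.+1 + d)%N, (h * (L \mPo G)), (h * tnth G 1); split.
  - exact: dhomogM.
  - exact: dhomogM.
  - exists [::] => Q _; rewrite !mevalM ev_comp.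
    have [->|/HG[t t0 ->]] := eqVneq (ev h (cvec Q)) 0; first by rewrite !mul0r.
    by rewrite ev_linear !mxE; ring.
  rewrite mevalM mulf_neq0 //; apply: contraNneq Y0.
  by rewrite eP !mxE => ->; rewrite mulr0.
have L0 : ev L (cvec (phi P)) = 0.
  by apply/eqP/negbNE/negP => L0; apply: nP.
have [h1 [a [hh1 ha h1P eS]]] := Y_uniformizer hL Y0 L0.
rewrite addn0 in ha.
exists (k.+1 + d * q)%N, (h * (a \mPo G)), (h * (h1 \mPo G)); split.
- by apply: dhomogM => //; exact: comp_mpoly_homog.
- by apply: dhomogM => //; exact: comp_mpoly_homog.
- exists [::] => Q _; rewrite !mevalM !ev_comp.
  have [->|/HG[t t0 eQ]] := eqVneq (ev h (cvec Q)) 0; first by rewrite !mul0r.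
  have := eS (phi Q); rewrite {1 4}eQ (ev_homogZ _ _ hh1) (ev_homogZ _ _ ha) => e1.
  apply: (mulfI (expf_neq0 q t0)).
  transitivity (ev h (cvec Q) * (cvec (phi Q) 0 1 * (t ^+ q * ev a (gev G (cvec Q))))).
    by ring.
  by rewrite -e1; ring.
rewrite mevalM mulf_neq0 // ev_comp; apply: contraNneq h1P.
by rewrite eP (ev_homogZ _ _ hh1) => ->; rewrite mulr0.
Qed.

(** Poles are at most simple. Transported by [psi], [b] becomes a form vanishing at [phi P], hence
    locally a multiple of [Y] there, which cancels the denominator of [L / Y]; composing with [phi]
    brings [b] back. *)
Lemma pullback_pole P m b : cvec (phi P) 0 1 = 0 -> b \is m.-homog ->
  ev b (cvec P) = 0 -> exists n h A,
  [/\ h \is n.-homog, A \is (n + m).-homog, pullback_eq A (h * b)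
    & ev h (cvec P) != 0].
Proof.
move=> Y0 hb bP; have [d [k [h [G [hh hG hP HG]]]]] := regular_at rphi P.
have [d' [k' [h' [G' [hh' hG' hP' HG']]]]] := regular_at rpsi (phi P).
have [c c0 eP] := HG P hP; have [c' c'0 eP'] := HG' _ hP'.
rewrite phiK in eP'.
have [j Pj] : exists j, cvec P 0 j != 0.
  apply/existsP; rewrite -[X in is_true X]negbK negb_exists.
  apply: contra (cvec_neq0 P) => /forallP h0.
  by apply/eqP/rowP => j; rewrite mxE; apply/eqP/negbNE/h0.
pose beta := h' * (b \mPo G').
have hbeta : beta \is (k' + d' * m).+1.-homog.
  by rewrite -addSn; apply: dhomogM => //; exact: comp_mpoly_homog.
have beta0 : ev beta (cvec (phi P)) = 0.
  rewrite mevalM ev_comp; move: bP; rewrite eP' (ev_homogZ _ _ hb) => /eqP.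
  by rewrite mulf_eq0 (negPf (expf_neq0 _ c'0)) => /eqP ->; rewrite mulr0.
have [h1 [a [hh1 ha h1P eS]]] := Y_uniformizer hbeta Y0 beta0.
have hGG (p : {mpoly K[3]}) i : p \is i.-homog -> p \mPo G \is (d * i).-homog.
  by move=> hp; exact: comp_mpoly_homog.
(* Going through both charts, the coordinates of a point return only up to a factor. Comparing
   [j]-th coordinates, [cc ^+ m] against ['X_j ^+ m] compensates for it in the form [b] of degree
   [m]. *)
pose cc := tnth G' j \mPo G.
pose hx := h * ((h1 \mPo G) * ((h' \mPo G) * cc ^+ m)).
pose A := h * ((a \mPo G) * ('X_j ^+ m * (L \mPo G))).
have hhx : hx \is (k.+1 + (d * q + (d * k'.+1 + d * d' * m)))%N.-homog.
  apply: dhomogM => //; apply: dhomogM; first exact: hGG.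
  apply: dhomogM; first exact: hGG.
  by apply: dhomogMn; apply: hGG.
exists (k.+1 + (d * q + (d * k'.+1 + d * d' * m)))%N, hx, A; split=> //.
- have hA : A \is (k.+1 + (d * (q + (k' + d' * m)) + (m + d * 1)))%N.-homog.
    apply: dhomogM => //; apply: dhomogM; first exact: hGG.
    by apply: dhomogM; [exact: homogXn|exact: hGG].
  have eN : (k.+1 + (d * (q + (k' + d' * m)) + (m + d * 1)) =
    k.+1 + (d * q + (d * k'.+1 + d * d' * m)) + m)%N.
    by ring.
  by rewrite -eN.
- exists [::] => Q _; rewrite !mevalM !rmorphXn /= !ev_comp evX.
  have [->|hQ] := eqVneq (ev h (cvec Q)) 0; first by rewrite !mul0r.
  have [t t0 eQ] := HG _ hQ; set g := gev G (cvec Q) in eQ *.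
  have e1 : ev h1 g * (ev h' g * ev b (gev G' g)) = g 0 1 * ev a g.
    move: (eS (phi Q)); rewrite eQ (ev_homogZ _ _ hh1) (ev_homogZ _ _ hbeta).
    rewrite (ev_homogZ _ _ ha) mxE mevalM ev_comp => e1.
    apply: (mulfI (expf_neq0 (q + (k' + d' * m).+1) t0)).
    transitivity (t ^+ q * ev h1 g *
        (t ^+ (k' + d' * m).+1 * (ev h' g * ev b (gev G' g)))).
      by rewrite exprD; ring.
    by rewrite e1 addnS exprS; ring.
  have e2 : ev 'X_j (cvec Q) ^+ m * (ev h' g * ev b (gev G' g)) =
      ev h' g * (ev b (cvec Q) * ev 'X_j (gev G' g) ^+ m).
    have [->|h'Q] := eqVneq (ev h' g) 0; first by rewrite !mul0r mulr0.
    have [|t' t'0] := HG' (phi Q).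
      by rewrite eQ (ev_homogZ _ _ hh') mulf_neq0 ?expf_neq0.
    rewrite phiK eQ => ->.
    have -> : gev G' (t *: g) = t ^+ d' *: gev G' g.
      by apply/rowP => i; rewrite !mxE (ev_homogZ _ _ (hG' i)).
    rewrite scalerA (ev_homogZ _ _ hb) (ev_homogZ _ _ (homogX j)) expr1 exprMn.
    by ring.
  move: e2; rewrite !evX mxE => e2; rewrite eQ ev_linear mxE.
  transitivity (ev h (cvec Q) * t * ev L g * cvec Q 0 j ^+ m * (g 0 1 * ev a g)).
    by ring.
  rewrite -e1.
  transitivity (ev h (cvec Q) * t * ev L g * ev h1 g *
    (cvec Q 0 j ^+ m * (ev h' g * ev b (gev G' g)))); first by ring.
  by rewrite e2; ring.
rewrite !mevalM rmorphXn /= !ev_comp mulf_neq0 // mulf_neq0 //.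
  by apply: contraNneq h1P => h10; rewrite eP (ev_homogZ _ _ hh1) h10 mulr0.
rewrite mulf_neq0 //.
  by apply: contraNneq hP' => h'0; rewrite eP (ev_homogZ _ _ hh') h'0 mulr0.
rewrite expf_neq0 //; apply: contraNneq Pj => j0.
by rewrite eP' !mxE eP (ev_homogZ _ _ (hG' j)) j0 !mulr0.
Qed.

Lemma pullback_eqM A B C : pullback_eq A B -> pullback_eq (C * A) (C * B).
Proof.
by move=> [s hs]; exists s => Q /hs; rewrite !mevalM -!mulrA => ->.
Qed.

(** Two fractions for the same function merge into [(A + u A') / (B + u B')] with [u] generic, once
    powers of [Z], which is 1 at the given points, have equalized the degrees. So the points can be
    treated one after another. *)
Lemma pullback_nonvanishing x0 (ts : seq K) :
  (forall P, pole P -> forall t, cvec P != cvec P 0 2 *: vec3 x0 t 1) ->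
  (forall t, t \in ts -> ev F (vec3 x0 t 1) = 0) ->
  exists n A B, [/\ A \is n.-homog, B \is n.-homog, pullback_eq A B &
    forall t, t \in ts -> ev B (vec3 x0 t 1) != 0].
Proof.
move=> hx0; elim: ts => [|t ts IH] hts.
  (* [pullback_eq] admits the fraction [0 / 0], which suffices as long as there are no points. *)
  by exists 0%N, 0, 0; split; rewrite ?rpred0 //; exists [::] => Q _; rewrite !meval0 !mul0r.
have [|n [A [B [hA hB AB Bts]]]] := IH.
  by move=> t' t'ts; apply: hts; rewrite inE t'ts orbT.
have [|P hP] := point_exists F_homog _ (hts t (mem_head _ _)).
  by rewrite vec3_eq0 oner_eq0 !andbF.
have [c c0 eP] := span_cvec hP.
have [nP|n' [A' [B' [hA' hB' AB' B't]]]] := @pullback_regular P _.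
  by have := hx0 P nP t; rewrite eP !mxE /= mulr1 eqxx.
rewrite eP (ev_homogZ _ _ hB') mulf_eq0 negb_or in B't.
have {B't} /andP[_ B't] := B't.
pose p t' : {poly K} := (ev B (vec3 x0 t' 1))%:P + (ev B' (vec3 x0 t' 1))%:P * 'X.
have pE t' : (p t' == 0) = (ev B (vec3 x0 t' 1) == 0) && (ev B' (vec3 x0 t' 1) == 0).
  apply/eqP/andP => [h|[/eqP h /eqP h']]; last by rewrite /p h h' mul0r addr0.
  have := congr1 (fun f : {poly K} => f`_0) h; have := congr1 (fun f : {poly K} => f`_1) h.
  rewrite /p !coefD !coefCM !coefX !coefC /= mulr1 mulr0 addr0 add0r => -> ->.
  by rewrite eqxx.
have /closed_nonrootP[u] : \prod_(t' <- t :: ts) p t' != 0.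
  rewrite prodf_seq_neq0; apply/allP => t'; rewrite inE /= => /orP[/eqP ->|t'ts].
    by rewrite pE negb_and B't orbT.
  by rewrite pE negb_and (Bts t' t'ts).
rewrite /root horner_prod prodf_seq_eq0 => /hasPn hu.
have hcomb (C C' : {mpoly K[3]}) : C \is n.-homog -> C' \is n'.-homog ->
    'X_2 ^+ n' * C + (u *: 'X_2 ^+ n) * C' \is (n + n').-homog.
  move=> hC hC'; apply: rpredD; last by apply: dhomogM => //; apply: rpredZ; exact: homogXn.
  by apply: (dhomogM_eq (homogXn _ _) hC); rewrite addnC.
exists (n + n')%N, ('X_2 ^+ n' * A + (u *: 'X_2 ^+ n) * A'),
  ('X_2 ^+ n' * B + (u *: 'X_2 ^+ n) * B'); split.
- exact: hcomb.
- exact: hcomb.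
- have [s hs] := pullback_eqM ('X_2 ^+ n') AB.
  have [s' hs'] := pullback_eqM (u *: 'X_2 ^+ n) AB'.
  exists (s ++ s') => Q; rewrite mem_cat negb_or => /andP[/hs e1 /hs' e2].
  by rewrite !mevalD !mulrDl e1 e2.
move=> t' /hu /=; rewrite /p hornerD hornerM hornerX !hornerC.
rewrite mevalD !mevalM mevalZ !rmorphXn /= evX vec3E !expr1n !mul1r mulr1.
by rewrite [_ * u]mulrC.
Qed.

(** On a vertical line [x = x0] without poles, a denominator [B] can be chosen that vanishes at none
    of its points on [C]. Elimination of [Y] then turns a multiple of [B], modulo [F], into a
    nonzero polynomial in [x] alone, that is, a product of vertical lines. *)
Lemma lines_denominator : exists cs A, [/\ all (fun c => c != 0) cs,
  A \is (size cs).-homog & pullback_eq A (\prod_(c <- cs) lin c)].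
Proof.
have [D hD] := phi_Y_finite.
have [x0] := exists_notin (special_x ++ [seq cvec P 0 0 / cvec P 0 2 | P <- D]).
rewrite mem_cat negb_or => /andP[x0s x0D].
have [rs _ [_ mrs]] := vert_line x0s.
have [||n [A [B [hA hB AB Brs]]]] := @pullback_nonvanishing x0 rs.
- move=> P [P0 _] t; apply: contra x0D => /eqP eP; apply/mapP; exists P; first exact: hD.
  have z0 : cvec P 0 2 != 0.
    by apply: contraNneq (cvec_neq0 P) => z0; rewrite eP z0 scale0r.
  have := congr1 (fun v : 'rV_3 => v 0 0) eP; rewrite [in RHS]mxE vec3E => ->.
  by rewrite mulrC mulKf.
- by move=> t; rewrite mrs => /eqP.
have [t Ft|r [v [r0 hrv]]] := @eliminate_Y B x0; first by apply: Brs; rewrite mrs Ft.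
have rn0 : r != 0 by apply: contraNneq r0 => ->; rewrite horner0.
have [ss ers] := closed_field_poly_normal r.
have lr : lead_coef r != 0 by rewrite lead_coef_eq0.
have [M0 hM0] := homogenize v; pose M := maxn M0 (size ss).
have [V hV eV] := hM0 M (leq_maxl _ _).
(* The roots of [r] give the lines [X = x Z]; copies of [Z = 0] fill up the degree to that of
   [V * A]. *)
pose cs : seq 'rV[K]_3 := nseq (M + n - size ss) (vec3 0 0 1) ++ [seq vec3 1 0 (- x) | x <- ss].
have scs : size cs = (M + n)%N.
  rewrite size_cat size_nseq size_map subnK //.
  by rewrite (leq_trans (leq_maxr M0 _)) // leq_addr.
have hcs : \prod_(c <- cs) lin c \is (M + n).-homog by rewrite -scs lin_prod_homog.
have evcs x y : ev (\prod_(c <- cs) lin c) (vec3 x y 1) = (lead_coef r)^-1 * r.[x].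
  rewrite {2}ers hornerZ mulrA mulVf // mul1r rmorph_prod /= big_cat /= big_nseq.
  rewrite ev_lin_dot /dot !vec3E !mul0r !add0r mulr1.
  rewrite (_ : iter _ _ _ = 1) ?mul1r; last by elim: (_ - _)%N => //= k ->; rewrite mulr1.
  rewrite big_map horner_prod; apply: eq_bigr => z _.
  by rewrite ev_lin_dot /dot !vec3E hornerXsubC; ring.
have hZ : vec3 0 0 1 != 0 :> 'rV[K]_3 by rewrite vec3_eq0 oner_eq0 !andbF.
have [sZ hsZ] := line_finite hZ.
have [s hs] := AB.
exists cs, ((lead_coef r)^-1 *: (V * A)); split.
- apply/allP => c; rewrite mem_cat => /orP[/nseqP[-> _] //|/mapP[z _ ->]].
  by rewrite vec3_eq0 oner_eq0.
- by rewrite scs rpredZ // dhomogM.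
exists (sZ ++ s) => Q; rewrite mem_cat negb_or => /andP[Qz /hs eAB].
rewrite mevalZ mevalM -!mulrA eAB !mulrA; congr (_ * _).
have z0 : cvec Q 0 2 != 0.
  apply: contra Qz => /eqP z0; apply: hsZ.
  by rewrite ev_lin_dot /dot !vec3E z0; ring.
have eQ : cvec Q = cvec Q 0 2 *: vec3 (cvec Q 0 0 / cvec Q 0 2) (cvec Q 0 1 / cvec Q 0 2) 1.
  by rewrite {1}(vec3_eta (cvec Q)) vec3Z mulr1 ![cvec Q 0 2 * _]mulrC !divfK.
have := cvec_on Q; move: eQ z0; move: (cvec Q 0 2) (_ / _) (_ / _) => z y x -> z0.
rewrite (ev_homogZ _ _ F_homog) (ev_homogZ _ _ hcs) (ev_homogZ _ _ hV) (ev_homogZ _ _ hB).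
move/eqP; rewrite mulf_eq0 (negPf (expf_neq0 _ z0)) /= => /eqP Fxy.
by rewrite evcs (hrv _ _ Fxy) eV exprD; ring.
Qed.

(** The relation on [C] becomes [A B - l C = H F] with [l] the form of the line, and [l] restricts
    to zero. *)
Lemma quotient_on_line (M : 'M[K]_3) A B C m n (s : seq (curve F)) : M \in unitmx ->
  A \is m.-homog -> B \is n.-homog -> coord_form M 2 * C \is (m + n).-homog ->
  (forall Q : curve F, Q \notin s ->
    ev A (cvec Q) * ev B (cvec Q) = ev (coord_form M 2) (cvec Q) * ev C (cvec Q)) ->
  restr (row 0 M) (row 1 M) F %| restr (row 0 M) (row 1 M) A * restr (row 0 M) (row 1 M) B.
Proof.
move=> uM hA hB hC hs.
have [||H eH] := @homog_vanish_dvd (m + n) (A * B - coord_form M 2 * C) s.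
- by rewrite rpredB // dhomogM.
- by move=> Q /hs; rewrite mevalB !mevalM => ->; rewrite subrr.
have l0 : restr (row 0 M) (row 1 M) (coord_form M 2) = 0.
  by rewrite restr_coord !ev_coord_row // mul0r addr0.
apply/dvdpP; exists (restr (row 0 M) (row 1 M) H).
by rewrite -!rmorphM /= -eH rmorphB !rmorphM /= l0 mul0r subr0.
Qed.

Lemma divide_line (M : 'M[K]_3) A B m : M \in unitmx -> ev F (row 1 M) != 0 ->
  A \is m.-homog -> pullback_eq A (coord_form M 2 * B) ->
  restr (row 0 M) (row 1 M) F %| restr (row 0 M) (row 1 M) A ->
  exists2 A1, A1 \is m.-1.-homog & pullback_eq A1 B.
Proof.
move=> uM Fw hA [s hs] fA.
have [A1 [H [hA1 eA]]] := restr_dvd uM hA F_homog Fw fA.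
have [|s' hs'] := @line_finite (col 2 (invmx M))^T.
  apply/eqP => c0; have := ev_coord_row 2 2 uM.
  rewrite /coord_form c0 ev_lin big1 => [/esym/eqP|i _]; last by rewrite mxE mul0r.
  by rewrite eqxx oner_eq0.
exists A1 => //; exists (s ++ s') => Q; rewrite mem_cat negb_or => /andP[/hs + /negP Qs'].
rewrite eA mevalD !mevalM cvec_on mulr0 addr0 -!mulrA; apply: mulfI.
by apply/eqP => l0; apply: Qs'; apply: hs'.
Qed.

Lemma ev_coord_line (M : 'M[K]_3) j t : M \in unitmx ->
  ev (coord_form M j) (row 0 M + t *: row 1 M) = (0 == j)%:R + t * (1 == j)%:R.
Proof.
move=> uM; rewrite -(ev_coord_row 0 j uM) -(ev_coord_row 1 j uM) !ev_coord_form mulmxDl -scalemxAl.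
by rewrite !mxE.
Qed.

Lemma root_point (M : 'M[K]_3) t : M \in unitmx ->
  root (restr (row 0 M) (row 1 M) F) t ->
  exists P : curve F, exists2 c, c != 0 & cvec P = c *: (row 0 M + t *: row 1 M).
Proof.
move=> uM; rewrite /root restr_ev => /eqP Fv.
have [|P /span_cvec h] := point_exists F_homog _ Fv; last by exists P.
apply: contraTneq (oner_neq0 K) => v0; rewrite negbK.
have := ev_coord_line 0 t uM; rewrite v0 (ev_homog0 (coord_form_homog M 0)).
by rewrite eqxx mulr0 addr0 => /esym/eqP.
Qed.

Lemma nonroot_restr (M : 'M[K]_3) n h c t (P : curve F) : h \is n.-homog ->
  cvec P = c *: (row 0 M + t *: row 1 M) -> ev h (cvec P) != 0 ->
  ~~ root (restr (row 0 M) (row 1 M) h) t.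
Proof.
move=> hh ->; rewrite (ev_homogZ _ _ hh) mulf_eq0 negb_or => /andP[_].
by rewrite /root restr_ev.
Qed.

Lemma coords_on_line (M : 'M[K]_3) c t (P : curve F) : M \in unitmx ->
  cvec P = c *: (row 0 M + t *: row 1 M) ->
  [/\ ev (coord_form M 0) (cvec P) = c, ev (coord_form M 1) (cvec P) = c * t
    & ev (coord_form M 2) (cvec P) = 0].
Proof.
move=> uM ->; rewrite !(ev_homogZ _ _ (coord_form_homog M _)) !ev_coord_line //.
by rewrite !expr1 /= !mulr0 !addr0 !add0r !mulr1 mulr0.
Qed.

(** At a pole [B] vanishes, so [B] times the pullback is regular there by [pullback_pole]; elsewhere
    the pullback itself is regular. Either way the numerator is locally divisible on the line, so no
    factor is spoiled. *)
Lemma peel_regular (M : 'M[K]_3) A B C c mb : M \in unitmx -> ev F (row 1 M) != 0 ->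
  B \is mb.-homog -> (forall P, pole P -> ev B (cvec P) = 0) ->
  (exists s : seq (curve F), forall Q, Q \notin s -> ev B (cvec Q) != 0) ->
  C \is c.-homog -> A \is (c + mb).+1.-homog ->
  pullback_eq A (coord_form M 2 * (C * B)) ->
  exists2 A1, A1 \is (c + mb).-homog & pullback_eq A1 (C * B).
Proof.
move=> uM Fw hB Bpole [sB hsB] hC hA AB.
apply: (divide_line uM Fw hA AB); apply: dvdp_local.
  by rewrite -size_poly_eq0 restr_F_size.
have [sY hsY] := phi_Y_finite; have [s hs] := AB.
move=> t rt; have [P [k k0 eP]] := root_point uM rt.
have [pP|nP] := EM (pole P).
  have [n [h [A' [hh hA' [s' hs'] hP]]]] := pullback_pole pP.1 hB (Bpole P pP).
  exists (restr (row 0 M) (row 1 M) h); first exact: nonroot_restr hh eP hP.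
  rewrite mulrC; apply: (@quotient_on_line M A h (C * A') _ n (sY ++ sB ++ s ++ s') uM hA hh).
    have -> : ((c + mb).+1 + n = 1 + (c + (n + mb)))%N by ring.
    by rewrite dhomogM ?coord_form_homog // dhomogM.
  move=> Q; rewrite !mem_cat !negb_or => /and4P[QY /hsB B0 /hs e1 /hs' e2].
  have Y0 : cvec (phi Q) 0 1 != 0 by apply: contra QY => /eqP /hsY.
  move: e1 e2; rewrite !mevalM => e1 e2.
  apply: (mulfI (mulf_neq0 Y0 B0)).
  transitivity (ev A (cvec Q) * cvec (phi Q) 0 1 * (ev h (cvec Q) * ev B (cvec Q))); first by ring.
  rewrite e1.
  transitivity (ev (coord_form M 2) (cvec Q) * ev C (cvec Q) * ev B (cvec Q) *
    (ev h (cvec Q) * ev B (cvec Q) * ev L (cvec (phi Q)))); first by ring.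
  by rewrite -e2; ring.
have [n [A' [B' [hA' hB' [s' hs'] B'P]]]] := pullback_regular nP.
exists (restr (row 0 M) (row 1 M) B'); first exact: nonroot_restr hB' eP B'P.
rewrite mulrC; apply: (@quotient_on_line M A B' (C * B * A') _ n (sY ++ s ++ s') uM hA hB').
  have -> : ((c + mb).+1 + n = 1 + (c + mb + n))%N by ring.
  by rewrite dhomogM ?coord_form_homog // dhomogM // dhomogM.
move=> Q; rewrite !mem_cat !negb_or => /and3P[QY /hs e1 /hs' e2].
have Y0 : cvec (phi Q) 0 1 != 0 by apply: contra QY => /eqP /hsY.
move: e1; rewrite !mevalM => e1; apply: (mulfI Y0).
transitivity (ev A (cvec Q) * cvec (phi Q) 0 1 * ev B' (cvec Q)); first by ring.
rewrite e1; transitivity (ev (coord_form M 2) (cvec Q) * ev C (cvec Q) * ev B (cvec Q) *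
  (ev B' (cvec Q) * ev L (cvec (phi Q)))); first by ring.
by rewrite -e2; ring.
Qed.

(** At a pole on the line, divisibility holds only after multiplication by the linear factor of that
    point, so [f] divides [a * E] with [E] of degree [size ps]. This product has degree at most
    [mb + 1 + size ps <= q], below the degree [q + 1] of [f]; hence [a = 0]. *)
Lemma peel_small (M : 'M[K]_3) A B mb (ps : seq (curve F)) :
  M \in unitmx -> ev F (row 1 M) != 0 ->
  B \is mb.-homog -> A \is mb.+1.-homog ->
  pullback_eq A (coord_form M 2 * B) ->
  (forall P, pole P -> ev (coord_form M 2) (cvec P) = 0 -> P \in ps) ->
  (mb.+1 + size ps <= q)%N ->
  exists2 A1, A1 \is mb.-homog & pullback_eq A1 B.
Proof.
move=> uM Fw hB hA AB hps sz.
apply: (divide_line uM Fw hA AB).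
set f := restr _ _ F; set a := restr _ _ A.
pose tP (P : curve F) := ev (coord_form M 1) (cvec P) / ev (coord_form M 0) (cvec P).
pose E := \prod_(P <- ps) ('X - (tP P)%:P).
have f0 : f != 0 by rewrite -size_poly_eq0 restr_F_size.
have fE : f %| a * E.
  apply: dvdp_local => //.
  have [sY hsY] := phi_Y_finite; have [s hs] := AB.
  move=> t rt; have [P [k k0 eP]] := root_point uM rt.
  have [c0P c1P c2P] := coords_on_line uM eP.
  have [pP|nP] := EM (pole P).
    pose b := coord_form M 1 - t *: coord_form M 0.
    have hb : b \is 1.-homog by rewrite rpredB ?rpredZ ?coord_form_homog.
    have bP : ev b (cvec P) = 0 by rewrite mevalB mevalZ c0P c1P mulrC subrr.
    have [n [h [A' [hh hA' [s' hs'] hP]]]] := pullback_pole pP.1 hb bP.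
    exists (restr (row 0 M) (row 1 M) h); first exact: nonroot_restr hh eP hP.
    have rb : restr (row 0 M) (row 1 M) b = 'X - t%:P.
      rewrite rmorphB /= restrZ !restr_coord !ev_coord_row //= mul0r addr0 add0r.
      by rewrite mul1r -mul_polyC mulr1.
    have fq : f %| a * restr (row 0 M) (row 1 M) (h * b).
      apply: (@quotient_on_line M A (h * b) (B * A') _ (n + 1) (sY ++ s ++ s') uM hA).
      - by rewrite dhomogM.
      - have -> : (mb.+1 + (n + 1) = 1 + (mb + (n + 1)))%N by ring.
        by rewrite dhomogM ?coord_form_homog // dhomogM.
      move=> Q; rewrite !mem_cat !negb_or => /and3P[QY /hs e1 /hs' e2].
      have Y0 : cvec (phi Q) 0 1 != 0 by apply: contra QY => /eqP /hsY.
      move: e1; rewrite !mevalM => e1; apply: (mulfI Y0).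
      transitivity (ev A (cvec Q) * cvec (phi Q) 0 1 * (ev h (cvec Q) * ev b (cvec Q))).
        by ring.
      rewrite e1; transitivity (ev (coord_form M 2) (cvec Q) * ev B (cvec Q) *
        (ev h (cvec Q) * ev b (cvec Q) * ev L (cvec (phi Q)))); first by ring.
      by move: e2; rewrite mevalM => <-; ring.
    rewrite /E (big_rem P) /=; last exact: hps.
    have -> : tP P = t by rewrite /tP c0P c1P mulrC mulKf.
    move: fq; rewrite rmorphM /= rb => fq.
    move: fq; move: (restr _ _ h) ('X - t%:P) (\prod_(y <- rem P ps) _) => r1 r2 r3 fq.
    by rewrite mulrCA [r1 * _]mulrA mulrA dvdp_mulr.
  have [n [A' [B' [hA' hB' [s' hs'] B'P]]]] := pullback_regular nP.
  exists (restr (row 0 M) (row 1 M) B'); first exact: nonroot_restr hB' eP B'P.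
  rewrite mulrA dvdp_mulr // mulrC.
  apply: (@quotient_on_line M A B' (B * A') _ n (sY ++ s ++ s') uM hA hB').
    have -> : (mb.+1 + n = 1 + (mb + n))%N by ring.
    by rewrite dhomogM ?coord_form_homog // dhomogM.
  move=> Q; rewrite !mem_cat !negb_or => /and3P[QY /hs e1 /hs' e2].
  have Y0 : cvec (phi Q) 0 1 != 0 by apply: contra QY => /eqP /hsY.
  move: e1; rewrite !mevalM => e1; apply: (mulfI Y0).
  transitivity (ev A (cvec Q) * cvec (phi Q) 0 1 * ev B' (cvec Q)); first by ring.
  rewrite e1; transitivity (ev (coord_form M 2) (cvec Q) * ev B (cvec Q) *
    (ev B' (cvec Q) * ev L (cvec (phi Q)))); first by ring.
  by rewrite -e2; ring.
have [a0|a0] := eqVneq a 0; first by rewrite a0 dvdp0.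
have mE : E \is monic by exact: monic_prod_XsubC.
have := dvdp_leq (mulf_neq0 a0 (monic_neq0 mE)) fE.
rewrite size_Mmonic // size_prod_XsubC restr_F_size // => szf.
have [sza _] := restr_top (row 0 M) (row 1 M) hA.
move: szf; rewrite addnS /= => szf.
by have := leq_trans szf (leq_add sza (leqnn (size ps))); rewrite addSn ltnS ltnNge sz.
Qed.

(** The fraction of [lines_denominator] is expanded by [B], after which its lines can be removed one
    at a time while [B] stays. *)
Lemma pullback_glue B mb : B \is mb.-homog ->
  (forall P, pole P -> ev B (cvec P) = 0) ->
  (exists s : seq (curve F), forall Q, Q \notin s -> ev B (cvec Q) != 0) ->
  exists2 A, A \is mb.-homog & pullback_eq A B.
Proof.
move=> hB Bpole Bgen; have [cs [A [cs0 hA AB]]] := lines_denominator.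
have {AB} : pullback_eq (B * A) (\prod_(c <- cs) lin c * B).
  by rewrite mulrC [_ * B]mulrC -[A * B]mulrC; exact: pullback_eqM.
have : B * A \is (size cs + mb).-homog by rewrite addnC dhomogM.
move: (B * A) => {A hA}; elim: cs cs0 => [_ A hA|c cs IH /= /andP[c0 cs0] A hA].
  by rewrite big_nil mul1r; exists A.
have [M [uM Fw eM]] := frame_exists c0.
rewrite big_cons -mulrA -eM => AB.
have [A1 hA1 AB1] := peel_regular uM Fw hB Bpole Bgen (lin_prod_homog cs) hA AB.
exact: IH AB1.
Qed.

Lemma pullback_const A : A \is 0.-homog -> pullback_eq A 1 ->
  exists c, L = c *: 'X_1.
Proof.
move=> hA [s hs]; exists (ev A 0); apply/eqP; rewrite -subr_eq0; apply/eqP.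
apply: (@homog_vanish_small 1 _ (map phi s)).
- by rewrite rpredB ?rpredZ ?homogX.
- exact: leq_trans q_ge4.
move=> R Rs; have : psi R \notin s.
  by apply: contra Rs => Rs; rewrite -(psiK R) map_f.
move/hs; rewrite psiK meval1 mul1r mevalB mevalZ evX => <-.
have -> : ev A 0 = ev A (cvec (psi R)).
  by rewrite -(scale0r (cvec (psi R))) (ev_homogZ _ _ hA) expr0 mul1r.
by rewrite subrr.
Qed.

(** [c0] joins two poles; every pole in [rest] gets a line missing the other points of [D].
    Cancelling such a line, with those of [r] still left, requires [size r + 3 <= q], which holds
    because two points of [D] lie on [c0]. Cancelling [c0] at the end requires [1 + size ps <= q],
    which holds because some point of [D] is off [c0]. A constant pullback then contradicts the
    assumption on [L]. *)
Lemma poles_collinear (D : seq (curve F)) : uniq D -> (1 < size D <= q)%N ->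
  (forall P, pole P -> P \in D) -> (forall c, L <> c *: 'X_1) ->
  exists2 c : 'rV[K]_3, c != 0 & forall P, P \in D -> dot c (cvec P) = 0.
Proof.
move=> uD /andP[D1 Dq] poleD nL.
have [P1 [P2 [P1D P2D P12]]] : exists P1 P2, [/\ P1 \in D, P2 \in D & P1 != P2].
  case: D uD D1 {Dq poleD} => [//|P1 [//|P2 D]] /= /andP[+ _] _.
  rewrite inE negb_or => /andP[ne _]; exists P1, P2.
  by split; rewrite ?inE ?eqxx ?orbT.
pose c0 := cross (cvec P1) (cvec P2).
have c00 : c0 != 0.
  apply: cross_neq0; first exact: cvec_neq0.
  by move=> t; apply: contraNneq P12 => /cvec_inj ->.
pose on (P : curve F) := dot c0 (cvec P) == 0.
pose ps := filter on D; pose rest := filter (predC on) D.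
have szD : (size ps + size rest = size D)%N.
  by rewrite !size_filter count_predC.
have ps2 : (2 <= size ps)%N.
  have : {subset [:: P1; P2] <= ps}.
    move=> P; rewrite !inE mem_filter => /orP[] /eqP ->.
      by rewrite P1D /on dot_crossl eqxx.
    by rewrite P2D /on dot_crossr eqxx.
  by apply: uniq_leq_size; rewrite /= inE P12.
have [rest0|rest1] := posnP (size rest).
  exists c0 => // P PD; apply/eqP/negbNE/negP => nP.
  have : P \in rest by rewrite mem_filter /= nP.
  by rewrite (size0nil rest0).
have /choice[cl hcl] : forall P : curve F, exists c : 'rV[K]_3, P \in D ->
    [/\ c != 0, dot c (cvec P) = 0 &
       forall P' : curve F, P' \in D -> P' != P -> dot c (cvec P') != 0].
  move=> P.
  have [w|c [cn0 cP cs]] :=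
    @line_avoiding K (cvec P) [seq cvec P' | P' <- D & P' != P] (cvec_neq0 P).
    case/mapP=> P'; rewrite mem_filter => /andP[ne _] -> t.
    by apply: contraNneq ne => /cvec_inj ->.
  exists c => PD; split=> // P' P'D ne; apply: cs; apply: map_f.
  by rewrite mem_filter ne.
pose B := \prod_(P <- rest) lin (cl P) * lin c0.
have restD : {subset rest <= D} by move=> P; rewrite mem_filter => /andP[].
have hprod (r : seq (curve F)) : \prod_(P <- r) lin (cl P) \is (size r).-homog.
  by have := lin_prod_homog (map cl r); rewrite big_map size_map.
have hB : B \is (size rest + 1).-homog by rewrite dhomogM ?lin_homog.
have Bpole (P : curve F) : pole P -> ev B (cvec P) = 0.
  move=> /poleD PD; have [oP|nP] := boolP (on P).
    by rewrite mevalM ev_lin_dot (eqP oP) mulr0.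
  rewrite mevalM (big_rem P) /=; last by rewrite mem_filter /= nP.
  by have [_ clP _] := hcl P PD; rewrite mevalM ev_lin_dot clP !mul0r.
have Bgen : exists s : seq (curve F), forall Q, Q \notin s -> ev B (cvec Q) != 0.
  have [|s hs] := @lin_prod_generic (c0 :: map cl rest).
    rewrite /= c00 all_map; apply/allP => P /restD PD /=.
    by have [] := hcl P PD.
  by exists s => Q /hs; rewrite big_cons big_map mulrC.
have [A hA AB] := pullback_glue hB Bpole Bgen.
have [A1 hA1 AB1] : exists2 A1, A1 \is 1.-homog & pullback_eq A1 (lin c0).
  have szr : (size rest + 2 <= q)%N.
    by rewrite (leq_trans _ Dq) // -szD addnC leq_add2r.
  move: hA AB szr; rewrite /B addn1; move: (rest) restD A {Bgen Bpole hB rest1 szD}.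
  elim=> [|P r IH] rD A hA; first by rewrite big_nil mul1r; exists A.
  have PD : P \in D by rewrite rD ?mem_head.
  have [clP0 clPP clPn] := hcl P PD.
  have [M [uM Fw eM]] := frame_exists clP0.
  rewrite big_cons -mulrA -eM => AB szr.
  have hB' : \prod_(P' <- r) lin (cl P') * lin c0 \is (size r).+1.-homog.
    by apply: (dhomogM_eq (hprod r) (lin_homog c0)); rewrite addn1.
  have [||A1 hA1 AB1] := @peel_small M A _ (size r).+1 [:: P] uM Fw hB' hA AB.
  - move=> P' /poleD P'D; rewrite eM ev_lin_dot inE => cP'.
    by apply: contra_eqT cP' => ne; exact: clPn.
  - by rewrite /= in szr *; rewrite addn1 -addn2.
  apply: IH AB1 _ => //; first by move=> P' P'r; apply: rD; rewrite inE P'r orbT.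
  by apply: leq_trans szr; rewrite leq_add2r leqnSn.
have [M [uM Fw eM]] := frame_exists c00.
have [|||A2 hA2 AB2] := @peel_small M A1 1 0 ps uM Fw (dhomog1 _ _) hA1.
- by rewrite mulr1 eM.
- move=> P /poleD PD; rewrite eM ev_lin_dot mem_filter PD andbT => cP.
  by rewrite /on cP.
- by rewrite (leq_trans _ Dq) // -szD addnC leq_add2l.
have [c ec] := pullback_const hA2 AB2.
by case: (nL c).
Qed.

End Pullback.

Lemma homog1_lin (A : {mpoly K[3]}) : A \is 1.-homog -> exists c, A = lin c.
Proof.
move=> hA; exists (\row_i A@_U_(i)); apply/mpolyP => m.
have [m1|m1] := eqVneq (mdeg m) 1%N; last first.
  by rewrite !(@dhomog_nemf_coeff _ _ mdeg 1) ?lin_homog.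
have /eqP/mdeg1P[i /eqP->] := m1.
rewrite raddf_sum /= (bigD1 i) //= mcoeffZ mcoeffX eqxx mulr1 mxE big1 ?addr0 //.
move=> j ji; rewrite mcoeffZ mcoeffX; case: eqP => [/mnmP/(_ i)|_]; last by rewrite mulr0.
by rewrite !mnm1E eqxx (negPf ji).
Qed.

Lemma four_distinct (T : eqType) (s : seq T) : uniq s -> (3 < size s)%N ->
  exists x1 x2 x3 x4, [&& x1 \in s, x2 \in s, x3 \in s & x4 \in s] /\
    uniq [:: x1; x2; x3; x4].
Proof.
case: s => [//|x1 [//|x2 [//|x3 [//|x4 s]]]] us _.
exists x1, x2, x3, x4; split; first by rewrite !inE !eqxx !orbT.
by have := take_uniq 4 us; rewrite /= take0.
Qed.

(** For [y = 0] the equation is [z x^q + x z^q = 0], whose solutions are the points of the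
    projective line over [F_q]. *)
Lemma Y_line_points : exists s : seq (curve F), [/\ uniq s, size s = q.+1 &
  forall P, (P \in s) = (cvec P 0 1 == 0)].
Proof.
have q0 : 0 ^+ q = 0 :> K by rewrite expr0n eqn0Ngt q_gt0.
have on a : ev F (vec3 (iota a) 0 1) = 0.
  rewrite F_ev iotaq expr1n !mul1r mulr1 mul0r exprS mul0r mulr0 !addr0.
  by rewrite (addrr_pchar2 charK).
have oninf : ev F (vec3 1 0 0) = 0.
  by rewrite F_ev q0 [0 ^+ q.+1]exprS !mul0r !mulr0 !addr0.
have n0 a : vec3 (iota a) 0 1 != 0 by rewrite vec3_eq0 oner_eq0 !andbF.
have n0inf : vec3 1 0 0 != 0 :> 'rV[K]_3 by rewrite vec3_eq0 oner_eq0.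
have [Pi hPi] := point_exists F_homog n0inf oninf.
have /choice[f hf] : forall a, exists P : curve F, val (val P) = <[vec3 (iota a) 0 1]>%VS.
  by move=> a; exact: point_exists F_homog (n0 a) (on a).
exists (Pi :: map f (enum Fq)); split.
- rewrite /= map_inj_uniq ?enum_uniq ?andbT.
    apply/mapP => -[a _ e1]; have := hf a; rewrite -e1 hPi => /eqP/span_eqP-/(_ (n0 a))[c _].
    move/rowP => h; move: (h 0) (h 2); rewrite !mxE /= mulr1 => + c0.
    by rewrite -c0 mul0r => /eqP; rewrite oner_eq0.
  move=> a b e1; have := hf a; rewrite e1 hf => /eqP/span_eqP-/(_ (n0 a))[c _ /rowP h].
  move: (h 0) (h 2); rewrite !mxE /= mulr1 => + c1.
  by rewrite -c1 mul1r => /fmorph_inj.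
- by rewrite /= size_map -cardE card_Fq.
move=> P; rewrite inE; apply/orP/eqP => [[/eqP->|/mapP[a _ ->]]|P1].
- by have [c _ ->] := span_cvec hPi; rewrite !mxE /= mulr0.
- by have [c _ ->] := span_cvec (hf a); rewrite !mxE /= mulr0.
have := cvec_on P; have := cvec_neq0 P; have := @cvec_line _ _ P.
rewrite (vec3_eta (cvec P)) P1; move: (cvec P 0 0) (cvec P 0 2) => x z line v0.
rewrite F_ev [0 ^+ q.+1]exprS !mul0r mulr0 !addr0 => Fv.
have [z0|z0] := eqVneq z 0.
  left; apply/eqP; do 2!apply: val_inj; rewrite hPi; apply: (line _ x).
  by rewrite vec3Z mulr1 mulr0 z0.
right; have [|a ea] := @Fq_fixed (x / z).
  rewrite exprMn exprVn; apply: (mulIf (expf_neq0 q z0)); rewrite divfK ?expf_neq0 //.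
  apply: (mulfI z0); move/eqP: Fv; rewrite addr_eq0 (oppr_pchar2 charK) => /eqP ->.
  by rewrite mulrA [z * _]mulrC divfK.
apply/mapP; exists a; rewrite ?mem_enum //; do 2!apply: val_inj; rewrite hf.
by apply: (line _ z); rewrite vec3Z mulr1 mulr0 -ea mulrC divfK.
Qed.

(** * Collinearity of the preimages of the points with [Y = 0], and linearity off a finite set *)

Section Linear.
Variables phi psi : curve F -> curve F.
Hypotheses (rphi : regular_map phi) (rpsi : regular_map psi).
Hypotheses (phiK : cancel phi psi) (psiK : cancel psi phi).

(** Here [L] is the line joining [R] to [(0:1:0)]; it meets [Y = 0] only in [R], so the preimages of
    the other [q] points are collinear. The lines obtained for [R1] and [R2] share the preimages of
    [R3] and [R4], so they coincide and contain all [q + 1] preimages. *)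
Lemma pullback_Y_collinear : exists2 c : 'rV[K]_3, c != 0 &
  forall P, cvec (phi P) 0 1 = 0 -> dot c (cvec P) = 0.
Proof.
have [RY [uRY sRY mRY]] := Y_line_points.
have main R : R \in RY -> exists2 c : 'rV[K]_3, c != 0 &
    forall P, cvec (phi P) 0 1 = 0 -> phi P != R -> dot c (cvec P) = 0.
  move=> RR; pose L : {mpoly K[3]} := lin (cross (cvec R) (vec3 0 1 0)).
  have LE v : ev L v = dot (cross (cvec R) (vec3 0 1 0)) v by exact: ev_lin_dot.
  have R1 : cvec R 0 1 = 0 by apply/eqP; rewrite -mRY.
  have L0 R' : R' \in RY -> ev L (cvec R') = 0 -> R' = R.
    rewrite mRY => /eqP R'1; rewrite LE dot_cross /dot R1 !crossE !vec3E => h.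
    have [|c /cvec_inj //] := @cross_eq0 _ (cvec R) (cvec R') (cvec_neq0 R) _.
    apply/rowP => i; rewrite [RHS]mxE; case: (ord3P i) => ->; rewrite !crossE ?R1 ?R'1.
    - by ring.
    - by rewrite -[RHS]oppr0 -h; ring.
    by ring.
  pose D := map psi (rem R RY).
  have uD : uniq D by rewrite map_inj_uniq ?rem_uniq //; exact: can_inj psiK.
  have sD : size D = q by rewrite size_map size_rem // sRY.
  have mD P : cvec (phi P) 0 1 = 0 -> phi P != R -> P \in D.
    by move=> /eqP; rewrite -mRY => Y0 ne; rewrite -(phiK P) map_f // mem_rem_uniq // inE ne.
  have [|||c c0 hc] := @poles_collinear _ _ rphi rpsi phiK psiK L (lin_homog _) D uD.
  - by rewrite sD leqnn andbT (leq_trans _ q_ge4).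
  - move=> P [Y0 LP]; apply: mD => //; apply: contraNneq LP => ->.
    by rewrite LE dot_crossl.
  - move=> c eL; have [R' R'r] : exists R', R' \in rem R RY.
      have : (0 < size (rem R RY))%N by rewrite size_rem // sRY q_gt0.
      by case: (rem R RY) => // R' s _; exists R'; rewrite mem_head.
    move: R'r; rewrite mem_rem_uniq // inE => /andP[/eqP ne R'r]; apply: ne.
    apply: L0 => //; rewrite eL mevalZ evX; move: R'r; rewrite mRY => /eqP ->.
    by rewrite mulr0.
  by exists c => // P Y0 ne; apply: hc; apply: mD.
have [||R1 [R2 [R3 [R4 [/and4P[R1r R2r R3r R4r] u4]]]]] := @four_distinct _ RY.
- exact: uRY.
- by rewrite sRY ltnS ltnW // q_ge4.
have [c1 c10 h1] := main R1 R1r; have [c2 c20 h2] := main R2 R2r.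
have Y0 R : R \in RY -> cvec (phi (psi R)) 0 1 = 0 by rewrite psiK mRY => /eqP.
have use c R R' : (forall P, cvec (phi P) 0 1 = 0 -> phi P != R -> dot c (cvec P) = 0) ->
    R' \in RY -> R' != R -> dot c (cvec (psi R')) = 0.
  by move=> h R'r ne; apply: h; [exact: Y0|rewrite psiK].
move: u4; rewrite /= !inE !negb_or !andbT => /and3P[/and3P[n12 n13 n14] /andP[n23 n24] n34].
move: n13 n14 n23 n24; rewrite !(eq_sym R1) !(eq_sym R2) => n31 n41 n32 n42.
have [t ec] : exists t, c1 = t *: c2.
  apply: (@dot_two _ c2 c1 (cvec (psi R3)) (cvec (psi R4))) => //.
  - exact: cvec_neq0.
  - move=> t; apply: contraNneq n34 => /cvec_inj e1.
    by rewrite -(can_inj psiK e1).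
  - exact: (use _ _ _ h2 R3r n32).
  - exact: (use _ _ _ h2 R4r n42).
  - exact: (use _ _ _ h1 R3r n31).
  - exact: (use _ _ _ h1 R4r n41).
exists c1 => // P YP; have [e1|ne] := eqVneq (phi P) R1; last exact: h1.
by rewrite ec dotZl -(phiK P) e1 (use _ _ _ h2 R1r n12) mulr0.
Qed.

(** With the single line [c] as denominator, [pullback_glue] yields linear numerators [a0] and [a2]
    for [X / Y] and [Z / Y]; thus [phi] is [(a0 : c : a2)]. *)
Lemma aut_linear_generic : exists (M : 'M[K]_3) (s : seq (curve F)),
  forall Q, Q \notin s -> exists2 k, k != 0 & cvec (phi Q) = k *: (cvec Q *m M).
Proof.
have [c c0 hc] := pullback_Y_collinear.
have [s1 hs1] := line_finite c0.
have glue i : exists (a : 'rV[K]_3) (s : seq (curve F)), forall Q, Q \notin s ->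
    dot a (cvec Q) * cvec (phi Q) 0 1 = dot c (cvec Q) * cvec (phi Q) 0 i.
  have [|||A hA [s hs]] := @pullback_glue _ _ rphi rpsi phiK 'X_i (homogX i) (lin c) 1.
  - exact: lin_homog.
  - by move=> P [YP _]; rewrite ev_lin_dot hc.
  - exists s1 => Q; apply: contra => /eqP; exact: hs1.
  have [a ea] := homog1_lin hA; exists a, s => Q /hs.
  by rewrite ea !ev_lin_dot evX.
have [a0 [t0 h0]] := glue 0; have [a2 [t2 h2]] := glue 2.
have [sY hsY] := phi_Y_finite phiK.
exists (\matrix_(i, j) (if j == 0 then a0 0 i else if j == 1 then c 0 i else a2 0 i)),
  (s1 ++ t0 ++ t2 ++ sY) => Q.
rewrite !mem_cat !negb_or => /and4P[Q1 /h0 e0 /h2 e2 QY].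
have cQ : dot c (cvec Q) != 0.
  by apply: contra Q1 => /eqP cQ; apply: hs1; rewrite ev_lin_dot.
have Y0 : cvec (phi Q) 0 1 != 0 by apply: contra QY => /eqP /hsY.
exists (cvec (phi Q) 0 1 / dot c (cvec Q)); first by rewrite mulf_neq0 // invr_eq0.
have E j : (cvec Q *m \matrix_(i, j)
      (if j == 0 then a0 0 i else if j == 1 then c 0 i else a2 0 i)) 0 j =
    dot (if j == 0 then a0 else if j == 1 then c else a2) (cvec Q).
  by rewrite mxE sum_ord3 /dot !mxE; case: (j == 0); case: (j == 1); ring.
apply/rowP => j; rewrite mxE E; apply: (mulfI cQ); rewrite mulrA [dot _ _ * (_ / _)]mulrC divfK //.
by case: (ord3P j) => -> /=; rewrite -?e0 -?e2; ring.
Qed.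

End Linear.

(** * From a matrix valid off a finite set to the whole curve *)

Definition mx_forms (M : 'M[K]_3) : 3.-tuple {mpoly K[3]} :=
  [tuple lin (col j M)^T | j < 3].

Lemma gev_mx_forms M v : gev (mx_forms M) v = v *m M.
Proof.
apply/rowP => j; rewrite mxE tnth_mktuple ev_lin mxE.
by apply: eq_bigr => i _; rewrite !mxE mulrC.
Qed.

Lemma mx_forms_homog M i : tnth (mx_forms M) i \is 1.-homog.
Proof. by rewrite tnth_mktuple lin_homog. Qed.

Lemma lin_eq0 (c : 'rV[K]_3) : lin c = 0 -> c = 0.
Proof.
move=> l0; apply/rowP => i; rewrite mxE.
have := congr1 (fun p => ev p (delta_mx 0 i : 'rV[K]_3)) l0.
rewrite ev_lin meval0 (bigD1 i) //= mxE !eqxx mulr1 big1 ?addr0 // => j ji.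
by rewrite mxE (negPf ji) andbF mulr0.
Qed.

Section Linear.
Variables (phi psi : curve F -> curve F) (M : 'M[K]_3) (s : seq (curve F)).
Hypotheses (rphi : regular_map phi) (phiK : cancel phi psi) (psiK : cancel psi phi).
Hypothesis phiM : forall Q, Q \notin s ->
  exists2 k, k != 0 & cvec (phi Q) = k *: (cvec Q *m M).

(** A kernel vector of [M^T] is a linear form vanishing at all but finitely many points of [C], as
    [phi] is onto; so it is zero. *)
Lemma aut_mx_unit : M \in unitmx.
Proof.
rewrite -unitmx_tr -row_free_unit -kermx_eq0.
apply/eqP/row_matrixP => i; rewrite row0.
have : row i (kermx M^T) *m M^T = 0 by rewrite -row_mul mulmx_ker row0.
move: (row i _) => c cM; apply: lin_eq0.
apply: (@homog_vanish_small 1 _ (map phi s)); first exact: lin_homog.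
  exact: leq_trans q_ge4.
move=> R Rs; have : psi R \notin s.
  by apply: contra Rs => Rs; rewrite -(psiK R) map_f.
move/phiM; rewrite psiK => -[k _ ->].
have -> : ev (lin c) (k *: (cvec (psi R) *m M)) = k * (c *m (cvec (psi R) *m M)^T) 0 0.
  rewrite ev_lin mxE mulr_sumr; apply: eq_bigr => j _; rewrite mxE [in RHS]mxE.
  by rewrite mulrCA.
by rewrite trmx_mul mulmxA cM mul0mx mxE mulr0.
Qed.

(** The form [F o M] vanishes on [C] off a finite set, hence is a multiple of [F]; by degrees only
    the constant part of the quotient counts. *)
Lemma aut_mx_form : exists c, forall v, ev F (v *m M) = c * ev F v.
Proof.
have hFM : F \mPo mx_forms M \is q.+1.-homog.
  rewrite -[q.+1]mul1n; apply: comp_mpoly_homog; first exact: F_homog.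
  exact: mx_forms_homog.
have [|H eH] := @homog_vanish_dvd _ _ s hFM.
  move=> P /phiM[k k0 e1]; rewrite ev_comp gev_mx_forms.
  have := cvec_on (phi P); rewrite e1 (ev_homogZ _ _ F_homog) => /eqP.
  by rewrite mulf_eq0 (negPf (expf_neq0 _ k0)) => /eqP.
have eH0 : F \mPo mx_forms M = pihomog mdeg 0 H * F.
  by rewrite -(pihomogM _ 0 F_homog) -eH pihomog_dE.
exists (ev (pihomog mdeg 0 H) 0) => v.
rewrite -gev_mx_forms -ev_comp eH0 mevalM; congr (_ * _).
by rewrite -(scale0r v) (ev_homogZ _ _ (pihomogP _ _ _)) expr0 mul1r.
Qed.

(** The 2 by 2 minors of [(G, v M)], multiplied by [h] to neutralize the points outside the chart,
    are forms vanishing off a finite set, hence on all of [C], in particular at [P]. *)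
Lemma aut_mx_all P : val (val (phi P)) = <[cvec P *m M]>%VS.
Proof.
have [d [k [h [G [hh hG hP HG]]]]] := regular_at rphi P.
have [c c0 eP] := HG P hP.
pose T i j : {mpoly K[3]} := h * (tnth G i * tnth (mx_forms M) j - tnth G j * tnth (mx_forms M) i).
have hT i j : T i j \is (k.+1 + (d + 1))%N.-homog.
  by rewrite dhomogM // rpredB // dhomogM ?mx_forms_homog.
have evT i j v : ev (T i j) v = ev h v * (gev G v 0 i * (v *m M) 0 j - gev G v 0 j * (v *m M) 0 i).
  by rewrite mevalM mevalB !mevalM -!gev_mx_forms !mxE.
have T0 i j : ev (T i j) (cvec P) = 0.
  apply: (homog_vanish (hT i j) (s := s)) => Q /phiM[l l0 eQ]; rewrite evT.
  have [->|/HG[l' l'0]] := eqVneq (ev h (cvec Q)) 0; first by rewrite mul0r.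
  rewrite eQ => e1.
  have -> : gev G (cvec Q) = (l'^-1 * l) *: (cvec Q *m M).
    by rewrite -scalerA e1 scalerA mulVf // scale1r.
  rewrite mxE [X in _ - X * _]mxE; ring.
have PM0 : cvec P *m M != 0.
  apply: contraNneq (cvec_neq0 P) => e0.
  by rewrite -(mulmxK aut_mx_unit (cvec P)) e0 mul0mx.
have [|t et] := @cross_eq0 _ (cvec P *m M) (gev G (cvec P)) PM0.
  apply/rowP => i; rewrite [RHS]mxE.
  have E j l : (cvec P *m M) 0 j * gev G (cvec P) 0 l - (cvec P *m M) 0 l * gev G (cvec P) 0 j = 0.
    have /eqP := T0 l j; rewrite evT mulf_eq0 (negPf hP) /= => /eqP e1.
    by rewrite -[RHS]e1; ring.
  by case: (ord3P i) => ->; rewrite !crossE E.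
by apply: (@cvec_line _ _ _ _ (c * t)); rewrite eP et scalerA.
Qed.

End Linear.

Lemma mderiv_comp (p : {mpoly K[3]}) (G : 3.-tuple {mpoly K[3]}) i :
  (p \mPo G)^`M(i) = \sum_j (p^`M(j) \mPo G) * (tnth G j)^`M(i).
Proof.
pose I (p : {mpoly K[3]}) := (p \mPo G)^`M(i) = \sum_j (p^`M(j) \mPo G) * (tnth G j)^`M(i).
have IM p1 p2 : I p1 -> I p2 -> I (p1 * p2).
  rewrite /I rmorphM mderivM => -> ->; rewrite mulr_suml mulr_sumr -big_split /=.
  by apply: eq_bigr => j _; rewrite mderivM rmorphD !rmorphM /=; ring.
have IC c : I c%:MP.
  rewrite /I comp_mpolyC mderivC big1 // => j _.
  by rewrite mderivC comp_mpoly0 mul0r.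
rewrite -/(I p) (mpolyE p); apply: (big_ind I) => [|p1 p2|m _].
- by rewrite -(mpolyC0 3 K); exact: IC.
- rewrite /I raddfD mderivD => -> ->; rewrite -big_split; apply: eq_bigr => j _.
  by rewrite mderivD raddfD mulrDl.
rewrite -mul_mpolyC; apply: (IM) => //; rewrite mpolyXE_id.
apply: (big_ind I) => [||j _]; [by rewrite -(mpolyC1 3 K); exact: IC|exact: IM|].
have IX : I 'X_j.
  rewrite /I comp_mpolyXU -tnth_nth (bigD1 j) //= mderivXi eqxx rmorph1 mul1r.
  rewrite big1 ?addr0 // => l lj; rewrite mderivXi eq_sym (negPf lj).
  by rewrite comp_mpoly0 mul0r.
elim: (m j) => [|n IH]; first by rewrite expr0 -(mpolyC1 3 K); exact: IC.
by rewrite exprS; apply: (IM).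
Qed.

(** * Linear automorphisms *)

Definition hessian (v : 'rV[K]_3) : 'M[K]_3 :=
  \matrix_(i, j) ev (F^`M(i)^`M(j)) v.

Section LinearAut.
Variables (M : 'M[K]_3) (c : K).
Hypotheses (uM : M \in unitmx) (FM : forall v, ev F (v *m M) = c * ev F v).

Lemma F_comp_mx : F \mPo mx_forms M = c *: F.
Proof.
apply: (@homog_eq _ _ _ q.+1) => [||x y].
- by rewrite -[q.+1]mul1n; apply: comp_mpoly_homog; [exact: F_homog|exact: mx_forms_homog].
- by rewrite rpredZ ?F_homog.
by rewrite ev_comp gev_mx_forms mevalZ FM.
Qed.

Lemma mderiv_mx_comp (p : {mpoly K[3]}) i :
  (p \mPo mx_forms M)^`M(i) = \sum_j M i j *: (p^`M(j) \mPo mx_forms M).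
Proof.
rewrite mderiv_comp; apply: eq_bigr => j _; rewrite -mul_mpolyC mulrC; congr (_ * _).
rewrite tnth_mktuple /lin raddf_sum /= (bigD1 i) //= mderivZ mderivXi eqxx !mxE big1 => [|k ki].
  by rewrite addr0 -mul_mpolyC mulr1.
by rewrite mderivZ mderivXi (negPf ki) scaler0.
Qed.

Lemma gradient_mx i v : \sum_j M i j * ev F^`M(j) (v *m M) = c * ev F^`M(i) v.
Proof.
have := congr1 (fun p : {mpoly K[3]} => ev p^`M(i) v) F_comp_mx.
rewrite /= mderiv_mx_comp mderivZ mevalZ raddf_sum /= => <-; apply: eq_bigr => j _.
by rewrite mevalZ ev_comp gev_mx_forms.
Qed.

Lemma hessian_mx v : M *m hessian (v *m M) *m M^T = c *: hessian v.
Proof.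
apply/matrixP => i k; rewrite [RHS]mxE [in RHS]mxE.
have := congr1 (fun p : {mpoly K[3]} => ev p^`M(i)^`M(k) v) F_comp_mx.
rewrite /= mderiv_mx_comp mderivZ mderivZ mevalZ => <-.
have -> : (\sum_j M i j *: (F^`M(j) \mPo mx_forms M))^`M(k) =
    \sum_j M i j *: \sum_l M k l *: (F^`M(j)^`M(l) \mPo mx_forms M).
  by rewrite raddf_sum; apply: eq_bigr => j _; rewrite /= mderivZ mderiv_mx_comp.
have -> : ev (\sum_j M i j *: \sum_l M k l *: (F^`M(j)^`M(l) \mPo mx_forms M)) v =
    \sum_j \sum_l M i j * (M k l * ev F^`M(j)^`M(l) (v *m M)).
  rewrite raddf_sum; apply: eq_bigr => j _; rewrite /= mevalZ raddf_sum mulr_sumr.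
  by apply: eq_bigr => l _; rewrite /= mevalZ ev_comp gev_mx_forms.
rewrite mxE.
rewrite exchange_big; apply: eq_bigr => l _; rewrite mxE mulr_suml.
by apply: eq_bigr => j _; rewrite !mxE; ring.
Qed.

(** In characteristic 2 the only nonzero second partials are, up to symmetry, [z y^(q-2)],
    [x y^(q-2)] and [y^(q-1)]. *)
Lemma hessian_Y0 (v : 'rV[K]_3) : v 0 1 = 0 -> hessian v = 0.
Proof.
move=> v1; have [d0 d1 d2] := deriv_F.
have e2 : (q.-1 == 0)%N = false by have := q_ge4; lia.
have e3 : (q.-2 == 0)%N = false by have := q_ge4; lia.
have q1 : odd q.-1.
  by have := q_even; rewrite -[in odd q](prednK q_gt0) /= => /negbFE.
have c01 : ev F^`M(0)^`M(1) v = 0.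
  rewrite d0 mderivD mderivM !mderiv_exp !mderivXi /= (mulrn_even _ q_even).
  by rewrite mul0r !add0r mulr1 mevalM mevalMn rmorphXn /= !evX v1 expr0n e3 mul0rn mulr0.
have c21 : ev F^`M(2)^`M(1) v = 0.
  rewrite d2 mderivD mderivM !mderiv_exp !mderivXi /= (mulrn_even _ q_even).
  by rewrite mul0r !add0r mulr1 mevalM mevalMn rmorphXn /= !evX v1 expr0n e3 mul0rn mulr0.
have c02 : ev F^`M(0)^`M(2) v = 0.
  rewrite d0 mderivD mderivM !mderiv_exp !mderivXi /= (mulrn_even _ q_even).
  by rewrite !mulr0 mul0rn mul1r mulr0 addr0 add0r rmorphXn /= evX v1 expr0n e2.
have c00 : ev F^`M(0)^`M(0) v = 0.
  rewrite d0 mderivD mderivM !mderiv_exp !mderivXi /= (mulrn_even _ q_even).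
  by rewrite !mulr0 mul0r mul0rn mulr0 !addr0 meval0.
have c22 : ev F^`M(2)^`M(2) v = 0.
  rewrite d2 mderivD mderivM !mderiv_exp !mderivXi /= (mulrn_even _ q_even).
  by rewrite !mulr0 mul0r mul0rn mulr0 !addr0 meval0.
have c11 : ev F^`M(1)^`M(1) v = 0.
  have [_ T1 _] := deriv_Tau.
  rewrite d1 mderivD T1 mderivZ mderiv_exp (mulrn_even _ q_even) scaler0 addr0.
  exact: meval0.
apply/matrixP => i j; rewrite !mxE.
case: (ord3P i) => ->; case: (ord3P j) => -> //; rewrite mderiv_comm //.
Qed.

(** By [hessian_mx] the Hessian at [v M] vanishes along with the one at [v], and its entry [(0, 2)]
    is the power [q - 1] of the [Y] coordinate. *)
Lemma Y_line_fixed : M 0 1 = 0 /\ M 2 1 = 0.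
Proof.
have main (v : 'rV[K]_3) : v 0 1 = 0 -> (v *m M) 0 1 = 0.
  move=> /hessian_Y0 h0; have := hessian_mx v; rewrite h0 scaler0 => /eqP.
  have uMT : M^T \in unitmx by rewrite unitmx_tr.
  rewrite -[0](mul0mx _ M^T) => /eqP /(congr1 (mulmx^~ (invmx M^T))).
  rewrite !mulmxK // => /(congr1 (mulmx (invmx M))); rewrite mulKmx // mulmx0.
  move/matrixP/(_ 0 2); rewrite !mxE; have [-> _ _] := deriv_F.
  rewrite mderivD mderivM !mderiv_exp !mderivXi /= (mulrn_even _ q_even).
  rewrite !mulr0 mul0rn mul1r mulr0 addr0 add0r rmorphXn /= evX => /eqP.
  by rewrite expf_eq0 mxE => /andP[_ /eqP].
split; [have := main (delta_mx 0 0)|have := main (delta_mx 0 2)];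
  by rewrite -rowE !mxE => ->.
Qed.

End LinearAut.

(** * Normal form of the matrix over [F_q] *)

Lemma q_gt1 : (1 < q)%N.
Proof. exact: leq_trans q_ge4. Qed.

(** The coefficient of [x^q] is [n], since the terms of [tau] have degrees [2^i < q]. *)
Lemma frob_additive_eq0 (n k : K) :
  (forall x, n * (x ^+ q + x) + tau (n * x) 1 + k = 0) -> n = 0.
Proof.
move=> h; pose p := n *: 'X^q + n *: 'X + \sum_(i < e) n ^+ (2 ^ i) *: 'X^(2 ^ i) + k%:P.
have p0 : p = 0.
  apply: poly_root_all => x; rewrite -[RHS](h x) tau_trace.
  rewrite !(hornerD, hornerZ, hornerXn, hornerX, hornerC) horner_sum.
  rewrite mulrDr; congr (_ + _ + _ + _); apply: eq_bigr => i _.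
  by rewrite hornerZ hornerXn exprMn.
have := congr1 (fun r : {poly K} => r`_q) p0.
rewrite /p !coefD !coefZ coefXn coefX coefC coef0 coef_sum eqxx mulr1.
rewrite big1 => [|i _]; last first.
  rewrite coefZ coefXn qE eqn_exp2l // gtn_eqF ?mulr0 //.
have -> : (q == 1%N) = false by have := q_gt1; lia.
have -> : (q == 0%N) = false by have := q_gt1; lia.
by rewrite mulr0 !addr0.
Qed.

Lemma Fq_sqrt (w : K) : w ^+ q = w -> exists2 s, s ^+ 2 = w & s ^+ q = s.
Proof.
move=> wq; exists (w ^+ (2 ^ e.-1)); last by rewrite exprAC wq.
have e0 : (0 < e)%N by exact: leq_trans e_ge2.
by rewrite -exprM -expnSr prednK // -qE.
Qed.

Lemma sqr_inj (x y : K) : x ^+ 2 = y ^+ 2 -> x = y.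
Proof.
move=> h; apply/eqP; rewrite -subr_eq0 -sqrf_eq0 (oppr_pchar2 charK).
by have := frob 1 x y; rewrite expn1 => ->; rewrite h (addrr_pchar2 charK).
Qed.

(** With [s^2 = w], one has [w x^2 + kap x = (s x)^2 + s x + (s + kap) x], and [tau] maps the first
    two terms to [s (x^q + x)]. The hypothesis becomes that of [frob_additive_eq0] for
    [n = s + kap]. *)
Lemma conic_coeff (w kap k : K) : w ^+ q = w ->
  (forall x, kap * (x ^+ q + x) + tau (w * x ^+ 2 + kap * x) 1 + k = 0) -> kap ^+ 2 = w.
Proof.
move=> wq h; have [s s2 sq] := Fq_sqrt wq.
suff n0 : s + kap = 0.
  by move/eqP: n0; rewrite addr_eq0 (oppr_pchar2 charK) => /eqP <-.
apply: (@frob_additive_eq0 _ k) => x; rewrite -[RHS](h x).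
have -> : w * x ^+ 2 + kap * x = ((s * x) ^+ 2 + s * x * 1) + (s + kap) * x.
  by rewrite -s2; ring: two0.
rewrite tauD tau_artin_schreier expr1n mulr1 exprMn sq.
by move: (tau _ _) => t; ring: two0.
Qed.

(** The coefficient of [w^2] gives [c^2 = c]; the trace has this term because [e >= 2]. *)
Lemma trace_scale_eq1 (c : K) : c != 0 -> (forall w, tau (c * w) 1 = c * tau w 1) -> c = 1.
Proof.
move=> c0 h; pose p := \sum_(i < e) (c ^+ (2 ^ i) - c) *: 'X^(2 ^ i).
have p0 : p = 0.
  apply: poly_root_all => x; have /eqP := h x; rewrite -subr_eq0 !tau_trace mulr_sumr.
  move/eqP => <-; rewrite -sumrB horner_sum; apply: eq_bigr => i _.
  by rewrite hornerZ hornerXn exprMn; ring.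
have := congr1 (fun r : {poly K} => r`_2) p0.
rewrite /p coef0 coef_sum (bigD1 (Ordinal e_ge2)) //= coefZ coefXn eqxx mulr1 big1.
  rewrite addr0 expn1 expr2 => /eqP; rewrite -[X in _ - X]mulr1 -mulrBr mulf_eq0 (negPf c0).
  by rewrite subr_eq0 => /eqP.
move=> i i1; rewrite coefZ coefXn -[X in X == _](expn1 2) eqn_exp2l //.
by case: eqP => [e1|_]; [case/eqP: i1; apply: val_inj|rewrite mulr0].
Qed.

Section NormalForm.
Variables (a b b' d f g c : K).
Let x' x y z := a * x + b * y + b' * z.
Let z' x y z := d * x + f * y + g * z.
Hypothesis c0 : c != 0.
Hypothesis grad0 : forall x y z,
  a * (z' x y z ^+ q + z' x y z * y ^+ q.-1) + d * (x' x y z ^+ q + x' x y z * y ^+ q.-1)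
  = c * (z ^+ q + z * y ^+ q.-1).
Hypothesis grad2 : forall x y z,
  b' * (z' x y z ^+ q + z' x y z * y ^+ q.-1) + g * (x' x y z ^+ q + x' x y z * y ^+ q.-1)
  = c * (x ^+ q + x * y ^+ q.-1).
Hypothesis inv : forall x z,
  z' x 1 z * x' x 1 z ^+ q + x' x 1 z * z' x 1 z ^+ q + tau (x' x 1 z * z' x 1 z) 1 + lambda
  = c * (z * x ^+ q + x * z ^+ q + tau (x * z) 1 + lambda).

(** At points with coordinates 0 and 1 the gradient identities become equations linear in [q]-th
    powers, with a system of determinant [c = a g + b' d]. Cramer's rule expresses [c] times the
    [q]-th power of each entry, and the result is [c] times the entry. *)
Lemma normal_form_Fq : [/\ [/\ a ^+ q = a, b ^+ q = b & b' ^+ q = b'],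
  [/\ d ^+ q = d, f ^+ q = f & g ^+ q = g] & c = a * g + b' * d].
Proof.
have q0 : 0 ^+ q = 0 :> K by rewrite expr0n eqn0Ngt q_gt0.
have q10 : 0 ^+ q.-1 = 0 :> K.
  by rewrite expr0n; have := q_gt1; case: q => [|[]].
have E1 : a * d ^+ q + d * a ^+ q = 0.
  have := grad0 1 0 0; rewrite /x' /z' !mulr0 !mulr1 !addr0 q10 q0 !mulr0 !addr0.
  by move=> ->; rewrite mulr0.
have E2 : a * g ^+ q + d * b' ^+ q = c.
  have := grad0 0 0 1; rewrite /x' /z' !mulr0 !mulr1 !add0r q10 !mulr0 !addr0.
  by rewrite expr1n mulr1.
have E3 : b' * d ^+ q + g * a ^+ q = c.
  have := grad2 1 0 0; rewrite /x' /z' !mulr0 !mulr1 !addr0 q10 !mulr0 !addr0.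
  by rewrite expr1n mulr1.
have E4 : b' * g ^+ q + g * b' ^+ q = 0.
  have := grad2 0 0 1; rewrite /x' /z' !mulr0 !mulr1 !add0r q10 q0 !mulr0 !addr0.
  by move=> ->; rewrite mulr0.
have E5 : a * (f ^+ q + f) + d * (b ^+ q + b) = 0.
  have := grad0 0 1 0; rewrite /x' /z' !mulr0 !mulr1 !addr0 !add0r q0 expr1n !mulr1.
  by move=> ->; rewrite addr0 mulr0.
have E6 : b' * (f ^+ q + f) + g * (b ^+ q + b) = 0.
  have := grad2 0 1 0; rewrite /x' /z' !mulr0 !mulr1 !addr0 !add0r q0 expr1n !mulr1.
  by move=> ->; rewrite addr0 mulr0.
have E7 : a * (f ^+ q + g ^+ q + (f + g)) + d * (b ^+ q + b' ^+ q + (b + b')) = 0.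
  have := grad0 0 1 1; rewrite /x' /z' !mulr0 !mulr1 !add0r !expr1n !mulr1 !frobq.
  by move=> ->; rewrite (addrr_pchar2 charK) mulr0.
have ec : c = a * g + b' * d.
  have : c + (a * g + b' * d) = 0.
    rewrite -E2 -[RHS]E7; transitivity (a * (f ^+ q + g ^+ q + (f + g)) +
      d * (b ^+ q + b' ^+ q + (b + b')) + (a * (f ^+ q + f) + d * (b ^+ q + b))).
      by move: (f ^+ q) (g ^+ q) (b ^+ q) (b' ^+ q) => *; ring: two0.
    by rewrite E5 addr0.
  by move/eqP; rewrite addr_eq0 (oppr_pchar2 charK) => /eqP.
have opp (u v : K) : u + v = 0 -> u = v.
  by move/eqP; rewrite addr_eq0 (oppr_pchar2 charK) => /eqP.
have cancel_c u v : c * u = c * v -> u = v by exact: (mulfI c0).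
split; last exact: ec.
- split; apply: cancel_c.
  + transitivity (a * (b' * d ^+ q + g * a ^+ q) + b' * (a * d ^+ q + d * a ^+ q)).
      by rewrite ec; move: (a ^+ q) (d ^+ q) => *; ring: two0.
    by rewrite E1 E3; ring.
  + apply: opp; rewrite -mulrDr ec.
    transitivity (a * (b' * (f ^+ q + f) + g * (b ^+ q + b)) +
      b' * (a * (f ^+ q + f) + d * (b ^+ q + b))).
      by move: (f ^+ q) (b ^+ q) => *; ring: two0.
    by rewrite E5 E6; ring.
  transitivity (b' * (a * g ^+ q + d * b' ^+ q) + a * (b' * g ^+ q + g * b' ^+ q)).
    by rewrite ec; move: (b' ^+ q) (g ^+ q) => *; ring: two0.
  by rewrite E2 E4; ring.
split; apply: cancel_c.
- transitivity (d * (b' * d ^+ q + g * a ^+ q) + g * (a * d ^+ q + d * a ^+ q)).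
    by rewrite ec; move: (a ^+ q) (d ^+ q) => *; ring: two0.
  by rewrite E1 E3; ring.
- apply: opp; rewrite -mulrDr ec.
  transitivity (g * (a * (f ^+ q + f) + d * (b ^+ q + b)) +
    d * (b' * (f ^+ q + f) + g * (b ^+ q + b))).
    by move: (f ^+ q) (b ^+ q) => *; ring: two0.
  by rewrite E5 E6; ring.
transitivity (g * (a * g ^+ q + d * b' ^+ q) + d * (b' * g ^+ q + g * b' ^+ q)).
  by rewrite ec; move: (b' ^+ q) (g ^+ q) => *; ring: two0.
by rewrite E2 E4; ring.
Qed.

(** The cases [z = 0] and [x = 0] of the invariance give [kap^2 = a d] and [kap'^2 = b' g]. The
    product of the new outer coordinates is then two Artin-Schreier expressions plus [c x z + b f],
    and the invariance shrinks to the compatibility of the trace with scaling by [c], so [c = 1].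
    Square roots of [a], [b'], [d], [g] exist in [F_q], and [b], [f] are recovered from [kap],
    [kap'] by Cramer's rule with determinant 1. *)
Lemma normal_form : exists A B D G : Fq,
  [/\ [/\ a = iota A ^+ 2, b = iota A * iota B & b' = iota B ^+ 2],
      [/\ d = iota D ^+ 2, f = iota D * iota G & g = iota G ^+ 2] &
      iota A * iota G + iota B * iota D = 1].
Proof.
have [[aq bq b'q] [dq fq gq] ec] := normal_form_Fq.
have q0 : 0 ^+ q = 0 :> K by rewrite expr0n eqn0Ngt q_gt0.
pose kap := a * f + b * d; pose kap' := b' * f + b * g.
have mulq u v : u ^+ q = u -> v ^+ q = v -> (u * v) ^+ q = u * v :> K.
  by move=> eu ev_; rewrite exprMn eu ev_.
(* The invariance at [x = z = 0], where the two terms [b f] cancel. *)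
pose k := tau (b * f) 1 + lambda + c * lambda.
have k2 : kap ^+ 2 = a * d.
  apply: (@conic_coeff _ _ k); first exact: mulq.
  move=> x; have := inv x 0; rewrite /x' /z' !(mulr0, mul0r, mulr1, q0, tau0, addr0, add0r).
  have -> : (a * x + b) * (d * x + f) = (a * d * x ^+ 2 + kap * x) + b * f.
    by rewrite /kap; ring.
  rewrite !frobq !exprMn aq bq dq fq tauD => e1.
  transitivity ((d * x + f) * (a * x ^+ q + b) + (a * x + b) * (d * x ^+ q + f) +
    (tau (a * d * x ^+ 2 + kap * x) 1 + tau (b * f) 1) + lambda + c * lambda).
    by rewrite /k /kap; move: (tau _ _) (tau _ _) (x ^+ q) => *; ring: two0.
  by rewrite e1 (addrr_pchar2 charK).
have k'2 : kap' ^+ 2 = b' * g.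
  apply: (@conic_coeff _ _ k); first exact: mulq.
  move=> x; have := inv 0 x; rewrite /x' /z' !(mulr0, mul0r, mulr1, q0, tau0, addr0, add0r).
  have -> : (b + b' * x) * (f + g * x) = (b' * g * x ^+ 2 + kap' * x) + b * f.
    by rewrite /kap'; ring.
  rewrite !frobq !exprMn b'q bq gq fq tauD => e1.
  transitivity ((f + g * x) * (b + b' * x ^+ q) + (b + b' * x) * (f + g * x ^+ q) +
    (tau (b' * g * x ^+ 2 + kap' * x) 1 + tau (b * f) 1) + lambda + c * lambda).
    by rewrite /k /kap'; move: (tau _ _) (tau _ _) (x ^+ q) => *; ring: two0.
  by rewrite e1 (addrr_pchar2 charK).
have tau_sq u x : tau ((u * x) ^+ 2 + u * x) 1 = (u * x) ^+ q + u * x.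
  by have := tau_artin_schreier (u * x) 1; rewrite expr1n !mulr1.
have tau4 u v w w' : tau (u + v + (w + w')) 1 = tau u 1 + tau v 1 + (tau w 1 + tau w' 1).
  by rewrite !tauD.
have kq : kap ^+ q = kap by rewrite frobq !exprMn aq fq bq dq.
have k'q : kap' ^+ q = kap' by rewrite frobq !exprMn b'q fq bq gq.
have inv' x z : tau (c * (x * z)) 1 + c * tau (x * z) 1 + k = 0.
  have := inv x z; rewrite /x' /z' !mulr1.
  have -> : (a * x + b + b' * z) * (d * x + f + g * z) =
     ((kap * x) ^+ 2 + kap * x) + ((kap' * z) ^+ 2 + kap' * z) + (c * (x * z) + b * f).
    by rewrite !exprMn k2 k'2 ec /kap /kap'; ring.
  rewrite tau4 !tau_sq !frobq !exprMn kq k'q aq bq b'q dq fq gq => e1.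
  have -> : tau (c * (x * z)) 1 + c * tau (x * z) 1 + k =
    ((d * x + f + g * z) * (a * x ^+ q + b + b' * z ^+ q) +
     (a * x + b + b' * z) * (d * x ^+ q + f + g * z ^+ q) +
     (kap * x ^+ q + kap * x + (kap' * z ^+ q + kap' * z) + (tau (c * (x * z)) 1 + tau (b * f) 1)) +
     lambda) + c * (z * x ^+ q + x * z ^+ q + tau (x * z) 1 + lambda).
    rewrite /k ec /kap /kap'; move: (tau _ _) (tau _ _) (tau _ _) (x ^+ q) (z ^+ q) => *.
    by ring: two0.
  by rewrite e1 (addrr_pchar2 charK).
have k0 : k = 0 by have := inv' 0 0; rewrite !mulr0 tau0 mulr0 !add0r.
have c1 : c = 1.
  apply: trace_scale_eq1 => // w; have := inv' w 1; rewrite k0 addr0 mulr1 => /eqP.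
  by rewrite addr_eq0 (oppr_pchar2 charK) => /eqP.
have root_ u : u ^+ q = u -> exists A, u = iota A ^+ 2.
  by move=> /Fq_sqrt[t <- /Fq_fixed[A ->]]; exists A.
have [A eA] := root_ a aq; have [B eB] := root_ b' b'q.
have [D eD] := root_ d dq; have [G eG] := root_ g gq.
exists A, B, D, G.
have AG : iota A * iota G + iota B * iota D = 1.
  apply: sqr_inj; rewrite expr1n -c1 ec eA eB eD eG; ring: two0.
have ek : kap = iota A * iota D by apply: sqr_inj; rewrite k2 eA eD exprMn.
have ek' : kap' = iota B * iota G by apply: sqr_inj; rewrite k'2 eB eG exprMn.
have e1 : a * g + b' * d = 1 by rewrite -ec.
have eb : b = a * kap' + b' * kap.
  by rewrite -[LHS]mulr1 -e1 /kap /kap'; ring: two0.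
have ef : f = g * kap + d * kap'.
  by rewrite -[LHS]mulr1 -e1 /kap /kap'; ring: two0.
split=> //; split=> //.
- rewrite eb ek ek' eA eB -[RHS]mulr1 -AG; ring.
- rewrite ef ek ek' eD eG -[RHS]mulr1 -AG; ring.
Qed.

End NormalForm.

(** * The action of GL_2 *)

(* The action of g on binary quadratic forms x s^2 + y s t + z t^2 by the
   substitution (s, t) -> (s, t) g, in characteristic 2. *)
Definition sq_mx (g : 'M[Fq]_2) : 'M[K]_3 :=
  let: (a, b) := (iota (g 0 0), iota (g 0 1)) in
  let: (c, d) := (iota (g 1 0), iota (g 1 1)) in
  \matrix_i (if i == 0 then vec3 (a ^+ 2) 0 (c ^+ 2)
             else if i == 1 then vec3 (a * b) (a * d + b * c) (c * d)
             else vec3 (b ^+ 2) 0 (d ^+ 2)).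

Lemma mul_sq_mx g x y z : vec3 x y z *m sq_mx g =
  vec3 (iota (g 0 0) ^+ 2 * x + iota (g 0 0) * iota (g 0 1) * y + iota (g 0 1) ^+ 2 * z)
       ((iota (g 0 0) * iota (g 1 1) + iota (g 0 1) * iota (g 1 0)) * y)
       (iota (g 1 0) ^+ 2 * x + iota (g 1 0) * iota (g 1 1) * y + iota (g 1 1) ^+ 2 * z).
Proof.
rewrite vec3_mulmx !rowK /= !vec3Z !vec3D !mulr0 add0r addr0.
congr (vec3 _ _ _); ring.
Qed.

Lemma sq_mx1 : sq_mx 1%:M = 1%:M.
Proof.
apply: mx3_eq => x y z; rewrite mul_sq_mx mulmx1 !mxE !(mulr1n, mulr0n) !rmorph1 !rmorph0.
congr (vec3 _ _ _); ring.
Qed.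

(** Row vectors are multiplied from the right, hence the reversal, which makes [sq_map] a
    homomorphism for composition. *)
Lemma sq_mxM g h : sq_mx (h *m g) = sq_mx g *m sq_mx h.
Proof.
apply: mx3_eq => x y z; rewrite mulmxA !mul_sq_mx !mxE !sum_ord2 !rmorphD !rmorphM.
congr (vec3 _ _ _); ring: two0.
Qed.

Lemma tauZ (d w y : K) : d ^+ q = d -> tau (d ^+ 2 * w) (d * y) = d * tau w y.
Proof.
move=> dq; rewrite mulr_sumr; apply: eq_bigr => i _.
rewrite exprMn -exprM [(d * y) ^+ _]exprMn mulrACA -exprD -expnS subnKC ?dq //.
exact: pow2_le (ltn_ord i).
Qed.

(** With [D] the determinant, the outer coordinates of the image have product
    [D^2 x z + s^2 + s (D y)]. So [tau] of it is [D tau(x z, y)] plus an Artin-Schreier term, and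
    this term absorbs the mixed terms coming from the rest of [F]. *)
Lemma F_sq_mx g v : ev F (v *m sq_mx g) =
  (iota (g 0 0) * iota (g 1 1) + iota (g 0 1) * iota (g 1 0)) ^+ 2 * ev F v.
Proof.
rewrite (vec3_eta v) mul_sq_mx !F_ev.
move: (v 0 0) (v 0 1) (v 0 2) => x y z.
have := iotaq (g 0 0); have := iotaq (g 0 1); have := iotaq (g 1 0); have := iotaq (g 1 1).
move: (iota (g 0 0)) (iota (g 0 1)) (iota (g 1 0)) (iota (g 1 1)) => a b c d dq cq bq aq.
pose D := a * d + b * c; rewrite -/D.
have Dq : D ^+ q = D by rewrite frobq !exprMn aq bq cq dq.
pose s := a * c * x + b * d * z + b * c * y.
have -> : (a ^+ 2 * x + a * b * y + b ^+ 2 * z) * (c ^+ 2 * x + c * d * y + d ^+ 2 * z) =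
    D ^+ 2 * (x * z) + (s ^+ 2 + s * (D * y)) by rewrite /s /D !sqrD2; ring: two0.
rewrite tauD tauZ // tau_artin_schreier.
have yq : y * y ^+ q.-1 = y ^+ q by rewrite -exprS prednK ?q_gt0.
have Dyq : D * y * (s * (D * y) ^+ q.-1) = s * (D * y ^+ q).
  by rewrite mulrCA -exprS prednK ?q_gt0 // exprMn Dq.
have mulq u w : u ^+ q = u -> w ^+ q = w -> (u * w) ^+ q = u * w :> K.
  by move=> eu ew; rewrite exprMn eu ew.
have lin_q u p w x1 y1 z1 : u ^+ q = u -> p ^+ q = p -> w ^+ q = w ->
    (u * x1 + p * y1 + w * z1) ^+ q = u * x1 ^+ q + p * y1 ^+ q + w * z1 ^+ q :> K.
  by move=> eu ep ew; rewrite !frobq !exprMn eu ep ew.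
have sq : s ^+ q = a * c * x ^+ q + b * d * z ^+ q + b * c * y ^+ q.
  by apply: lin_q; exact: mulq.
rewrite (mulrDr (D * y)) (mulrDr (D * y)) Dyq {}sq !lin_q ?(mulq, expr2) //.
rewrite ![_ ^+ q.+1]exprS exprMn Dq.
move: (tau _ _) (x ^+ q) (y ^+ q) (z ^+ q) => T X Y Z.
have main : (c * c * x + c * d * y + d * d * z) * (a * a * X + a * b * Y + b * b * Z) +
    (a * a * x + a * b * y + b * b * z) * (c * c * X + c * d * Y + d * d * Z) +
    (D * y * (a * c * X + b * d * Z + b * c * Y) + s * (D * Y)) = D ^+ 2 * (z * X + x * Z).
  (* Once [D ^+ 2] is expanded by [sqrD2], the left side exceeds the right by 2 times the given
     expression, as an identity with integer coefficients. *)
  rewrite -[RHS]addr0 -(mul0r (a ^+ 2 * c ^+ 2 * (x * X)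
    + (a * b * c ^+ 2 + a ^+ 2 * c * d) * (x * Y + y * X)
    + (a * b * d ^+ 2 + b ^+ 2 * c * d) * (z * Y + y * Z)
    + (2%:R * a * b * c * d + b ^+ 2 * c ^+ 2) * (y * Y) + b ^+ 2 * d ^+ 2 * (z * Z))) -two0.
  by rewrite /s /D sqrD2; ring.
rewrite [RHS](_ : _ = D ^+ 2 * (z * X + x * Z) + D ^+ 2 * (y * T + lambda * (y * Y))); last by ring.
by rewrite -main; clearbody D s; ring.
Qed.

Lemma sq_mx_det (g : 'M[Fq]_2) :
  iota (g 0 0) * iota (g 1 1) + iota (g 0 1) * iota (g 1 0) = iota (\det g).
Proof. by rewrite det_mx2 rmorphB !rmorphM (oppr_pchar2 charK). Qed.

Lemma form_mx_sq (M : 'M[K]_3) c : M \in unitmx -> M 1 1 = 1 ->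
  (forall v, ev F (v *m M) = c * ev F v) ->
  exists2 g : 'M[Fq]_2, g \in unitmx & M = sq_mx g.
Proof.
move=> uM M1 FM; have [M0 M2] := Y_line_fixed uM FM.
have vM x y z := mulmx_vec3 x y z M0 M1 M2.
have c0 : c != 0.
  apply/eqP => c0; have := FM (vec3 0 1 0 *m invmx M).
  rewrite mulmxKV // c0 mul0r F_ev !mul0r tau0 mul1r !add0r expr1n mulr1.
  by apply/eqP; exact: lambda0.
have [|||A [B [D [G [[eA eAB eB] [eD eDG eG] AG]]]]] :=
  @normal_form (M 0 0) (M 1 0) (M 2 0) (M 0 2) (M 1 2) (M 2 2) c c0.
- move=> x y z; have := gradient_mx FM 0 (vec3 x y z).
  rewrite sum_ord3 vM M0 mul0r addr0; have [-> _ _] := F_ev_deriv x y z.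
  by have [-> _ ->] := F_ev_deriv (M 0 0 * x + M 1 0 * y + M 2 0 * z) y
    (M 0 2 * x + M 1 2 * y + M 2 2 * z).
- move=> x y z; have := gradient_mx FM 2 (vec3 x y z).
  rewrite sum_ord3 vM M2 mul0r addr0; have [_ _ ->] := F_ev_deriv x y z.
  by have [-> _ ->] := F_ev_deriv (M 0 0 * x + M 1 0 * y + M 2 0 * z) y
    (M 0 2 * x + M 1 2 * y + M 2 2 * z).
- move=> x z; have := FM (vec3 x 1 z).
  by rewrite vM !F_ev !expr1n !mulr1 !mul1r.
pose g : 'M[Fq]_2 := \matrix_(i, j)
  (if i == 0 then if j == 0 then A else B else if j == 0 then D else G).
have gE : ((g 0 0 = A) * (g 0 1 = B) * (g 1 0 = D) * (g 1 1 = G))%type by rewrite !mxE.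
have Mg : M = sq_mx g.
  apply: mx3_eq => x y z; rewrite vM mul_sq_mx !gE eA eAB eB eD eDG eG.
  by rewrite AG mul1r.
exists g => //; rewrite unitmxE.
by rewrite unitfE -(fmorph_eq0 iota) -sq_mx_det !gE AG oner_neq0.
Qed.

Lemma form_mx_normal (M : 'M[K]_3) c : M \in unitmx ->
  (forall v, ev F (v *m M) = c * ev F v) ->
  exists k (g : 'M[Fq]_2), [/\ k != 0, g \in unitmx & M = k *: sq_mx g].
Proof.
move=> uM FM; have [M0 M2] := Y_line_fixed uM FM.
have M1 : M 1 1 != 0.
  apply/eqP => m0; have := congr1 (fun v : 'rV[K]_3 => v 0 1) (mulmxKV uM (delta_mx 0 1)).
  rewrite mxE sum_ord3 M0 M2 m0 !mulr0 !addr0 mxE => /esym/eqP.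
  by rewrite oner_eq0.
have [|||g ug eg] := @form_mx_sq ((M 1 1)^-1 *: M) ((M 1 1)^-1 ^+ q.+1 * c).
- by rewrite unitmxZ // unitfE invr_eq0.
- by rewrite mxE mulVf.
- by move=> v; rewrite -scalemxAr (ev_homogZ _ _ F_homog) FM mulrA.
by exists (M 1 1), g; rewrite -eg scalerA mulfV // scale1r.
Qed.

(** * The isomorphism with [PGL_2(F_q)] *)

Lemma regular_linear (f : curve F -> curve F) M :
  (forall P, val (val (f P)) = <[cvec P *m M]>%VS) -> regular_map f.
Proof.
move=> fM P; exists 1%N, 0%N, 1, (mx_forms M).
split=> [|i||Q _]; [exact: dhomog1|exact: mx_forms_homog|by rewrite meval1 oner_neq0|].
have -> : tuple_eval (mx_forms M) (ccoord Q) = cvec Q *m M by rewrite -gev_mx_forms.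
split=> //; apply/eqP => e0.
by have := valP (val (f Q)); rewrite fM e0 dim_vline eqxx.
Qed.

Lemma sq_mx_unit g : g \in unitmx -> sq_mx g \in unitmx.
Proof.
move=> ug; apply: (proj1 (@mulmx1_unit _ _ _ (sq_mx (invmx g)) _)).
by rewrite -sq_mxM mulVmx // sq_mx1.
Qed.

Lemma linear_point g (P : curve F) : g \in unitmx ->
  exists Q : curve F, val (val Q) = <[cvec P *m sq_mx g]>%VS.
Proof.
move=> ug; apply: (point_exists F_homog); last by rewrite F_sq_mx cvec_on mulr0.
apply: contraNneq (cvec_neq0 P) => e0.
by rewrite -(mulmxK (sq_mx_unit ug) (cvec P)) e0 mul0mx.
Qed.

Definition sq_map (g : {'GL_2[Fq]}) (P : curve F) : curve F :=
  sval (cid (linear_point P (GL_unitmx g))).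

Lemma sq_mapE g P : val (val (sq_map g P)) = <[cvec P *m sq_mx (GLval g)]>%VS.
Proof. exact: svalP (cid (linear_point P (GL_unitmx g))). Qed.

Lemma sq_mapM g h : sq_map (g * h)%g =1 sq_map g \o sq_map h.
Proof.
move=> P; do 2!apply: val_inj; rewrite !sq_mapE.
have [c c0 e1] := span_cvec (sq_mapE h P).
have := cvec_neq0 (sq_map g (sq_map h P)).
have [d d0 ->] := span_cvec (sq_mapE g (sq_map h P)).
rewrite e1 -scalemxAl -mulmxA -sq_mxM => /[dup].
rewrite scaler_eq0 negb_or => /andP[_ n0] _; apply/esym/eqP/span_eqP.
  by apply: contraNneq n0 => ->; rewrite scaler0.
by exists c.
Qed.

Lemma sq_map1 : sq_map 1%g =1 id.
Proof.
move=> P; do 2!apply: val_inj; rewrite sq_mapE -[GLval _]/(1%:M : 'M_2) sq_mx1 mulmx1.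
by rewrite -cvec_span.
Qed.

Lemma sq_map_aut g : is_automorphism (sq_map g).
Proof.
split; first exact: regular_linear (sq_mapE g).
exists (sq_map g^-1); split; last exact: regular_linear (sq_mapE _).
- by move=> P; rewrite -[LHS]sq_mapM mulVg sq_map1.
- by move=> P; rewrite -[LHS]sq_mapM mulgV sq_map1.
Qed.

Definition sq_aut g : curveAut F := CurveAut (asboolT (sq_map_aut g)).

Lemma sq_autM : {morph sq_aut : g h / (g * h)%g}.
Proof. by move=> g h; apply: aut_eqP; apply/funext; exact: sq_mapM. Qed.

Lemma sq_aut_surj f : exists g, sq_aut g = f.
Proof.
have [rf [f' [fK f'K rf']]] := autP f.
have [M [s hM]] := aut_linear_generic rf rf' fK f'K.
have uM := aut_mx_unit f'K hM; have [c FM] := aut_mx_form hM.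
have [k [g [k0 ug eM]]] := form_mx_normal uM FM.
exists (Sub g ug : {'GL_2[Fq]}); apply: aut_eqP; apply/funext => P.
do 2!apply: val_inj; rewrite sq_mapE (aut_mx_all rf f'K hM) eM.
have e1 : GLval (Sub g ug : {'GL_2[Fq]}) = g by [].
rewrite e1; apply/esym/eqP/span_eqP; last by exists k; rewrite // -scalemxAr.
apply: contraNneq (cvec_neq0 P) => e0.
by rewrite -(mulmxK (sq_mx_unit ug) (cvec P)) e0 mul0mx.
Qed.

(** If [g] acts trivially, the 2 by 2 minors of the pair formed by the image of [v] and [v] are
    quadratic forms vanishing on [C], hence zero as [2 <= q]; evaluating them at a few vectors shows
    that [g] is scalar. Conversely a scalar [a] multiplies all coordinates by [a^2]. *)
Lemma sq_aut_ker g : sq_aut g = 1%g <-> g \in 'Z('GL_2[Fq])%g.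
Proof.
split=> [e1|/center_GL2P[a ga]]; last first.
  apply: aut_eqP; apply/funext => P; do 2!apply: val_inj; rewrite sq_mapE ga.
  have a0 : a != 0 by apply: contraNneq (GL_det g) => a0; rewrite ga a0 det_scalar expr0n.
  have -> : cvec P *m sq_mx a%:M = iota a ^+ 2 *: cvec P.
    rewrite (vec3_eta (cvec P)) mul_sq_mx !mxE !(mulr1n, mulr0n) rmorph0 vec3Z.
    congr (vec3 _ _ _); ring.
  rewrite [RHS]cvec_span; apply/eqP/span_eqP; first exact: cvec_neq0.
  by exists (iota a ^+ 2); rewrite // expf_neq0 // fmorph_eq0.
apply/center_GL2P; exists (GLval g 0 0).
pose T i : {mpoly K[3]} := tnth (mx_forms (sq_mx g)) i * 'X_1 - tnth (mx_forms (sq_mx g)) 1 * 'X_i.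
have evT i v : ev (T i) v = (v *m sq_mx g) 0 i * v 0 1 - (v *m sq_mx g) 0 1 * v 0 i.
  by rewrite mevalB !mevalM !evX -!gev_mx_forms !mxE.
have T0 i : T i = 0.
  apply: (@homog_vanish_small 2 _ [::]) => [||P _].
  - by rewrite rpredB // (@dhomogM_eq _ _ _ 1 1) ?mx_forms_homog ?homogX.
  - exact: leq_trans q_ge4.
  have := sq_mapE g P; rewrite -[sq_map g P]/(aut_fun (sq_aut g) P) e1 => /span_cvec[c c0].
  by rewrite evT; move: (_ *m _) => w ->; rewrite [in X in X - _]mxE [in X in _ - X]mxE; ring.
have T0v i (v : 'rV[K]_3) : (v *m sq_mx g) 0 i * v 0 1 = (v *m sq_mx g) 0 1 * v 0 i.
  by apply/eqP; rewrite -subr_eq0 -evT T0 meval0.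
have := T0v 0 (vec3 0 1 0); have := T0v 0 (vec3 0 1 1); have := T0v 0 (vec3 1 1 0).
have := T0v 2 (vec3 0 1 0); have := T0v 2 (vec3 1 1 0).
rewrite !mul_sq_mx !vec3E !(mulr0, mulr1, addr0, add0r) => e5 e4 e3 e2 e1'.
have b0 : iota (GLval g 0 1) = 0 by move: e2; rewrite e1' add0r => /eqP; rewrite sqrf_eq0 => /eqP.
have d0 : iota (GLval g 1 0) = 0 by move: e5; rewrite e4 addr0 => /eqP; rewrite sqrf_eq0 => /eqP.
have : iota (GLval g 0 0) * (iota (GLval g 0 0) - iota (GLval g 1 1)) = 0.
  by move: e3; rewrite b0 !(mulr0, mul0r, addr0) expr2 mulrBr => ->; rewrite subrr.
have := GL_det g; rewrite -(fmorph_eq0 iota) -sq_mx_det b0 mul0r addr0 mulf_eq0 => /norP[a0 _].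
move/eqP; rewrite mulf_eq0 (negPf a0) subr_eq0 => /eqP/fmorph_inj ad.
apply: mx2_eq; rewrite !mxE ?mulr1n ?mulr0n //.
- by apply: (fmorph_inj iota); rewrite b0 rmorph0.
- by apply: (fmorph_inj iota); rewrite d0 rmorph0.
Qed.

Lemma Aut_isomorphic : group_isomorphic (curveAut F) (PGL2 Fq).
Proof.
apply: (@quotient_isomorphic _ _ _ sq_aut) => [g|||].
- by apply: (fintype.subsetP (normal_norm (center_normal _))); rewrite finset.in_setT.
- exact: sq_autM.
- exact: sq_aut_surj.
exact: sq_aut_ker.
Qed.

Lemma Aut_cardinal : cardinal (curveAut F) = (q ^ 3 - q)%N.
Proof.
have [f [f_bij _]] := Aut_isomorphic.
by rewrite -card_Fq -card_PGL2; exact: cardinal_bij f_bij.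
Qed.

(** With [r = q (q - 1)] one has [84 (g - 1) <= 42 r] and [q^3 - q = r (q + 1)], which reduces the
    claim to [42 < q + 1]. *)
Lemma genus_lt : (64 <= q -> 84 * (q * (q - 1) %/ 2 - 1) < q ^ 3 - q)%N.
Proof.
move=> q64; have h : (2 * (q * (q - 1) %/ 2) <= q * (q - 1))%N by rewrite mulnC leq_trunc_div.
have -> : (q ^ 3 - q = q * (q - 1) * q.+1)%N.
  have -> : (q ^ 3 = q * (q - 1) * q.+1 + q)%N; last by rewrite addnK.
  by have := q_gt0; case: (q) => // n _; rewrite subn1 /=; ring.
have r0 : (0 < q * (q - 1))%N by rewrite muln_gt0 subn_gt0 q_gt0 q_gt1.
move: h r0; move: (q * (q - 1))%N => r h r0.
apply: (@leq_ltn_trans (42 * r)); first by clear -h; lia.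
by rewrite mulnC ltn_pmul2l // ltnS; exact: leq_trans q64.
Qed.

End Curve.

Theorem theorem1 (K : closedFieldType) (q e : nat)
    (Fq : finFieldType) (iota : {rmorphism Fq -> K}) (lambda : K)
    (charK : 2%N \in [pchar K]) (qE : q = (2 ^ e)%N) (q_ge4 : (4 <= q)%N)
    (card_Fq : #|Fq| = q) (lambda0 : lambda != 0) (lambda1 : lambda != 1) :
  let C := curve_form iota lambda in
  let gC := (q * (q - 1) %/ 2)%N in
  [/\ C \is (q.+1).-homog, smooth_curve C & has_genus C gC] /\
  group_isomorphic (curveAut C) (PGL2 Fq) /\
  cardinal (curveAut C) = (q ^ 3 - q)%N /\
  ((64 <= q)%N -> (84 * (gC - 1) < cardinal (curveAut C))%N).
Proof.
split; first split.
- exact: F_homog card_Fq.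
- exact: (F_smooth charK qE q_ge4 card_Fq lambda0 lambda1).
- exact: (F_genus iota charK qE q_ge4 card_Fq lambda0 lambda1).
split; first exact: (Aut_isomorphic iota charK qE q_ge4 card_Fq lambda0 lambda1).
rewrite (Aut_cardinal iota charK qE q_ge4 card_Fq lambda0 lambda1).
by split; last exact: genus_lt.
Qed.
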